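(* Let $X$ be a surface without boundary and let $G$ be a group with $\mathcal{H}_{c0}(X)\leq G\leq \mathcal{H}(X)$. Then the restriction to $G$ of the compact-open topology on $\mathcal{H}(X)$ is minimal, i.e. $G$ admits no Hausdorff group topology strictly coarser than this restricted compact-open topology.
   Context: A surface is a topological $2$-manifold. $\mathcal{H}(X)$ denotes the group of all homeomorphisms of $X$. The compact-open topology on $\mathcal{H}(X)$ is the topology generated by the sets $[K,U]=\{f\,|\,f(K)\subseteq U\}$ with $K\subseteq X$ compact and $U\subseteq X$ open. $\mathcal{H}_{c0}(X)$ is the subgroup of those $h\in\mathcal{H}(X)$ for which there is an isotopy $H:X\times[0,1]\to X$ (continuous, with each $H(-,t)$ a homeomorphism, $H(-,0)=h$, $H(-,1)=\mathrm{id}$) and a compact set $K\subseteq X$ such that every $H(-,t)$ is supported on $K$ (i.e. is the identity outside $K$). A Hausdorff group topology $\mathfrak{t}$ on a group is called minimal if the group admits no Hausdorff group topology strictly coarser than $\mathfrak{t}$. *)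

(* Defs.v *)
From HB Require Import structures.
From mathcomp Require Import all_boot all_order all_algebra.
From mathcomp Require Import all_classical all_reals all_analysis.
From mathcomp Require Import Rstruct Rstruct_topology.
Set Implicit Arguments. Unset Strict Implicit. Unset Printing Implicit Defensive.
Import Order.TTheory GRing.Theory Num.Theory.
Local Open Scope classical_set_scope.
Local Open Scope ring_scope.

Notation RR := Rdefinitions.R.

Definition locally_euclidean2 (X : topologicalType) : Prop :=
  forall x : X, exists (U : set X) (V : set (RR * RR)%type)
    (phi : X -> (RR * RR)%type) (psi : (RR * RR)%type -> X),
    [/\ open U, U x, open V & phi @` U = V] /\
    [/\ {within U, continuous phi}, {within V, continuous psi},
         (forall u, U u -> psi (phi u) = u) & (forall v, V v -> phi (psi v) = v)].

Definition surface_without_boundary (X : topologicalType) : Prop :=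
  [/\ hausdorff_space X, @second_countable X & locally_euclidean2 X].

Definition is_homeo (X : topologicalType) (f : X -> X) : Prop :=
  continuous f /\ exists g : X -> X,
    [/\ continuous g, cancel f g & cancel g f].

Definition in_Hc0 (X : topologicalType) (h : X -> X) : Prop :=
  is_homeo h /\
  exists (H : X -> RR -> X) (K : set X),
    [/\ {within [set p : (X * RR)%type | 0 <= p.2 <= 1],
           continuous (fun p : (X * RR)%type => H p.1 p.2)},
        (forall t : RR, 0 <= t <= 1 -> is_homeo (H ^~ t)),
        H ^~ 0 = h, H ^~ 1 = id
      & compact K /\
        (forall t : RR, 0 <= t <= 1 -> forall x, ~ K x -> H x t = x)].

Definition homeo_subgroup (X : topologicalType) (G : set (X -> X)) : Prop :=
  [/\ (forall f, G f -> is_homeo f), G id,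
      (forall f g, G f -> G g -> G (f \o g))
    & (forall f g, G f -> cancel f g -> cancel g f -> G g)].

Definition topology_on (T : Type) (G : set T) (tau : set (set T)) : Prop :=
  [/\ (forall W, tau W -> W `<=` G), tau set0, tau G,
      (forall W1 W2, tau W1 -> tau W2 -> tau (W1 `&` W2))
    & (forall F : set (set T), F `<=` tau -> tau (\bigcup_(W in F) W))].

Definition hausdorff_on (T : Type) (G : set T) (tau : set (set T)) : Prop :=
  forall f g, G f -> G g -> f <> g ->
    exists U V, [/\ tau U, tau V, U f, V g & U `&` V = set0].

Definition group_topology (X : Type) (G : set (X -> X))
    (tau : set (set (X -> X))) : Prop :=
  [/\ topology_on G tau,
      (forall f g, G f -> G g -> forall W, tau W -> W (f \o g) ->
         exists U V, [/\ tau U, tau V, U f, V g &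
           forall u v, U u -> V v -> W (u \o v)])
    & (forall f finv, G f -> cancel f finv -> cancel finv f ->
         forall W, tau W -> W finv ->
         exists U, tau U /\ U f /\
           forall u uinv, U u -> G uinv -> cancel u uinv -> cancel uinv u ->
             W uinv)].

Definition hausdorff_group_topology (X : Type) (G : set (X -> X))
    (tau : set (set (X -> X))) : Prop :=
  group_topology G tau /\ hausdorff_on G tau.

Definition co_sub (X : topologicalType) (K U : set X) : set (X -> X) :=
  [set f | f @` K `<=` U].

Definition compact_open_on (X : topologicalType) (G : set (X -> X)) :
    set (set (X -> X)) :=
  [set W | W `<=` G /\
    forall f, W f -> exists s : seq (set X * set X),
      [/\ (forall p, p \in s -> compact p.1 /\ open p.2),
          (forall p, p \in s -> co_sub p.1 p.2 f)
        & (forall g, G g -> (forall p, p \in s -> co_sub p.1 p.2 g) -> W g)]].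

Definition minimal_group_topology (X : Type) (G : set (X -> X))
    (tau : set (set (X -> X))) : Prop :=
  hausdorff_group_topology G tau /\
  forall sigma, hausdorff_group_topology G sigma -> sigma `<=` tau ->
    sigma = tau.

(* Main.v *)
(** The compact-open topology is a group topology because [X] is locally compact and locally a plane. Let [sigma] be a strictly coarser Hausdorff group topology. Then there are a point [x0] and an open [U] around it such that every [sigma]-neighbourhood [W] of the identity contains maps sending points arbitrarily close to [x0] outside [U]. Work in a chart at [x0]. If [g] in [W] is such a map, it cannot displace a given small box [B] (conjugation by [g] would make two noncommuting homeomorphisms supported in [B] commute, contradicting that [sigma] is Hausdorff), so [g B] is a connected set joining [B] to the unit sphere of the chart; a homeomorphism supported in [g B] is conjugate by [g] to one supported in [B], hence lies in [W W W]. Pushing along [g B], every [W] contains homeomorphisms supported in the chart that move the centre to one fixed other point.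

From here on the argument takes place in the plane. Rescaled copies of these maps, chained together, show that every neighbourhood [N] contains homeomorphisms sliding a point along the vertical axis inside a thin tube, and hence all homeomorphisms supported in a suitable (wild) neighbourhood [O] of an arc crossing a low slab. The arc is unknotted inside the slab: after approximating it by a simple lattice path, a path that is not straight has a U-shaped run, which is removed by elementary moves. Conjugating by the (small) product of the unknotting maps and by a bounded number of vertical compressions, [N] contains all homeomorphisms supported in some neighbourhood of the segment [{0} x [0, 1]]. Squeezing columns horizontally onto such neighbourhoods, [N] contains all homeomorphisms supported in a union of narrow columns, and a fixed vertical shear is a product of two of those, over even and odd columns. So this shear lies in every neighbourhood of the identity, which contradicts that [sigma] is Hausdorff. *)
Require Import Defs.
From HB Require Import structures.
From mathcomp Require Import all_boot all_order all_algebra.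
From mathcomp Require Import all_classical all_reals topology normedtype realfun.
From mathcomp Require Import Rstruct Rstruct_topology.
From mathcomp Require Import ring lra zify.
Set Implicit Arguments. Unset Strict Implicit. Unset Printing Implicit Defensive.
Import Order.TTheory GRing.Theory Num.Theory numFieldNormedType.Exports.
Local Open Scope classical_set_scope.
Local Open Scope ring_scope.

(** * Homeomorphisms and supports *)

(** A product of [k] maps lies in a neighbourhood [N] when its factors lie in some [M] that depends
    on [N] and [k], so [k] must be known before [M], and [M] before the factors. But the
    constructions need more pieces the finer they are, and the fineness is dictated by the
    neighbourhood. The way out: a product of maps with disjoint supports moves points no further
    than its factors do, whatever their number, so it is small if they are, and small maps are
    admissible because sigma is coarser than the compact-open topology. Conjugating maps are
    therefore controlled by smallness alone; this fixes the number of slabs or columns, and only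
    then is the neighbourhood chosen from which the individual factors are built. Unknotting is
    needed for the same reason: the arc is the image of a segment under a map known only through its
    membership in [N], its support and its effect on a point, and the straightening map is
    admissible only because it stays in a low thin slab. Hence all moves keep their support in the
    slab, and an explicit lattice argument takes the place of the Schoenflies theorem. *)

Record homeo (T : topologicalType) := Homeo {
  hfun :> T -> T;
  hinv : T -> T;
  hfun_cts : continuous hfun;
  hinv_cts : continuous hinv;
  hfunK : cancel hfun hinv;
  hinvK : cancel hinv hfun }.

Section HomeoGroup.
Variable T : topologicalType.
Implicit Types (f g : homeo T) (O : set T).

Definition hid : homeo T :=
  @Homeo T id id (fun x => cvg_id) (fun x => cvg_id) (fun x => erefl) (fun x => erefl).

Lemma comp_cts (f g : T -> T) : continuous f -> continuous g -> continuous (f \o g).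
Proof. by move=> cf cg x; apply: continuous_comp; [exact: cg|exact: cf]. Qed.

Definition hcomp f g : homeo T :=
  Homeo (comp_cts (hfun_cts (h:=f)) (hfun_cts (h:=g)))
        (comp_cts (hinv_cts (h:=g)) (hinv_cts (h:=f)))
        (can_comp (hfunK f) (hfunK g)) (can_comp (hinvK g) (hinvK f)).

Definition hopp f : homeo T :=
  Homeo (hinv_cts (h:=f)) (hfun_cts (h:=f)) (hinvK f) (hfunK f).

Definition hconj f g := hcomp f (hcomp g (hopp f)).

(** Support in the weak sense: [O] need not contain the closure of the moved points. This already
    makes [O] invariant under [f], and it passes to conjugates without taking closures. *)
Definition fixoff O f := forall z, ~ O z -> f z = z.

Lemma fixoffS O O' f : O `<=` O' -> fixoff O f -> fixoff O' f.
Proof. by move=> OO' fO z Oz; apply: fO => /OO'. Qed.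

Lemma fixoff_id O : fixoff O hid. Proof. by []. Qed.

Lemma fixoff_comp O f g : fixoff O f -> fixoff O g -> fixoff O (hcomp f g).
Proof. by move=> fO gO z Oz /=; rewrite gO// fO. Qed.

Lemma fixoff_opp O f : fixoff O f -> fixoff O (hopp f).
Proof. by move=> fO z Oz /=; rewrite -[in LHS](fO z Oz) hfunK. Qed.

Lemma hfun_inj f : injective f.
Proof. exact: can_inj (hfunK f). Qed.

Lemma fixoff_in O f z : fixoff O f -> O (f z) -> O z.
Proof.
move=> fO Ofz; apply: contrapT => Oz; apply: (Oz).
by rewrite -(fO z Oz).
Qed.

Lemma fixoff_stable O f z : fixoff O f -> O z -> O (f z).
Proof.
by move=> fO Oz; apply: (fixoff_in (fixoff_opp fO)); rewrite /= hfunK.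
Qed.

Lemma fixoff_conj O O' (h g : homeo T) : fixoff O g -> (forall u, O u -> O' (h u)) -> fixoff O' (hconj h g).
Proof.
move=> gO OO' z O'z /=; rewrite gO ?hinvK // => Oh.
by apply: O'z; rewrite -[z](hinvK h); exact: OO'.
Qed.

Lemma hfun_open f O : open O -> open [set z | O (f z)].
Proof. by move=> oO; exact: (open_comp (fun z _ => @hfun_cts _ f z) oO). Qed.

Lemma hinv_open f O : open O -> open [set z | O (hinv f z)].
Proof. by move=> oO; exact: (open_comp (fun z _ => @hinv_cts _ f z) oO). Qed.

Definition hprod (s : seq (homeo T)) := foldr hcomp hid s.

Lemma fixoff_prod O s : (forall f, List.In f s -> fixoff O f) -> fixoff O (hprod s).
Proof.
elim: s => [|f s IH] H //=; apply: fixoff_comp; first by apply: H; left.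
by apply: IH => g gs; apply: H; right.
Qed.

Lemma hprod_cat s1 s2 : hprod (s1 ++ s2) =1 hprod s1 \o hprod s2.
Proof. by elim: s1 => //= f s1 IH z /=; rewrite IH. Qed.

End HomeoGroup.
Arguments hid {T}.

(* [continuous f] is a notation that beta-reduces [f]; this constant keeps [f] visible to the syntax-directed tactic [cts]. *)
Definition ctsf (T U : topologicalType) (f : T -> U) : Prop := continuous f.
Lemma ctsfW (T U : topologicalType) (f : T -> U) : ctsf f -> continuous f.
Proof. by []. Qed.

Section Continuity.
Variables (R : realType) (T : topologicalType).
Local Notation P := (R * R)%type.
Implicit Types f g : T -> R.

Lemma ctsD f g : ctsf f -> ctsf g -> ctsf (fun x => f x + g x).
Proof. by move=> cf cg x; exact: (cvgD (cf x) (cg x)). Qed.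
Lemma ctsN f : ctsf f -> ctsf (fun x => - f x).
Proof. by move=> cf x; exact: (cvgN (cf x)). Qed.
Lemma ctsM f g : ctsf f -> ctsf g -> ctsf (fun x => f x * g x).
Proof. by move=> cf cg x; exact: (cvgM (cf x) (cg x)). Qed.
Lemma cts_norm f : ctsf f -> ctsf (fun x => `|f x|).
Proof. by move=> cf x; exact: (cvg_norm (cf x)). Qed.
Lemma cts_max f g : ctsf f -> ctsf g -> ctsf (fun x => Num.max (f x) (g x)).
Proof. by move=> cf cg x; exact: (continuous_max (cf x) (cg x)). Qed.
Lemma cts_min f g : ctsf f -> ctsf g -> ctsf (fun x => Num.min (f x) (g x)).
Proof. by move=> cf cg x; exact: (continuous_min (cf x) (cg x)). Qed.
Lemma cts_pair f g : ctsf f -> ctsf g -> ctsf (fun x => (f x, g x) : P).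
Proof. by move=> cf cg x; exact: (cvg_pair (cf x) (cg x)). Qed.
Lemma cts_fst (f : T -> P) : ctsf f -> ctsf (fun x => (f x).1).
Proof. by move=> cf x; apply: (cvg_comp f fst (cf x)); exact: cvg_fst. Qed.
Lemma cts_snd (f : T -> P) : ctsf f -> ctsf (fun x => (f x).2).
Proof. by move=> cf x; apply: (cvg_comp f snd (cf x)); exact: cvg_snd. Qed.
End Continuity.

Lemma cts_cst (T U : topologicalType) (a : U) : ctsf (fun _ : T => a).
Proof. by move=> x; apply: cvg_cst. Qed.
Lemma cts_id (T : topologicalType) : ctsf (fun x : T => x).
Proof. by move=> x; exact: cvg_id. Qed.
Lemma cts_comp (T U V : topologicalType) (f : U -> V) (g : T -> U) :
  continuous f -> ctsf g -> ctsf (fun x => f (g x)).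
Proof. by move=> cf cg x; apply: (cvg_comp g f (cg x)); exact: cf. Qed.

Ltac cts_step := lazymatch goal with |- ctsf ?F =>
  lazymatch F with
  | (fun x => x) => exact: cts_id
  | (fun _ => ?a) => exact: cts_cst
  | (fun x => (@?f x, @?g x)) => apply: (@cts_pair _ _ f g)
  | (fun x => (@?f x).1) => apply: (@cts_fst _ _ f)
  | (fun x => (@?f x).2) => apply: (@cts_snd _ _ f)
  | (fun x => @?f x + @?g x) => apply: (@ctsD _ _ f g)
  | (fun x => @?f x * @?g x) => apply: (@ctsM _ _ f g)
  | (fun x => - @?f x) => apply: (@ctsN _ _ f)
  | (fun x => `|@?f x|) => apply: (@cts_norm _ _ f)
  | (fun x => Num.max (@?f x) (@?g x)) => apply: (@cts_max _ _ f g)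
  | (fun x => Num.min (@?f x) (@?g x)) => apply: (@cts_min _ _ f g)
  | (fun x => hfun ?h (@?g x)) => apply: (@cts_comp _ _ _ (hfun h) g (@hfun_cts _ h))
  | (fun x => hinv ?h (@?g x)) => apply: (@cts_comp _ _ _ (hinv h) g (@hinv_cts _ h))
  | (fun x => ?k (@?g x)) => apply: (@cts_comp _ _ _ k g); first assumption
  | _ => assumption
  end end.
Ltac cts := lazymatch goal with |- ctsf _ => idtac | _ => apply: ctsfW end; repeat cts_step.

Ltac maxmin := repeat match goal with
  | |- context [Num.min ?a ?b] => case: (leP a b) => ?
  | |- context [Num.max ?a ?b] => case: (ltP a b) => ? end.

(** * Boxes in the plane and row-preserving homeomorphisms *)

Section Plane.
Variable R : realType.
Local Notation P := (R * R)%type.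
Implicit Types (z w : P).

Definition bx (z : P) (r : R) : set P := [set w | `|w.1 - z.1| < r /\ `|w.2 - z.2| < r].

Lemma bx_ball z r : bx z r = ball z r.
Proof.
apply/seteqP; split => w; rewrite /bx /ball /= /prod_ball /ball /=;
  by rewrite (distrC w.1) (distrC w.2).
Qed.

Lemma bx_open z r : open (bx z r).
Proof. by rewrite bx_ball; exact: ball_open. Qed.

Lemma open_bx (O : set P) z : open O -> O z -> exists2 r, 0 < r & bx z r `<=` O.
Proof.
move=> oO Oz; have /nbhs_ballP[r r0 rO] : nbhs z O by exact: open_nbhs_nbhs.
by exists r => //; rewrite bx_ball.
Qed.

Lemma bx_self z r : 0 < r -> bx z r z.
Proof. by move=> r0; rewrite /bx /= !subrr normr0. Qed.

Lemma bxS z r s : r <= s -> bx z r `<=` bx z s.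
Proof. by move=> rs w [h1 h2]; split; apply: lt_le_trans rs. Qed.

Lemma nbhs_bx z (A : set P) : nbhs z A <-> exists2 r, 0 < r & bx z r `<=` A.
Proof.
split; first by move=> /nbhs_ballP[r r0 rA]; exists r => //; rewrite bx_ball.
by move=> [r r0 rA]; apply/nbhs_ballP; exists r => //; rewrite -bx_ball.
Qed.

Lemma ctsP_bx (f : P -> P) : continuous f <->
  forall z e, 0 < e -> exists2 d, 0 < d & forall w, bx z d w -> bx (f z) e (f w).
Proof.
split=> [cf z e e0|H z A /nbhs_bx[e e0 eA]].
  have /cf/nbhs_bx[d d0 dA] : nbhs (f z) (bx (f z) e) by apply/nbhs_bx; exists e.
  by exists d.
have [d d0 dA] := H z e e0.
by apply/nbhs_bx; exists d => // w /dA /eA.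
Qed.

Lemma ctsP_R (f : P -> R) : continuous f ->
  forall z e, 0 < e -> exists2 d, 0 < d & forall w, bx z d w -> `|f w - f z| < e.
Proof.
move=> cf z e e0.
have /cf/nbhs_bx[d d0 dA] : nbhs (f z) (ball (f z) e) by apply/nbhs_ballP; exists e.
by exists d => // w /dA; rewrite /= distrC.
Qed.

Section Shear.
Variables (phi : P -> R) (C : R).
Hypothesis cphi : continuous phi.
Hypothesis iphi : forall y x x', x < x' -> phi (x, y) < phi (x', y).
Hypothesis bphi : forall z, `|phi z - z.1| <= C.

Let hs_fun z : P := (phi z, z.2).

(** [phi] stays within [C] of the first coordinate, so its values at [z.1 - C] and [z.1 + C] enclose
    [z.1]. *)
Let hs_ex z : exists x, phi (x, z.2) = z.1.
Proof.
have C0 : 0 <= C by apply: le_trans (bphi (0, 0)).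
have [] := @IVT R (fun x => phi (x, z.2)) (z.1 - C) (z.1 + C) z.1.
- lra.
- by apply: continuous_subspaceT; apply: (ctsfW (f := fun x => phi (x, z.2))); cts.
- have := bphi (z.1 - C, z.2); have := bphi (z.1 + C, z.2).
  rewrite !ler_norml /= => /andP[h1 h2] /andP[h3 h4].
  rewrite ge_min le_max; apply/andP; split; apply/orP; [left|right]; lra.
- by move=> c _ <-; exists c.
Qed.

Let hs_x z := projT1 (cid (hs_ex z)).
Let hs_xE z : phi (hs_x z, z.2) = z.1.
Proof. exact: projT2 (cid (hs_ex z)). Qed.
Let hs_inv z : P := (hs_x z, z.2).

Let iphi_le y x x' : phi (x, y) < phi (x', y) -> x < x'.
Proof.
move=> H; rewrite ltNge; apply/negP => xx.
move: xx; rewrite le_eqVlt => /orP[/eqP E|/(iphi y) E]; first by move: H; rewrite E ltxx.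
by move: (lt_trans H E); rewrite ltxx.
Qed.

Let hs_fun_cts : continuous hs_fun. Proof. by apply: (ctsfW (f := fun z => (phi z, z.2))); cts. Qed.

(** By strict monotonicity the solution on the row of [w] lies between [x - e] and [x + e] as soon
    as the values of [phi] at these two abscissas straddle [w.1], which is an open condition on
    [w]. *)
Let hs_inv_cts : continuous hs_inv.
Proof.
apply/ctsP_bx => z e e0.
set x := hs_x z; have xE : phi (x, z.2) = z.1 by exact: hs_xE.
have h1 : phi (x - e, z.2) < z.1 by rewrite -xE; apply: iphi; lra.
have h2 : z.1 < phi (x + e, z.2) by rewrite -xE; apply: iphi; lra.
pose d := Num.min (z.1 - phi (x - e, z.2)) (phi (x + e, z.2) - z.1) / 2.
have d0 : 0 < d by rewrite /d divr_gt0 // lt_min; apply/andP; split; lra.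
have [dl dl0 Hl] := ctsP_R cphi (x - e, z.2) d0.
have [dr dr0 Hr] := ctsP_R cphi (x + e, z.2) d0.
have [hd1 hd2] : d * 2 <= z.1 - phi (x - e, z.2) /\ d * 2 <= phi (x + e, z.2) - z.1.
  have -> : d * 2 = Num.min (z.1 - phi (x - e, z.2)) (phi (x + e, z.2) - z.1) by rewrite /d divfK ?pnatr_eq0.
  by split; rewrite ge_min lexx ?orbT.
exists (Num.min (Num.min d e) (Num.min dl dr)); first by rewrite !lt_min d0 dl0 dr0 e0.
move=> w [/=]; rewrite !lt_min => /andP[/andP[w1 _] _] /andP[/andP[_ we] /andP[w3 w4]].
split => //=.
have := Hl (x - e, w.2); rewrite /bx /= subrr normr0 => /(_ (conj dl0 w3)).
have := Hr (x + e, w.2); rewrite /bx /= subrr normr0 => /(_ (conj dr0 w4)).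
move: w1; rewrite !ltr_norml => /andP[a1 a2] /andP[a3 a4] /andP[a5 a6].
have xw := hs_xE w.
have /iphi_le : phi (x - e, w.2) < phi (hs_x w, w.2) by rewrite xw; lra.
have /iphi_le : phi (hs_x w, w.2) < phi (x + e, w.2) by rewrite xw; lra.
by move=> b1 b2; rewrite -/x; apply/andP; split; lra.
Qed.

Let hs_funK : cancel hs_fun hs_inv.
Proof.
move=> [x y]; rewrite /hs_inv /hs_fun /=; congr pair.
have := hs_xE (phi (x, y), y) => /= E.
by have [/(iphi y)|/(iphi y)|//] := ltgtP (hs_x (phi (x, y), y)) x; rewrite E ltxx.
Qed.

Let hs_invK : cancel hs_inv hs_fun.
Proof. by move=> [x y]; rewrite /hs_inv /hs_fun /= hs_xE. Qed.

Definition hshear : homeo P := Homeo hs_fun_cts hs_inv_cts hs_funK hs_invK.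

End Shear.
End Plane.

(** * Explicit shears, pushes of a point, and orbits in open sets *)

Section Shears.
Variable R : realType.
Local Notation P := (R * R)%type.
Implicit Types (z w : P).

Definition affmap (A al be : P) (z : P) : P :=
  (A.1 + z.1 * al.1 + z.2 * be.1, A.2 + z.1 * al.2 + z.2 * be.2).
Definition affinv (A al be : P) (w : P) : P :=
  let D := (al.1 * be.2 - al.2 * be.1)^-1 in
  (((w.1 - A.1) * be.2 - (w.2 - A.2) * be.1) * D,
   (al.1 * (w.2 - A.2) - al.2 * (w.1 - A.1)) * D).

Lemma aff_ex (A al be : P) : al.1 * be.2 - al.2 * be.1 != 0 ->
  exists h : homeo P, hfun h = affmap A al be /\ hinv h = affinv A al be.
Proof.
move=> D0.
have c1 : ctsf (affmap A al be) by rewrite /affmap; cts.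
have c2 : ctsf (affinv A al be) by rewrite /affinv; cts.
have k1 : cancel (affmap A al be) (affinv A al be).
  by move=> [x y]; rewrite /affmap /affinv /=; congr pair; field.
have k2 : cancel (affinv A al be) (affmap A al be).
  by move=> [x y]; rewrite /affmap /affinv /=; congr pair; field.
by exists (Homeo c1 c2 k1 k2).
Qed.

Lemma hshear_ex (s m : R -> R) (C : R) : continuous s -> continuous m ->
  (forall y x x', x < x' -> x + s y * m x < x' + s y * m x') ->
  (forall y x, `|s y * m x| <= C) ->
  exists h : homeo P, forall z, h z = (z.1 + s z.2 * m z.1, z.2).
Proof.
move=> cs cm im bm.
have cphi : continuous (fun z : P => z.1 + s z.2 * m z.1).
  by cts.
have iphi y x x' : x < x' ->
   (fun z : P => z.1 + s z.2 * m z.1) (x, y) < (fun z : P => z.1 + s z.2 * m z.1) (x', y).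
  exact: im.
have bphi z : `|(fun z : P => z.1 + s z.2 * m z.1) z - z.1| <= C.
  by rewrite /= addrAC subrr add0r.
by exists (hshear cphi iphi bphi).
Qed.

Lemma swap_ex : exists w : homeo P, forall z, w z = (z.2, z.1) /\ hinv w z = (z.2, z.1).
Proof.
have c : ctsf (fun z : P => (z.2, z.1)) by cts.
have k : cancel (fun z : P => (z.2, z.1)) (fun z : P => (z.2, z.1)) by case.
by exists (Homeo c c k k).
Qed.

Lemma vshear_ex (s m : R -> R) (C : R) : continuous s -> continuous m ->
  (forall x y y', y < y' -> y + s x * m y < y' + s x * m y') ->
  (forall x y, `|s x * m y| <= C) ->
  exists h : homeo P, forall z, h z = (z.1, z.2 + s z.1 * m z.2).
Proof.
move=> cs cm im bm; have [h hE] := hshear_ex cs cm im bm.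
have [w wE] := swap_ex.
by exists (hconj w h) => z /=; rewrite (wE z).2 hE (wE _).1.
Qed.

Lemma lip_mono (s : R) (m : R -> R) : `|s| < 1 ->
  (forall x x', `|m x - m x'| <= `|x - x'|) ->
  forall x x', x < x' -> x + s * m x < x' + s * m x'.
Proof.
move=> s1 ml x x' xx; rewrite -subr_gt0.
have -> : x' + s * m x' - (x + s * m x) = (x' - x) - s * (m x - m x') by ring.
rewrite subr_gt0; apply: (le_lt_trans (ler_norm _)); rewrite normrM.
have x0 : 0 < x' - x by rewrite subr_gt0.
have : `|s| * `|m x - m x'| <= `|s| * `|x - x'| by apply: ler_wpM2l.
move/le_lt_trans; apply; rewrite distrC (gtr0_norm x0).
by rewrite gtr_pMl.
Qed.

Lemma hlip_ex (s m : R -> R) (C : R) : continuous s -> continuous m ->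
  (forall y, `|s y| < 1) -> (forall x x', `|m x - m x'| <= `|x - x'|) ->
  (forall x, `|m x| <= C) ->
  exists h : homeo P, forall z, h z = (z.1 + s z.2 * m z.1, z.2).
Proof.
move=> cs cm s1 ml mC; apply: (@hshear_ex s m C) => //.
  by move=> y x x'; exact: lip_mono.
move=> y x; rewrite normrM; apply: (le_trans _ (mC x)).
by rewrite ler_piMl// ltW.
Qed.

Lemma vlip_ex (s m : R -> R) (C : R) : continuous s -> continuous m ->
  (forall y, `|s y| < 1) -> (forall x x', `|m x - m x'| <= `|x - x'|) ->
  (forall x, `|m x| <= C) ->
  exists h : homeo P, forall z, h z = (z.1, z.2 + s z.1 * m z.2).
Proof.
move=> cs cm s1 ml mC; apply: (@vshear_ex s m C) => //.
  by move=> y x x'; exact: lip_mono.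
move=> y x; rewrite normrM; apply: (le_trans _ (mC x)).
by rewrite ler_piMl// ltW.
Qed.

Definition tent (r u : R) := Num.max 0 (r - `|u|).

Lemma tent_cts r c : continuous (fun u => tent r (u - c)).
Proof. by apply: (ctsfW (f := fun u => Num.max 0 (r - `|u - c|))); cts. Qed.

Lemma tentk_cts r c k q : continuous (fun u => k * (tent r (u - c) / q)).
Proof. by apply: (ctsfW (f := fun u => k * (Num.max 0 (r - `|u - c|) / q))); cts. Qed.

Lemma tent_ge0 r u : 0 <= tent r u.
Proof. by rewrite /tent le_max lexx. Qed.

Lemma tent_le r u : 0 <= r -> tent r u <= r.
Proof. by move=> r0; rewrite /tent ge_max r0 gerBl normr_ge0. Qed.

Lemma tent_off r u : r <= `|u| -> tent r u = 0.
Proof. by move=> ru; rewrite /tent; apply/max_idPl; rewrite subr_le0. Qed.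

Lemma tent0 r : 0 <= r -> tent r 0 = r.
Proof. by move=> r0; rewrite /tent normr0 subr0; apply/max_idPr. Qed.

Lemma tent_lip r u v : `|tent r u - tent r v| <= `|u - v|.
Proof.
have H a b : tent r a - tent r b <= `|a - b|.
  rewrite /tent; have := ler_dist_dist b a; rewrite ler_norml => /andP[h _].
  have := lerB_dist b a; rewrite (distrC b a) => h2.
  have := normr_ge0 (a - b) => h3.
  rewrite lerBlDr ge_max; apply/andP; split.
    by apply: addr_ge0 => //; rewrite le_max lexx.
  apply: (@le_trans _ _ (`|a - b| + (r - `|b|))); first by lra.
  by rewrite lerD2l le_max lexx orbT.
rewrite ler_norml H andbT lerNl opprB distrC; exact: H.
Qed.

(** A shear whose displacement is a product of two tents centred at [z]: its slope along rows is at
    most [|x - z.1| / r < 1], so rows are mapped injectively. Preservation of rows is what lets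
    [slab] straighten the end of an arc without changing heights. *)
Lemma hpush (z : P) (x r q : R) : `|x - z.1| < r -> 0 < q -> exists f : homeo P,
  [/\ fixoff [set w | `|w.1 - z.1| < r /\ `|w.2 - z.2| < q] f, f z = (x, z.2) &
     forall w, (f w).2 = w.2].
Proof.
move=> h1 q0; have r0 : 0 < r by apply: le_lt_trans h1.
have lipt (c u u' : R) : `|tent r (u - c) - tent r (u' - c)| <= `|u - u'|.
  by have := tent_lip r (u - c) (u' - c); have -> : u - c - (u' - c) = u - u' by ring.
have [f fE] : exists h : homeo P, forall w, h w =
   (w.1 + (x - z.1) / r * (tent q (w.2 - z.2) / q) * tent r (w.1 - z.1), w.2).
  apply: (@hlip_ex (fun y => (x - z.1) / r * (tent q (y - z.2) / q)) (fun x => tent r (x - z.1)) r).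
  - by apply: tentk_cts.
  - exact: tent_cts.
  - move=> y; rewrite !normrM !normfV (gtr0_norm r0) (gtr0_norm q0) (ger0_norm (tent_ge0 _ _)).
    have t1 : tent q (y - z.2) / q <= 1 by rewrite ler_pdivrMr ?mul1r// tent_le// ltW.
    have t0 : 0 <= tent q (y - z.2) / q by rewrite divr_ge0 ?tent_ge0 ?ltW.
    have d1 : `|x - z.1| / r < 1 by rewrite ltr_pdivrMr ?mul1r.
    by apply: le_lt_trans d1; rewrite ler_piMr// divr_ge0 ?normr_ge0 ?(ltW r0).
  - by move=> u u' /=; apply: lipt.
  - by move=> u; rewrite (ger0_norm (tent_ge0 _ _)) tent_le// ltW.
exists f; split.
- move=> w wO; rewrite fE; case: (ltP `|w.2 - z.2| q) => w2; last first.
    by rewrite (tent_off w2) mul0r mulr0 mul0r addr0; case: (w).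
  have w1 : r <= `|w.1 - z.1| by rewrite leNgt; apply/negP => w1; apply: wO.
  by rewrite (tent_off w1) mulr0 addr0; case: (w).
- rewrite fE !subrr !tent0 ?ltW // divff ?gt_eqF // mulr1 divfK ?gt_eqF //.
  by congr pair; ring.
- by move=> w; rewrite fE.
Qed.

Lemma vpush (z : P) (y r q : R) : `|y - z.2| < r -> 0 < q -> exists2 f : homeo P,
  fixoff [set w | `|w.1 - z.1| < q /\ `|w.2 - z.2| < r] f & f z = (z.1, y).
Proof.
move=> h q0; have [f [fO fz _]] := @hpush (z.2, z.1) y r q h q0.
have [w wE] := swap_ex; exists (hconj w f).
  by apply: (fixoff_conj fO) => u [u1 u2]; rewrite (wE u).1.
by rewrite /= (wE z).2 fz (wE _).1.
Qed.

Lemma box_push z z' r : bx z r z' -> exists2 h : homeo P, fixoff (bx z r) h & h z = z'.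
Proof.
move=> [h1 h2]; have r0 : 0 < r by apply: le_lt_trans h1.
have [f [fO fz _]] := hpush h1 r0.
(* The vertical push takes place around the abscissa [z'.1]; this half-width keeps it inside the
   box. *)
have q0 : 0 < r - `|z'.1 - z.1| by rewrite subr_gt0.
have [g gO gz] := @vpush (z'.1, z.2) z'.2 r (r - `|z'.1 - z.1|) h2 q0.
exists (hcomp g f); last by rewrite /= fz gz; case: (z').
apply: fixoff_comp => //; apply: (fixoffS _ gO) => w [/= w1 w2]; split => //=.
by have := ler_distD z'.1 w.1 z.1; lra.
Qed.

Definition reach (O : set P) z z' := exists2 h : homeo P, fixoff O h & h z = z'.

Lemma reach_refl O z : reach O z z. Proof. by exists hid. Qed.
Lemma reach_sym O z z' : reach O z z' -> reach O z' z.
Proof.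
by move=> [h hO <-]; exists (hopp h); [exact: fixoff_opp|rewrite /= hfunK].
Qed.
Lemma reach_trans O z1 z2 z3 : reach O z1 z2 -> reach O z2 z3 -> reach O z1 z3.
Proof.
by move=> [f fO <-] [g gO <-]; exists (hcomp g f) => //; exact: fixoff_comp.
Qed.
Lemma reachS O O' z z' : O `<=` O' -> reach O z z' -> reach O' z z'.
Proof. by move=> OO [h hO hz]; exists h => //; exact: fixoffS hO. Qed.

Lemma reach_near O z : open O -> O z -> exists2 r, 0 < r & forall w, bx z r w -> reach O z w.
Proof.
move=> oO Oz; have [r r0 rO] := open_bx oO Oz; exists r => // w /box_push.
exact: reachS.
Qed.

(** The class of [a] is open by the local hypothesis, and so is its complement by symmetry; the
    interval being connected, the class is everything. Used both for orbits of points and for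
    lattice walks. *)
Lemma itv_equiv (E : R -> R -> Prop) (a b : R) : a <= b ->
  (forall s t u, E s t -> E t u -> E s u) -> (forall s t, E s t -> E t s) -> E a a ->
  (forall t, a <= t <= b -> exists2 r, 0 < r & forall u, a <= u <= b -> `|t - u| < r -> E t u) ->
  E a b.
Proof.
move=> ab tr sy Ea loc.
pose I := `[a, b]%classic : set R.
have IE t : I t = (a <= t <= b) :> Prop by rewrite /I /= in_itv.
pose r t := if pselect (a <= t <= b) is left H then projT1 (cid2 (loc t H)) else 1.
have rP t : a <= t <= b -> 0 < r t /\ forall u, a <= u <= b -> `|t - u| < r t -> E t u.
  by rewrite /r; case: pselect => // H _; case: (cid2 (loc t H)).
pose B := [set t | I t /\ E a t].
have BI : B = I.
  have Ia : I a by rewrite IE lexx.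
  apply: (@segment_connected R a b B); first by exists a.
  - exists (\bigcup_(u in B) ball u (r u)).
      by apply: bigcup_open => u _; exact: ball_open.
    apply/seteqP; split => t; first by move=> Bt; split; [exact: Bt.1|exists t => //; apply: ballxx; have [] := rP t _ => //; have := Bt.1; rewrite IE].
    move=> [It [u [Iu Eu] tu]]; split => //; apply: (tr _ _ _ Eu).
    by have [_] := rP u ltac:(by rewrite -IE); apply => //; rewrite -IE.
  - exists (~` \bigcup_(u in I `\` B) ball u (r u)).
      by apply: open_closedC; apply: bigcup_open => u _; exact: ball_open.
    apply/seteqP; split => t.
      move=> [It Et]; split => // -[u [Iu Bu] tu]; apply: Bu; split => //.
      apply: (tr _ _ _ Et); apply: sy.
      by have [_] := rP u ltac:(by rewrite -IE); apply => //; rewrite -IE.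
    move=> [It H]; apply: contrapT => Bt; apply: H; exists t => //.
    by apply: ballxx; have [] := rP t ltac:(by rewrite -IE).
have : B b by rewrite BI IE ab lexx.
by case.
Qed.

(** Orbits of the homeomorphisms supported in [O] are open, because a point can be pushed anywhere
    in a small box around it; a path therefore stays in one orbit. *)
Lemma path_reach O (c : R -> P) (a b : R) : open O -> continuous c -> a <= b ->
  (forall t, a <= t <= b -> O (c t)) -> reach O (c a) (c b).
Proof.
move=> oO cc ab cO.
apply: (@itv_equiv (fun s t => reach O (c s) (c t))) => //.
- by move=> s t u; exact: reach_trans.
- by move=> s t; exact: reach_sym.
- exact: reach_refl.
move=> t It; have [e e0 He] := @reach_near O (c t) oO (cO t It).
have /cc : nbhs (c t) (bx (c t) e) by apply/nbhs_bx; exists e.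
by move=> /nbhs_ballP[r r0 rH]; exists r => // u _ /rH; exact: He.
Qed.

End Shears.

(** * Two elementary moves in the unit square *)

Section Squares.
Variable R : realType.
Local Notation P := (R * R)%type.
Implicit Types (z w : P).

(** A Lebesgue number for the curve, from compactness of [[0, 1]] in its near-covering form, with
    radii tending to 0 from the right. Halving the radius absorbs the variation of [c] near [t]. *)
Lemma path_thick (c : R -> P) (V : set P) : open V -> ctsf c ->
  (forall t : R, 0 <= t <= 1 -> V (c t)) ->
  exists2 e, 0 < e & forall t : R, 0 <= t <= 1 -> bx (c t) e `<=` V.
Proof.
move=> oV cc cV.
have := @segment_compact R 0 1; rewrite compact_near_coveringP => cK.
have := @cK R (at_right 0) (fun e t => bx (c t) e `<=` V) _.
move=> /(_ _)[].
  move=> t; rewrite /= in_itv /= => It.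
  have [r r0 rV] := open_bx oV (cV t It).
  have r2 : 0 < r / 2 by lra.
  have /cc /nbhs_ballP[d d0 dH] : nbhs (c t) (bx (c t) (r / 2)) by apply/nbhs_bx; exists (r / 2).
  exists (ball t d, [set e | e < r / 2]).
    split => /=; first exact: nbhsx_ballx.
    by exists (r / 2) => // e /=; rewrite sub0r normrN => h1 h2; move: h1; rewrite gtr0_norm.
  move=> [t' e] /= [/dH [h1 h2] er] w [h3 h4]; apply: rV; split.
    by have := ler_distD (c t').1 w.1 (c t).1; rewrite /= in h1 h2; lra.
  by have := ler_distD (c t').2 w.2 (c t).2; rewrite /= in h1 h2; lra.
move=> d /= d0 H; exists (d / 2); first by rewrite divr_gt0.
move=> t It; apply: (H (d / 2)) => /=.
- by rewrite sub0r normrN gtr0_norm; rewrite ?divr_gt0//; move: d0 => /= d0; lra.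
- by rewrite divr_gt0.
- by rewrite in_itv.
Qed.

(** [ramp 1 2 1 (- k)] is the hat of height 1 at 0 that vanishes at [- 1 / 2] and at [1 / k]. Only
    its falling side limits the shear, so the rising side may be steep, which keeps the support to
    the right of [- 1 / 2]. *)
Definition ramp (a b c d : R) (x : R) := Num.max 0 (Num.min (a + b * x) (c + d * x)).

(** For nonnegative [s] only the descent of [m] can destroy monotonicity, hence the one-sided slope
    bound. *)
Lemma bump_mono (s c : R) (m : R -> R) : 0 <= s -> s * c < 1 ->
  (forall x x', x < x' -> m x - m x' <= c * (x' - x)) ->
  forall x x', x < x' -> x + s * m x < x' + s * m x'.
Proof.
move=> s0 sc H x x' xx; have h := H _ _ xx.
have : s * (m x - m x') <= s * (c * (x' - x)) by rewrite ler_wpM2l.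
have : s * c * (x' - x) < 1 * (x' - x) by rewrite ltr_pM2r // subr_gt0.
lra.
Qed.

Lemma hbump_ex (s m : R -> R) (c : R) : continuous s -> continuous m ->
  (forall y, 0 <= s y) -> (forall y, s y <= 1) -> (forall y, s y * c < 1) ->
  (forall x x', x < x' -> m x - m x' <= c * (x' - x)) ->
  (forall x, 0 <= m x <= 1) ->
  exists h : homeo P, forall z, h z = (z.1 + s z.2 * m z.1, z.2).
Proof.
move=> cs cm s0 s1 sc H m1; apply: (@hshear_ex _ s m 1) => //.
  by move=> y x x'; apply: (@bump_mono (s y) c m).
move=> y x; have /andP[a b] := m1 x.
by rewrite ger0_norm ?mulr_ge0// -[1]mulr1; apply: ler_pM.
Qed.

Lemma ramp_cts a b c d : continuous (ramp a b c d).
Proof.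
by apply: (ctsfW (f := fun x => Num.max 0 (Num.min (a + b * x) (c + d * x)))); cts.
Qed.

(** Open rectangles around the part of the unit square that a move changes, small enough to miss
    every lattice edge except those found in [edge_cap] and [edge_corner]. *)
Definition cap_region := [set z : P | - 1 / 2 < z.1 < 3 / 2 /\ 0 < z.2 < 1].
Definition corner_region := [set z : P | - 1 / 2 < z.1 < 1 /\ 0 < z.2 < 3 / 2].

Lemma ramp_mono k (x x' : R) : k = 2 / 3 \/ k = 1 -> x < x' ->
  ramp 1 2 1 (- k) x - ramp 1 2 1 (- k) x' <= k * (x' - x).
Proof. by move=> [] -> xx; rewrite /ramp; maxmin; lra. Qed.

Lemma ramp_01 k (x : R) : k = 2 / 3 \/ k = 1 -> 0 <= ramp 1 2 1 (- k) x <= 1.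
Proof. by move=> [] ->; rewrite /ramp; maxmin; lra. Qed.

Lemma ramp_off k (x : R) : k = 2 / 3 \/ k = 1 -> ~ (- 1 / 2 < x /\ x * k < 1) ->
  ramp 1 2 1 (- k) x = 0.
Proof. by move=> [] -> H; rewrite /ramp; maxmin => //; exfalso; apply: H; split; lra. Qed.

Lemma ramp_at0 k : ramp 1 2 1 (- k) 0 = 1.
Proof. by rewrite /ramp !mulr0 !addr0 minxx; apply/max_idPr. Qed.

(** The left side is sheared onto the right one: the displacement [s y] is 1 for heights in
    [[e, 1 - e]] and falls to 0 at the corners, where the image stays within [e] of the horizontal
    sides. [2 / 3] is a slope below 1 that brings the ramp to 0 at [3 / 2]. *)
Lemma square_cap (V : set P) : open V ->
  (forall t : R, 0 <= t <= 1 -> [/\ V (t, 0), V (1, t) & V (t, 1)]) ->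
  exists2 f : homeo P, fixoff cap_region f & forall y : R, 0 <= y <= 1 -> V (f (0, y)).
Proof.
move=> oV HV.
have [|t|e1 e10 H1] := @path_thick (fun t : R => (t, 0)) V oV; first by cts.
  by move=> /HV[].
have [|t|e2 e20 H2] := @path_thick (fun t : R => (t, 1)) V oV; first by cts.
  by move=> /HV[].
pose e := Num.min (1/2) (Num.min e1 e2).
have e0 : 0 < e by rewrite !lt_min e10 e20; apply/andP; split => //; lra.
have [ee1 ee2] : e <= e1 /\ e <= e2 by rewrite /e !ge_min !lexx !orbT.
have e12 : e <= 1 / 2 by rewrite /e ge_min lexx.
pose s := fun y : R => Num.max 0 (Num.min 1 (Num.min (2 * y / e) (2 * (1 - y) / e))).
have cs : continuous s by apply: ctsfW; rewrite /s; cts.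
have s0 y : 0 <= s y by rewrite /s le_max lexx.
have s1 y : s y <= 1 by rewrite /s ge_max ge_min lexx ler01.
have [|||f fE] := @hbump_ex s (ramp 1 2 1 (- (2 / 3))) (2 / 3) cs (@ramp_cts _ _ _ _) s0 s1.
- by move=> y; have := s1 y; lra.
- by move=> x x'; apply: ramp_mono; auto.
- by move=> x; apply: ramp_01; auto.
exists f.
  move=> [x y] /= H; rewrite fE /=; congr pair.
  case: (boolP (0 < y < 1)) => hy.
    have r0 : ramp 1 2 1 (- (2 / 3)) x = 0.
      by apply: ramp_off; [auto|move=> [h1 h2]; apply: H; split => //=; lra].
    by rewrite r0 mulr0 addr0.
  rewrite (_ : s y = 0) ?mul0r ?addr0 // /s.
  apply/max_idPl; rewrite !ge_min; apply/orP; right.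
  rewrite !ler_pdivrMr // mul0r.
  by move: hy; rewrite negb_and -!leNgt => /orP[|] h; apply/orP; [left|right]; lra.
move=> y /andP[y0 y1]; rewrite fE /=.
rewrite ramp_at0.
rewrite add0r mulr1.
have sy := s0 y; have sy1 := s1 y.
case: (ltP y e) => ye; first by apply: (H1 (s y)); rewrite ?sy ?sy1 //; split => /=; rewrite ?subrr ?normr0 ?subr0 // ger0_norm //; lra.
case: (ltP (1 - y) e) => ye'; first by apply: (H2 (s y)); rewrite ?sy ?sy1 //; split => /=; rewrite ?subrr ?normr0 // distrC ger0_norm; lra.
suff -> : s y = 1 by have [] := HV y ltac:(by apply/andP).
rewrite /s; have -> : Num.min 1 (Num.min (2 * y / e) (2 * (1 - y) / e)) = 1; last by apply/max_idPr.
by apply/min_idPl; rewrite le_min !ler_pdivlMr // mul1r; lra.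
Qed.

(** The support must stay left of [x = 1], so the ramp has slope -1 and strict monotonicity requires
    the factor [1 - e]. The left side thus comes only within [e] of the right one, and the top side
    is squeezed within [e] of the point [(1, 1)]; the thickness of [V] allows for this. *)
Lemma square_corner (V : set P) : open V ->
  (forall t : R, 0 <= t <= 1 -> V (t, 0) /\ V (1, t)) ->
  exists2 f : homeo P, fixoff corner_region f &
    forall t : R, 0 <= t <= 1 -> V (f (0, t)) /\ V (f (t, 1)).
Proof.
move=> oV HV.
have [|t|e1 e10 H1] := @path_thick (fun t : R => (t, 0)) V oV; first by cts.
  by move=> /HV[].
have [|t|e2 e20 H2] := @path_thick (fun t : R => (1, t)) V oV; first by cts.
  by move=> /HV[].
pose e := Num.min (1/2) (Num.min e1 e2) / 2.
have e0 : 0 < e by rewrite divr_gt0 // !lt_min e10 e20; apply/andP; split => //; lra.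
have e2e : e * 2 = Num.min (1/2) (Num.min e1 e2) by rewrite /e divfK ?pnatr_eq0.
have [ee1 ee2] : e * 2 <= e1 /\ e * 2 <= e2 by rewrite e2e !ge_min !lexx !orbT.
have e12 : e * 2 <= 1 / 2 by rewrite e2e ge_min lexx.
pose s0 := fun y : R => Num.max 0 (Num.min 1 (Num.min (y / e) (3 - 2 * y))).
have cs : continuous (fun y => (1 - e) * s0 y) by apply: ctsfW; rewrite /s0; cts.
have s00 y : 0 <= s0 y by rewrite /s0 le_max lexx.
have s01 y : s0 y <= 1 by rewrite /s0 ge_max ge_min lexx ler01.
have s1e y : (1 - e) * s0 y <= 1 - e by rewrite ler_piMr //; lra.
have [|||||f fE] := @hbump_ex (fun y => (1 - e) * s0 y) (ramp 1 2 1 (- 1)) 1 cs (@ramp_cts _ _ _ _).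
- by move=> y; rewrite mulr_ge0 //; lra.
- by move=> y; apply: (le_trans (s1e y)); lra.
- by move=> y; rewrite mulr1; apply: (le_lt_trans (s1e y)); lra.
- by move=> x x'; apply: ramp_mono; auto.
- by move=> x; apply: ramp_01; auto.
exists f.
  move=> [x y] /= H; rewrite fE /=; congr pair.
  case: (boolP (0 < y < 3 / 2)) => hy.
    have r0 : ramp 1 2 1 (- 1) x = 0.
      by apply: ramp_off; [auto|move=> [h1 h2]; apply: H; split => //=; lra].
    by rewrite r0 mulr0 addr0.
  rewrite (_ : s0 y = 0) ?mulr0 ?mul0r ?addr0 // /s0.
  apply/max_idPl; rewrite !ge_min; apply/orP; right.
  rewrite ler_pdivrMr // mul0r.
  by move: hy; rewrite negb_and -!leNgt => /orP[|] h; apply/orP; [left|right]; lra.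
move=> y /andP[y0 y1]; split; rewrite fE /=.
  rewrite ramp_at0.
  rewrite add0r mulr1.
  have sy : 0 <= (1 - e) * s0 y by rewrite mulr_ge0 //; lra.
  have sy1 := s1e y.
  case: (ltP y e) => ye.
    apply: (H1 ((1 - e) * s0 y)); first by apply/andP; split => //; lra.
    by split => /=; rewrite ?subrr ?normr0 ?subr0 // ger0_norm //; lra.
  have -> : s0 y = 1.
    rewrite /s0; have -> : Num.min 1 (Num.min (y / e) (3 - 2 * y)) = 1; last by apply/max_idPr.
    by apply/min_idPl; rewrite le_min ler_pdivlMr // mul1r ye /=; lra.
  by apply: (H2 y); [lra|]; split => /=; rewrite ?subrr ?normr0 // mulr1 addrAC subrr sub0r normrN gtr0_norm //; lra.
have -> : ramp 1 2 1 (- 1) y = 1 - y by clear -y0 y1; rewrite /ramp; maxmin; lra.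
have -> : s0 1 = 1.
  rewrite /s0; have -> : Num.min 1 (Num.min (1 / e) (3 - 2 * 1)) = 1; last by apply/max_idPr.
  by apply/min_idPl; rewrite le_min ler_pdivlMr // mul1r; apply/andP; split; lra.
have h : 0 <= (1 - y) * e <= e by rewrite mulr_ge0 ?ler_piMl //; lra.
apply: (H2 1); first lra.
split => /=; rewrite ?subrr ?normr0 //.
by rewrite ltr_norml; lra.
Qed.

End Squares.

(** * Lattice paths *)

Section Lattice.
Variable R : realType.
Local Notation P := (R * R)%type.
Local Notation pt := (int * int)%type.
Implicit Types (z w : P) (u v A a b : pt).

Definition int_pt u : P := (u.1%:~R, u.2%:~R).
Definition adj u v : Prop :=
  (u.1 = v.1 /\ (v.2 = u.2 + 1 \/ v.2 = u.2 - 1)) \/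
  (u.2 = v.2 /\ (v.1 = u.1 + 1 \/ v.1 = u.1 - 1)).
Definition lin (z w : P) (t : R) : P :=
  ((1 - t) * z.1 + t * w.1, (1 - t) * z.2 + t * w.2).
Definition seg u v : set P := [set z | exists2 t, 0 <= t <= 1 & z = lin (int_pt u) (int_pt v) t].
Definition frame_pt A a b (i j : int) : pt := (A.1 + i * a.1 + j * b.1, A.2 + i * a.2 + j * b.2).
(** The eight orthonormal lattice bases, both orientations included; through [frame_pt] every cap or
    corner becomes the one in the unit square. *)
Definition frame a b : Prop :=
  (a.2 = 0 /\ b.1 = 0 /\ (a.1 = 1 \/ a.1 = -1) /\ (b.2 = 1 \/ b.2 = -1)) \/
  (a.1 = 0 /\ b.2 = 0 /\ (a.2 = 1 \/ a.2 = -1) /\ (b.1 = 1 \/ b.1 = -1)).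

Lemma seg_sym u v : seg u v = seg v u.
Proof.
by apply/seteqP; split => z [t t01 ->]; exists (1 - t);
  [lra|rewrite /lin; congr pair; ring|lra|rewrite /lin; congr pair; ring].
Qed.

Lemma frame_coord A a b u : frame a b -> exists i j, u = frame_pt A a b i j.
Proof.
move=> fr.
exists ((u.1 - A.1) * a.1 + (u.2 - A.2) * a.2), ((u.1 - A.1) * b.1 + (u.2 - A.2) * b.2).
case: u A a b fr => [u1 u2] [A1 A2] [a1 a2] [b1 b2]; rewrite /frame /frame_pt /=.
by move=> [[-> [-> [[->|->] [->|->]]]]|[-> [-> [[->|->] [->|->]]]]]; congr pair; ring.
Qed.

Lemma adj_frame A a b i j i' j' : frame a b -> adj (frame_pt A a b i j) (frame_pt A a b i' j') ->
  adj (i, j) (i', j').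
Proof.
case: A a b => [A1 A2] [a1 a2] [b1 b2]; rewrite /frame /adj /frame_pt /=.
by move=> [[-> [-> [[->|->] [->|->]]]]|[-> [-> [[->|->] [->|->]]]]]; lia.
Qed.

Local Notation Laff A a b := (affmap (int_pt A) (int_pt a) (int_pt b)).

Lemma int_pt_frame A a b i j : int_pt (frame_pt A a b i j) = Laff A a b (int_pt (i, j)).
Proof. by rewrite /int_pt /frame_pt /affmap /= !intrD !intrM. Qed.

Lemma aff_lin (A a b : P) z w t : affmap A a b (lin z w t) = lin (affmap A a b z) (affmap A a b w) t.
Proof. by rewrite /affmap /lin /=; congr pair; ring. Qed.

Lemma seg_frame A a b i j i' j' z : seg (frame_pt A a b i j) (frame_pt A a b i' j') z ->
  exists2 w, seg (i, j) (i', j') w & z = Laff A a b w.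
Proof.
move=> [t t01 ->]; exists (lin (int_pt (i, j)) (int_pt (i', j')) t); first by exists t.
by rewrite aff_lin !int_pt_frame.
Qed.

Lemma int_between (i : int) (k l : int) (x : R) : x = i%:~R -> k%:~R < x -> x < l%:~R ->
  k < i /\ i < l.
Proof. by move=> ->; rewrite !ltr_int. Qed.

(** Only the sides [x = 0] and [x = 1] of the unit square cross the region. For the second it is
    enough to record where the edge starts, since the path to which this is applied avoids [(1, 0)]
    and [(1, 1)]. *)
Lemma edge_cap (i j i' j' : int) w : adj (i, j) (i', j') -> seg (i, j) (i', j') w -> cap_region w ->
  [\/ (i, j) = (0, 0) /\ (i', j') = (0, 1), (i, j) = (0, 1) /\ (i', j') = (0, 0),
      (i, j) = (1, 0) | (i, j) = (1, 1)].
Proof.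
move=> ad [t t01 ->]; rewrite /cap_region /lin /int_pt /= => -[h1 h2].
move: ad; rewrite /adj /= => -[[ei hj]|[ej hi]]; [rewrite -ei in h1 *|rewrite -ej in h2 *]; last first.
  have [] := @int_between j 0 1 j%:~R erefl; try lra.
  by lia.
have ei' : (1 - t) * i%:~R + t * i%:~R = i%:~R :> R by ring.
have [] := @int_between i (-1) 2 i%:~R erefl; rewrite ?ei' in h1; try lra.
move=> i0 i1.
have [hj0|hj0] : (i = 0) \/ (i = 1) by lia.
  have : j' = j + 1 /\ j = 0 \/ j' = j - 1 /\ j = 1.
    case: hj => hj; rewrite hj ?intrD ?intrB in h2; [left|right]; split => //.
      have [] := @int_between j (-1) 1 j%:~R erefl; rewrite ?mulrN1z; try lra.
      by lia.
    have [] := @int_between j 0 2 j%:~R erefl; try lra.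
    by lia.
  case => [[-> ->]|[-> ->]]; rewrite hj0; [by constructor 1|by constructor 2].
have : j = 0 \/ j = 1.
  have [] := @int_between j (-1) 2 j%:~R erefl; rewrite ?mulrN1z; try lia;
    by case: hj => hj; rewrite hj ?intrD ?intrB in h2; lra.
by rewrite hj0 => -[->|->]; [constructor 3|constructor 4].
Qed.

(** The four edges that cross the region all meet at [(0, 1)], so a corner move does not disturb
    edges that avoid this point. *)
Lemma edge_corner (i j i' j' : int) w : adj (i, j) (i', j') -> seg (i, j) (i', j') w -> corner_region w ->
  (i, j) = (0, 1) \/ (i', j') = (0, 1).
Proof.
move=> ad [t t01 ->]; rewrite /corner_region /lin /int_pt /= => -[h1 h2].
move: ad; rewrite /adj /= => -[[ei0 hj]|[ej0 hi]]; [rewrite -ei0 in h1 *|rewrite -ej0 in h2 *].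
  have ei : (1 - t) * i%:~R + t * i%:~R = i%:~R :> R by ring.
  have [] := @int_between i (-1) 1 i%:~R erefl; rewrite ?mulrN1z ?ei in h1 *; [lra|lra|move=> i0 i1];
  have -> : i = 0 by lia.
  have : j = 1 \/ j' = 1; last by move=> [->|->]; [left|right].
  case: hj => hj; rewrite hj ?intrD ?intrB in h2 *.
    have [] := @int_between j (-1) 2 j%:~R erefl; rewrite ?mulrN1z; try lra.
    by lia.
  have [] := @int_between j 0 3 j%:~R erefl; try lra.
  by lia.
have ej : (1 - t) * j%:~R + t * j%:~R = j%:~R :> R by ring.
have [] := @int_between j 0 2 j%:~R erefl; rewrite ?ej in h2; [lra|lra|move=> j0 j1];
 have -> : j = 1 by lia.
have : i = 0 \/ i' = 0; last by move=> [->|->]; [left|right].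
case: hi => hi; rewrite hi ?intrD ?intrB in h1 *.
  have [] := @int_between i (-2) 1 i%:~R erefl; rewrite ?mulrN1z ?rmorphN /=; try lra.
  by lia.
have [] := @int_between i (-1) 2 i%:~R erefl; rewrite ?mulrN1z; try lra.
by lia.
Qed.

Lemma frame_det a b : frame a b -> (int_pt a).1 * (int_pt b).2 - (int_pt a).2 * (int_pt b).1 != 0.
Proof.
case: a b => [a1 a2] [b1 b2]; rewrite /frame /int_pt /=.
by move=> [[-> [-> [[->|->] [->|->]]]]|[-> [-> [[->|->] [->|->]]]]];
  rewrite ?mulrN1z ?mulr1z ?mulr0z; apply/eqP; lra.
Qed.

Lemma seg_lin A a b (i j i' j' : int) t : 0 <= t <= 1 ->
  seg (frame_pt A a b i j) (frame_pt A a b i' j') (Laff A a b (lin (int_pt (i, j)) (int_pt (i', j')) t)).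
Proof. by move=> t01; exists t => //; rewrite aff_lin !int_pt_frame. Qed.

Lemma cap_move A a b (V : set P) : frame a b -> open V ->
  seg (frame_pt A a b 0 0) (frame_pt A a b 1 0) `<=` V -> seg (frame_pt A a b 1 0) (frame_pt A a b 1 1) `<=` V ->
  seg (frame_pt A a b 1 1) (frame_pt A a b 0 1) `<=` V ->
  exists2 f : homeo P, fixoff [set z | exists2 w, cap_region w & z = Laff A a b w] f &
    forall z, seg (frame_pt A a b 0 0) (frame_pt A a b 0 1) z -> V (f z).
Proof.
move=> fr oV s1 s2 s3.
have [La [LaE LaI]] := aff_ex (int_pt A) (frame_det fr).
have [t t01|f f1 f2] := @square_cap _ [set w | V (La w)] (@hfun_open _ La V oV).
  rewrite /= LaE; split; [apply: s1|apply: s2|apply: s3].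
  - have -> : (t, 0) = lin (int_pt (0, 0)) (int_pt (1, 0)) (t) by rewrite /lin /int_pt /=; congr pair; ring.
    exact: seg_lin.
  - have -> : (1, t) = lin (int_pt (1, 0)) (int_pt (1, 1)) (t) by rewrite /lin /int_pt /=; congr pair; ring.
    exact: seg_lin.
  - have -> : (t, 1) = lin (int_pt (1, 1)) (int_pt (0, 1)) (1 - t) by rewrite /lin /int_pt /=; congr pair; ring.
    by apply: seg_lin; lra.
exists (hconj La f).
  by apply: (fixoff_conj f1) => w Rw; exists w => //; rewrite -LaE.
move=> z /seg_frame[w [t t01 ->] ->] /=; rewrite -LaE hfunK.
have -> : lin (int_pt (0, 0)) (int_pt (0, 1)) t = (0, t) by rewrite /lin /int_pt /=; congr pair; ring.
exact: f2.
Qed.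

Lemma corner_move A a b (V : set P) : frame a b -> open V ->
  seg (frame_pt A a b 0 0) (frame_pt A a b 1 0) `<=` V -> seg (frame_pt A a b 1 0) (frame_pt A a b 1 1) `<=` V ->
  exists2 f : homeo P, fixoff [set z | exists2 w, corner_region w & z = Laff A a b w] f &
    forall z, seg (frame_pt A a b 0 0) (frame_pt A a b 0 1) z \/ seg (frame_pt A a b 0 1) (frame_pt A a b 1 1) z -> V (f z).
Proof.
move=> fr oV s1 s2.
have [La [LaE LaI]] := aff_ex (int_pt A) (frame_det fr).
have [t t01|f f1 f2] := @square_corner _ [set w | V (La w)] (@hfun_open _ La V oV).
  rewrite /= LaE; split; [apply: s1|apply: s2].
  - have -> : (t, 0) = lin (int_pt (0, 0)) (int_pt (1, 0)) (t) by rewrite /lin /int_pt /=; congr pair; ring.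
    exact: seg_lin.
  - have -> : (1, t) = lin (int_pt (1, 0)) (int_pt (1, 1)) (t) by rewrite /lin /int_pt /=; congr pair; ring.
    exact: seg_lin.
exists (hconj La f).
  by apply: (fixoff_conj f1) => w Rw; exists w => //; rewrite -LaE.
move=> z [] /seg_frame[w [t t01 ->] ->] /=; rewrite -LaE hfunK.
  have -> : lin (int_pt (0, 0)) (int_pt (0, 1)) t = (0, t) by rewrite /lin /int_pt /=; congr pair; ring.
  by have [] := f2 t t01.
have -> : lin (int_pt (0, 1)) (int_pt (1, 1)) t = (t, 1) by rewrite /lin /int_pt /=; congr pair; ring.
by have [] := f2 t t01.
Qed.

Lemma not_edge_cap A a b u v z : frame a b -> adj u v -> seg u v z ->
  u <> frame_pt A a b 1 0 -> u <> frame_pt A a b 1 1 ->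
  ~ (u = frame_pt A a b 0 0 /\ v = frame_pt A a b 0 1) -> ~ (u = frame_pt A a b 0 1 /\ v = frame_pt A a b 0 0) ->
  ~ (exists2 w, cap_region w & z = Laff A a b w).
Proof.
move=> fr; have [i [j ->]] := frame_coord A u fr; have [i' [j' ->]] := frame_coord A v fr.
move=> ad sg n1 n2 n3 n4 [w Rw zw].
have [w' sw' zw'] := seg_frame sg.
have [La [LaE _]] := aff_ex (int_pt A) (frame_det fr).
have ww : w = w' by apply: (@hfun_inj _ La); rewrite LaE -zw -zw'.
rewrite -ww in sw'.
have [[[? ?] [? ?]]|[[? ?] [? ?]]|[? ?]|[? ?]] := edge_cap (adj_frame fr ad) sw' Rw; subst.
- exact: n3.
- exact: n4.
- exact: n1.
- exact: n2.
Qed.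

Lemma not_edge_corner A a b u v z : frame a b -> adj u v -> seg u v z ->
  u <> frame_pt A a b 0 1 -> v <> frame_pt A a b 0 1 ->
  ~ (exists2 w, corner_region w & z = Laff A a b w).
Proof.
move=> fr; have [i [j ->]] := frame_coord A u fr; have [i' [j' ->]] := frame_coord A v fr.
move=> ad sg n1 n2 [w Rw zw].
have [w' sw' zw'] := seg_frame sg.
have [La [LaE _]] := aff_ex (int_pt A) (frame_det fr).
have ww : w = w' by apply: (@hfun_inj _ La); rewrite LaE -zw -zw'.
rewrite -ww in sw'.
have [[? ?]|[? ?]] := edge_corner (adj_frame fr ad) sw' Rw; subst.
- exact: n1.
- exact: n2.
Qed.

Definition ibox (m h : int) u : Prop := - m < u.1 < m /\ 0 < u.2 < h.
Definition rbox (m h : int) : set P :=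
  [set z | - m%:~R < z.1 < m%:~R /\ 0 < z.2 < h%:~R].

Lemma ibox_real m h u : ibox m h u ->
  [/\ - m%:~R + 1 <= u.1%:~R :> R, u.1%:~R + 1 <= m%:~R :> R, 1 <= u.2%:~R :> R
    & u.2%:~R + 1 <= h%:~R :> R].
Proof.
move=> [/andP[h1 h2] /andP[h3 h4]].
have e1 : - m%:~R + 1 = (- m + 1)%:~R :> R by rewrite intrD mulrNz.
have e2 (k : int) : k%:~R + 1 = (k + 1)%:~R :> R by rewrite intrD.
rewrite e1 !e2; have -> : (1 <= u.2%:~R :> R) = (1%:~R <= u.2%:~R :> R) by [].
by rewrite !ler_int; split; lia.
Qed.

(** The region of a move exceeds its square by at most 1/2, while lattice points of the open box
    keep distance 1 from its boundary. *)
Lemma frame_rbox m h A a b (Q : set P) : frame a b ->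
  ibox m h (frame_pt A a b 0 0) -> ibox m h (frame_pt A a b 1 1) ->
  Q `<=` [set z | - 1 / 2 < z.1 < 3 / 2 /\ - 1 / 2 < z.2 < 3 / 2] ->
  [set z | exists2 w, Q w & z = Laff A a b w] `<=` rbox m h.
Proof.
move=> fr /ibox_real[a1 a2 a3 a4] /ibox_real[c1 c2 c3 c4] Qs z [[x y] /Qs[/= w1 w2] ->].
rewrite /rbox /affmap /int_pt /=; move: fr a1 a2 a3 a4 c1 c2 c3 c4.
case: a b => [a1 a2] [b1 b2]; rewrite /frame /frame_pt /= !intrD !intrM {Qs}.
by move=> [[-> [-> [[->|->] [->|->]]]]|[-> [-> [[->|->] [->|->]]]]];
  rewrite ?mulrN1z ?mulr1z ?mulr0z => *; split; lra.
Qed.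

End Lattice.

(** * Straightening simple lattice paths *)

Section Unknot.
Variable R : realType.
Local Notation P := (R * R)%type.
Local Notation pt := (int * int)%type.
Variables m h : int.
Implicit Types (p : nat -> pt) (n i L : nat).

Definition lpath n p : Prop :=
  [/\ p 0%N = (0, 0), p n = (0, h), (forall k, (k < n)%N -> adj (p k) (p k.+1)),
      (forall i j, (i <= n)%N -> (j <= n)%N -> p i = p j -> i = j)
    & (forall k, (0 < k < n)%N -> ibox m h (p k))].

(** Quantifying over all neighbourhoods [V] makes moves composable: after a move, [V] is replaced
    with its preimage. The maps go from the straight segment towards the path, and only the position
    of the image matters, not its parametrization. *)
Definition straightenable n p : Prop := forall V : set P, open V ->
  (forall k, (k < n)%N -> @seg R (p k) (p k.+1) `<=` V) ->
  exists2 G : homeo P, fixoff (@rbox R m h) G & forall y : R, 0 <= y <= h%:~R -> V (G (0, y)).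

Lemma straightenable_move n p n' p' :
  straightenable n' p' ->
  (forall V : set P, open V -> (forall k, (k < n)%N -> @seg R (p k) (p k.+1) `<=` V) ->
     exists2 f : homeo P, fixoff (@rbox R m h) f &
       forall k, (k < n')%N -> @seg R (p' k) (p' k.+1) `<=` [set z | V (f z)]) ->
  straightenable n p.
Proof.
move=> sp' H V oV Vp; have [g gb gV] := H V oV Vp.
have [G Gb GV] := sp' _ (@hfun_open _ g V oV) gV.
by exists (hcomp g G) => //; exact: fixoff_comp.
Qed.

Lemma ibox_corner (A a b : pt) : frame a b -> ibox m h (frame_pt A a b 0 0) ->
  ibox m h (frame_pt A a b 1 1) -> ibox m h (frame_pt A a b 1 0) /\ ibox m h (frame_pt A a b 0 1).
Proof.
case: A a b => [A1 A2] [a1 a2] [b1 b2]; rewrite /frame /ibox /frame_pt /=.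
by move=> [[-> [-> [[->|->] [->|->]]]]|[-> [-> [[->|->] [->|->]]]]]; lia.
Qed.

(** The two outer points of the cap are dropped and the later indices shift by two. Apart from the
    new edge, the edges of the shorter path are edges of [p] that, by injectivity, start at neither
    dropped point, so the move fixes them. *)
Lemma remove_cap n p i (A a b : pt) : lpath n p -> frame a b -> (0 < i)%N -> (i + 3 < n)%N ->
  p i = frame_pt A a b 0 0 -> p i.+1 = frame_pt A a b 1 0 -> p i.+2 = frame_pt A a b 1 1 ->
  p i.+3 = frame_pt A a b 0 1 ->
  (forall p', lpath (n - 2) p' -> straightenable (n - 2) p') -> straightenable n p.
Proof.
move=> [p0 pn pad pinj pib] fr i0 i3 e0 e1 e2 e3 IH.
pose p' k := if (k <= i)%N then p k else p k.+2.
apply: (@straightenable_move n p (n - 2) p').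
  apply: IH; split.
  - by rewrite /p'.
  - rewrite /p' ifF; last by lia.
    by rewrite (_ : (n - 2).+2 = n) //; lia.
  - move=> k kn; rewrite /p'; case: (ltngtP k i) => ki.
    + by apply: pad; lia.
    + by apply: pad; lia.
    + rewrite ki e0 e3; case: A a b fr {e0 e1 e2 e3} => [A1 A2] [a1 a2] [b1 b2].
      rewrite /frame /adj /frame_pt /=.
      by move=> [[-> [-> [[->|->] [->|->]]]]|[-> [-> [[->|->] [->|->]]]]]; lia.
  - move=> k l kn ln; rewrite /p'; case: (leqP k i) => ki; case: (leqP l i) => li /pinj; lia.
  - move=> k kn; rewrite /p'; case: (leqP k i) => ki; apply: pib; lia.
move=> V oV Vp.
have s1 : @seg R (frame_pt A a b 0 0) (frame_pt A a b 1 0) `<=` V by rewrite -e0 -e1; apply: Vp; lia.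
have s2 : @seg R (frame_pt A a b 1 0) (frame_pt A a b 1 1) `<=` V by rewrite -e1 -e2; apply: Vp; lia.
have s3 : @seg R (frame_pt A a b 1 1) (frame_pt A a b 0 1) `<=` V by rewrite -e2 -e3; apply: Vp; lia.
have [f fR fV] := cap_move fr oV s1 s2 s3.
exists f.
  by apply: fixoffS fR; apply: frame_rbox => //; [rewrite -e0; apply: pib; lia|rewrite -e2; apply: pib; lia|move=> z [? ?]; split; lra].
move=> k kn z zk.
have [e03|n03] := pselect (p' k = frame_pt A a b 0 0 /\ p' k.+1 = frame_pt A a b 0 1).
  by apply: fV; rewrite -e03.1 -e03.2.
have [e30|n30] := pselect (p' k = frame_pt A a b 0 1 /\ p' k.+1 = frame_pt A a b 0 0).
  by apply: fV; rewrite seg_sym -e30.1 -e30.2.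
have [l [ln [lE lE']]] : exists l, (l < n)%N /\ p' k = p l /\ p' k.+1 = p l.+1.
  rewrite /p' in n03 *; case: (ltngtP k i) => ki.
  - by exists k; split; first lia.
  - by exists k.+2; split; first lia.
  - by exfalso; apply: n03; rewrite ki leqnn ltnn e0 e3.
rewrite /= fR; first by apply: (Vp l) => //; rewrite -lE -lE'.
apply: (@not_edge_cap _ A a b (p' k) (p' k.+1)) => //; rewrite ?lE ?lE'; try by apply: pad.
  by rewrite -e1 => /pinj E; have : l = i.+1 by [apply: E; lia]; move: lE;
     rewrite /p'; case: (leqP k i) => ki /pinj EE; have := EE ltac:(lia) ltac:(lia); lia.
by rewrite -e2 => /pinj E; have : l = i.+2 by [apply: E; lia]; move: lE;
     rewrite /p'; case: (leqP k i) => ki /pinj EE; have := EE ltac:(lia) ltac:(lia); lia.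
Qed.

Lemma flip_corner n p i (A a b : pt) : lpath n p -> frame a b -> (0 < i)%N -> (i + 2 < n)%N ->
  p i = frame_pt A a b 0 0 -> p i.+1 = frame_pt A a b 1 0 -> p i.+2 = frame_pt A a b 1 1 ->
  (forall k, (k <= n)%N -> p k <> frame_pt A a b 0 1) ->
  let p' := fun k => if k == i.+1 then frame_pt A a b 0 1 else p k in
  lpath n p' /\ (straightenable n p' -> straightenable n p).
Proof.
move=> [p0 pn pad pinj pib] fr i0 i2 e0 e1 e2 nD p'.
have b0 : ibox m h (frame_pt A a b 0 0) by rewrite -e0; apply: pib; lia.
have b2 : ibox m h (frame_pt A a b 1 1) by rewrite -e2; apply: pib; lia.
have [b1 b3] := ibox_corner fr b0 b2.
split.
  split.
  - by rewrite /p'.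
  - by rewrite /p' ifF //; lia.
  - move=> k kn; rewrite /p'; case: (eqVneq k i.+1) => [->|ki].
      rewrite ifF; last by lia.
      rewrite e2; case: A a b fr {e0 e1 e2 nD b0 b1 b2 b3 p'} => [A1 A2] [a1 a2] [b1 b2].
      rewrite /frame /adj /frame_pt /=.
      by move=> [[-> [-> [[->|->] [->|->]]]]|[-> [-> [[->|->] [->|->]]]]]; lia.
    case: (eqVneq k.+1 i.+1) => [[->]|ki']; last exact: pad.
    rewrite e0; case: A a b fr {e0 e1 e2 nD b0 b1 b2 b3 p'} => [A1 A2] [a1 a2] [b1 b2].
    rewrite /frame /adj /frame_pt /=.
    by move=> [[-> [-> [[->|->] [->|->]]]]|[-> [-> [[->|->] [->|->]]]]]; lia.
  - move=> k l kn ln; rewrite /p'.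
    case: (eqVneq k i.+1) => [->|ki]; case: (eqVneq l i.+1) => [->|li] //.
    + by move/esym/(nD l ln).
    + by move/(nD k kn).
    + by move/pinj; apply.
  - by move=> k kn; rewrite /p'; case: eqP => // _; exact: pib.
move=> sp'; apply: (@straightenable_move n p n p') => // V oV Vp.
have s1 : @seg R (frame_pt A a b 0 0) (frame_pt A a b 1 0) `<=` V by rewrite -e0 -e1; apply: Vp; lia.
have s2 : @seg R (frame_pt A a b 1 0) (frame_pt A a b 1 1) `<=` V by rewrite -e1 -e2; apply: Vp; lia.
have [f fR fV] := corner_move fr oV s1 s2.
exists f; first by apply: fixoffS fR; apply: frame_rbox => // z [? ?]; split; lra.
move=> k kn z; rewrite /p' /=.
case: (eqVneq k i.+1) => [->|ki].
  by rewrite ifF; [rewrite e2 => zk; apply: fV; right|lia].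
case: (eqVneq k.+1 i.+1) => [[->]|ki'].
  by rewrite e0 => zk; apply: fV; left.
move=> zk; rewrite /= fR; first exact: (Vp k).
by apply: (@not_edge_corner _ A a b (p k) (p k.+1)) => //; [exact: pad|apply: nD; lia|apply: nD; lia].
Qed.

Definition Urun n p (a b x y : int) i L : Prop :=
  [/\ a = 1 \/ a = -1, b = 1 \/ b = -1, (0 < L)%N, (i + L + 2 <= n)%N &
   [/\ p i = (x, y), (forall l, (l <= L)%N -> p (i + 1 + l)%N = (x + a, y + b * l%:Z))
    & p (i + L + 2)%N = (x, y + b * L%:Z)]].

(** Induction on the length [L] of the bottom of the U. If [L = 1], the run is a cap. Otherwise
    flipping the first corner shortens the run by one, unless the path itself occupies the inner
    corner [(x, y + b)]. In that case the strand through this point either continues to [(x, y)],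
    which closes a cap; or it follows column [x] and turns off into column [x - a], which yields a U
    shorter than [L] on the same path; or it joins the other end of the run, which closes a cap
    there. *)
Lemma Urun_straightenable L : forall n p a b x y i, lpath n p -> Urun n p a b x y i L ->
  (forall p', lpath (n - 2) p' -> straightenable (n - 2) p') -> straightenable n p.
Proof.
have [k] := ubnP L; elim: k L => // k IHk L Lk n p a b x y i lp U IHn.
have [p0 pn pad pinj pib] := lp.
have [ha hb L0 iL [ei er eL]] := U.
have fr1 : frame (a, 0) (0, b) by left.
have fr2 : frame (0, - b) (a, 0) by right; rewrite /=; lia.
have fr3 : frame (0, b) (- a, 0) by right; rewrite /=; lia.
have e1 : p i.+1 = (x + a, y) by have := er 0%N isT; rewrite addn0 addn1 mulr0 addr0.
have eL1 : p (i + L).+1 = (x + a, y + b * L%:Z).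
  by rewrite -(er L) //; congr p; lia.
have y0 : 0 < y /\ y < h by have := pib i.+1 ltac:(lia); rewrite e1 /ibox /=; lia.
have yL0 : 0 < y + b * L%:Z /\ y + b * L%:Z < h.
  by have := pib (i + L).+1 ltac:(lia); rewrite eL1 /ibox /=; lia.
have i0 : (0 < i)%N.
  by rewrite lt0n; apply/negP => /eqP E; move: ei; rewrite E p0 => -[_ E2]; lia.
have iLn : (i + L + 2 < n)%N.
  by rewrite ltn_neqAle iL andbT; apply/negP => /eqP E; move: eL; rewrite E pn => -[_ E2]; lia.
have [L1|L2] : L = 1%N \/ (1 < L)%N by lia.
  apply: (@remove_cap n p i (x, y) (a, 0) (0, b)) => //; rewrite ?ei ?e1 /frame_pt /=; try lia.
  - by congr pair; ring.
  - by congr pair; ring.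
  - have := er 1%N; rewrite L1 => /(_ isT); rewrite (_ : i + 1 + 1 = i.+2)%N; last by lia.
    by move=> ->; congr pair; ring.
  - have := eL; rewrite L1 (_ : i + 1 + 2 = i.+3)%N; last by lia.
    by move=> ->; congr pair; ring.
have e2 : p i.+2 = (x + a, y + b).
  by have := er 1%N ltac:(lia); rewrite (_ : i + 1 + 1 = i.+2)%N ?mulr1 //; lia.
have [[q [qn qc]]|nq] := pselect (exists q, (q <= n)%N /\ p q = (x, y + b)); last first.
  have [|||||lp' sp'] := @flip_corner n p i (x, y) (a, 0) (0, b) lp fr1 i0.
  - lia.
  - by rewrite ei /frame_pt /=; congr pair; ring.
  - by rewrite e1 /frame_pt /=; congr pair; ring.
  - by rewrite e2 /frame_pt /=; congr pair; ring.
  - by move=> j jn E; apply: nq; exists j; split => //; rewrite E /frame_pt /=; congr pair; ring.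
  apply: sp'; apply: (IHk (L - 1)%N ltac:(lia) n _ a b x (y + b) i.+1 lp') => //.
  split => //; try lia.
  split.
  - by rewrite eqxx /frame_pt /=; congr pair; ring.
  - move=> l lL; rewrite ifF; last by lia.
    have := er l.+1 ltac:(lia); rewrite (_ : i + 1 + l.+1 = i.+1 + 1 + l)%N; last by lia.
    by move=> ->; congr pair; lia.
  - rewrite ifF; last by lia.
    rewrite (_ : i.+1 + (L - 1) + 2 = i + L + 2)%N; last by lia.
    by rewrite eL; congr pair; lia.
(* the corner opposite to [p i.+1] already lies on the path, at index [q] *)
have qr : (q < i \/ i + L + 2 < q)%N.
  have [|qi] := ltnP q i; first by left.
  have [|qi'] := ltnP (i + L + 2) q; first by right.
  exfalso; have [E|[E|E]] : q = i \/ q = (i + L + 2)%N \/ exists2 l, (l <= L)%N & q = (i + 1 + l)%N.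
    have [->|ne] := eqVneq q i; first by left.
    have [->|ne'] := eqVneq q (i + L + 2)%N; first by right; left.
    by right; right; exists (q - i - 1)%N; lia.
  - by move: qc; rewrite E ei => -[]; lia.
  - by move: qc; rewrite E eL => -[]; lia.
  - by case: E => l lL El; move: qc; rewrite El (er l lL) => -[]; lia.
have q0 : (0 < q)%N.
  by rewrite lt0n; apply/negP => /eqP E; move: qc; rewrite E p0 => -[]; lia.
have qn' : (q < n)%N.
  by rewrite ltn_neqAle qn andbT; apply/negP => /eqP E; move: qc; rewrite E pn => -[]; lia.
have nbq r : (r = q.+1 \/ r.+1 = q) -> [\/ p r = (x, y), p r = (x - a, y + b) | p r = (x, y + b + b)].
  move=> rq; have rn : (r <= n)%N by lia.
  have ad : adj (p r) (x, y + b) \/ adj (x, y + b) (p r).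
    case: rq => rq; first by right; rewrite -qc rq; apply: pad.
    by left; rewrite -qc -rq; apply: pad; lia.
  have ne : p r <> (x + a, y + b) by rewrite -e2 => /pinj E; have := E rn ltac:(lia); lia.
  case: (p r) ad ne => r1 r2; rewrite /adj /= => ad ne.
  have [[-> ->]|[[-> ->]|[[-> ->]|[E1 E2]]]] : (r1 = x /\ r2 = y) \/ (r1 = x - a /\ r2 = y + b) \/
     (r1 = x /\ r2 = y + b + b) \/ (r1 = x + a /\ r2 = y + b) by lia.
  - by constructor 1.
  - by constructor 2.
  - by constructor 3.
  - by exfalso; apply: ne; rewrite E1 E2.
have qi1 r : (r = q.+1 \/ r.+1 = q) -> p r = (x, y) -> q.+1 = i.
  by rewrite -ei => rq /pinj E; have := E ltac:(lia) ltac:(lia); lia.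
have [qi|qi] := pselect (q.+1 = i).
  apply: (@remove_cap n p q (x, y + b) (0, - b) (a, 0)) => //; rewrite ?qi ?qc ?ei ?e1 ?e2 /frame_pt /=; try lia;
    by congr pair; ring.
have qne : p q.+1 <> p q.-1 by move=> /pinj E; have := E ltac:(lia) ltac:(lia); lia.
have [E|Ep|Ep] := nbq q.+1 (or_introl erefl); first by exfalso; apply: qi; exact: (qi1 q.+1 (or_introl erefl)).
- (* the path runs from [q] in the direction [b] with decreasing indices *)
  have Em : p q.-1 = (x, y + b + b).
    have [E|E|//] := nbq q.-1 ltac:(lia); first by exfalso; apply: qi; apply: (qi1 q.-1 _ E); lia.
    by exfalso; apply: qne; rewrite Ep E.
  have walk t : (t < L)%N -> straightenable n p \/ ((t <= q)%N /\
      forall s, (s <= t)%N -> p (q - s)%N = (x, y + b + b * s%:Z)).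
    elim: t => [|t IHt] tL.
      by right; split => // s; rewrite leqn0 => /eqP ->; rewrite subn0 qc; congr pair; lia.
    have [|[tq H]] := IHt ltac:(lia); first by left.
    have tq' : (t < q)%N.
      rewrite ltn_neqAle tq andbT; apply/negP => /eqP E.
      by have := H t (leqnn t); rewrite E subnn p0 => -[]; lia.
    have Ht := H t (leqnn t).
    have ad : adj (p (q - t.+1)%N) (p (q - t)%N).
      by have := pad (q - t.+1)%N ltac:(lia); rewrite (_ : (q - t.+1).+1 = q - t)%N //; lia.
    have [t0|t0] : t = 0%N \/ (0 < t)%N by lia.
      right; split; first lia.
      move=> s st; have [->|->] : s = 0%N \/ s = 1%N by lia.
        by rewrite subn0 qc; congr pair; lia.
      by rewrite subn1 Em; congr pair; lia.
    (* A step towards column [x + a] would hit the run; equal indices would then make [q - t] the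
       next index of the run, whose point lies in the other column. *)
    have ne1 : p (q - t.+1)%N <> (x + a, y + b + b * t%:Z).
      have <- : p (i + 1 + t.+1)%N = (x + a, y + b + b * t%:Z) by rewrite er; [congr pair; lia|lia].
      move=> /pinj E; have {}E := E ltac:(lia) ltac:(lia).
      have := er t.+2 ltac:(lia); rewrite (_ : i + 1 + t.+2 = q - t)%N; last by lia.
      by rewrite Ht => -[]; lia.
    have ne2 : p (q - t.+1)%N <> (x, y + b * t%:Z).
      have <- : p (q - (t - 1))%N = (x, y + b * t%:Z) by rewrite H; [congr pair; lia|lia].
      by move=> /pinj E; have := E ltac:(lia) ltac:(lia); lia.
    have [E|E] : p (q - t.+1)%N = (x - a, y + b + b * t%:Z) \/ p (q - t.+1)%N = (x, y + b + b * t.+1%:Z).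
      move: ad ne1 ne2; rewrite Ht; case: (p (q - t.+1)%N) => r1 r2; rewrite /adj /= => ad ne1 ne2.
      have [[-> ->]|[[-> ->]|[[E1 E2]|[E1 E2]]]] : (r1 = x - a /\ r2 = y + b + b * t%:Z) \/
        (r1 = x /\ r2 = y + b + b * t.+1%:Z) \/ (r1 = x + a /\ r2 = y + b + b * t%:Z) \/
        (r1 = x /\ r2 = y + b * t%:Z) by lia.
      + by left.
      + by right.
      + by exfalso; apply: ne1; rewrite E1 E2.
      + by exfalso; apply: ne2; rewrite E1 E2.
    + left; apply: (IHk t ltac:(lia) n p a (- b) (x - a) (y + b + b * t%:Z) (q - t.+1)%N) => //.
      split => //; try lia.
      split => //.
      * move=> l lt; rewrite (_ : q - t.+1 + 1 + l = q - (t - l))%N; last by lia.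
        by rewrite H; [congr pair; lia|lia].
      * rewrite (_ : q - t.+1 + t + 2 = q.+1)%N; last by lia.
        by rewrite Ep; congr pair; lia.
    + right; split => // s; rewrite leq_eqVlt => /orP[/eqP ->//|st].
      exact: H.
  (* The strand never turned off, so it joins the far end of the run and the last cell is a cap. *)
  have [//|[Lq H]] := walk (L - 1)%N ltac:(lia).
  have qL : (q - (L - 1) = i + L + 2)%N.
    apply: pinj; try lia.
    by rewrite H // eL; congr pair; lia.
  have e3 : p (i + L).+3 = (x, y + b * (L - 1)%N%:Z).
    rewrite (_ : (i + L).+3 = q - (L - 2))%N; last by lia.
    by rewrite H; [congr pair; lia|lia].
  apply: (@remove_cap n p (i + L)%N (x + a, y + b * (L - 1)%N%:Z) (0, b) (- a, 0)) => //;
    rewrite /frame_pt /=; try lia.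
  + by rewrite (_ : i + L = i + 1 + (L - 1))%N; [rewrite er; [congr pair; lia|lia]|lia].
  + by rewrite eL1; congr pair; lia.
  + by rewrite (_ : (i + L).+2 = i + L + 2)%N; [rewrite eL; congr pair; lia|lia].
  + by rewrite e3; congr pair; lia.
- (* same with increasing indices; here the walk cannot reach the end of the run *)
  have Em : p q.-1 = (x - a, y + b).
    have [E|//|E] := nbq q.-1 ltac:(lia); first by exfalso; apply: qi; apply: (qi1 q.-1 _ E); lia.
    by exfalso; apply: qne; rewrite Ep E.
  have walk t : (t < L)%N -> straightenable n p \/ ((q + t <= n)%N /\
      forall s, (s <= t)%N -> p (q + s)%N = (x, y + b + b * s%:Z)).
    elim: t => [|t IHt] tL.
      by right; split; [lia|] => s; rewrite leqn0 => /eqP ->; rewrite addn0 qc; congr pair; lia.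
    have [|[tq H]] := IHt ltac:(lia); first by left.
    have tq' : (q + t < n)%N.
      rewrite ltn_neqAle tq andbT; apply/negP => /eqP E.
      by have := H t (leqnn t); rewrite E pn => -[]; lia.
    have Ht := H t (leqnn t).
    have ad : adj (p (q + t)%N) (p (q + t.+1)%N) by rewrite addnS; apply: pad.
    have [t0|t0] : t = 0%N \/ (0 < t)%N by lia.
      right; split; first lia.
      move=> s st; have [->|->] : s = 0%N \/ s = 1%N by lia.
        by rewrite addn0 qc; congr pair; lia.
      by rewrite addn1 Ep; congr pair; lia.
    have ne1 : p (q + t.+1)%N <> (x + a, y + b + b * t%:Z).
      have <- : p (i + 1 + t.+1)%N = (x + a, y + b + b * t%:Z) by rewrite er; [congr pair; lia|lia].
      by move=> /pinj E; have := E ltac:(lia) ltac:(lia); lia.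
    have ne2 : p (q + t.+1)%N <> (x, y + b * t%:Z).
      have <- : p (q + (t - 1))%N = (x, y + b * t%:Z) by rewrite H; [congr pair; lia|lia].
      by move=> /pinj E; have := E ltac:(lia) ltac:(lia); lia.
    have [E|E] : p (q + t.+1)%N = (x - a, y + b + b * t%:Z) \/ p (q + t.+1)%N = (x, y + b + b * t.+1%:Z).
      move: ad ne1 ne2; rewrite Ht; case: (p (q + t.+1)%N) => r1 r2; rewrite /adj /= => ad ne1 ne2.
      have [[-> ->]|[[-> ->]|[[E1 E2]|[E1 E2]]]] : (r1 = x - a /\ r2 = y + b + b * t%:Z) \/
        (r1 = x /\ r2 = y + b + b * t.+1%:Z) \/ (r1 = x + a /\ r2 = y + b + b * t%:Z) \/
        (r1 = x /\ r2 = y + b * t%:Z) by lia.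
      + by left.
      + by right.
      + by exfalso; apply: ne1; rewrite E1 E2.
      + by exfalso; apply: ne2; rewrite E1 E2.
    + left; apply: (IHk t ltac:(lia) n p a b (x - a) (y + b) q.-1) => //.
      split => //; try lia.
      split => //.
      * move=> l lt; rewrite (_ : q.-1 + 1 + l = q + l)%N; last by lia.
        by rewrite H; [congr pair; lia|lia].
      * rewrite (_ : q.-1 + t + 2 = q + t.+1)%N; last by lia.
        by rewrite E.
    + right; split; first by lia.
      move=> s; rewrite leq_eqVlt => /orP[/eqP ->//|st].
      exact: H.
  have [//|[Lq H]] := walk (L - 1)%N ltac:(lia).
  exfalso.
  have qL : (q + (L - 1) = i + L + 2)%N.
    apply: pinj; try lia.
    by rewrite H // eL; congr pair; lia.
  have := H (L - 2)%N ltac:(lia); rewrite (_ : q + (L - 2) = (i + L).+1)%N; last by lia.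
  by rewrite eL1 => -[]; lia.
Qed.

End Unknot.

Section Unknot2.
Variable R : realType.
Local Notation P := (R * R)%type.
Local Notation pt := (int * int)%type.
Variables m h : int.
Implicit Types (p : nat -> pt) (n i L : nat).
Local Notation lpath := (lpath m h).
Local Notation straightenable := (@straightenable R m h).

(** Take a column with [|x|] maximal and a maximal stretch of the path in it. Both neighbours of the
    stretch lie one column closer to 0, and inside it the height is monotone because no point
    repeats. It has at least two points, since otherwise its two neighbours would coincide. *)
Lemma Urun_ex n p : lpath n p -> (exists2 k, (k <= n)%N & (p k).1 <> 0) ->
  exists a b x y i L, Urun n p a b x y i L.
Proof.
move=> [p0 pn pad pinj pib] [k0 k0n x0].
have [k kn [kX kmax]] : exists2 k, (k <= n)%N & (p k).1 <> 0 /\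
    forall j, (j <= n)%N -> `|(p j).1| <= `|(p k).1|.
  pose F (j : 'I_n.+1) := `|(p j).1|%N.
  have [k _ kmax] := @arg_maxnP _ (inord k0 : 'I_n.+1) xpredT F isT.
  exists k; first by have := ltn_ord k; lia.
  split.
    have := kmax (inord k0) isT; rewrite /F inordK //; lia.
  by move=> j jn; have := kmax (inord j) isT; rewrite /F inordK //; lia.
set X := (p k).1 in kX kmax.
pose a : int := if 0 < X then 1 else -1.
have ha : a = 1 \/ a = -1 by rewrite /a; case: ifP; [left|right].
have aX : forall u : int, `|u| <= `|X| -> (u = X + 1 \/ u = X - 1) -> u = X - a.
  by move=> u; rewrite /a; case: ifP => hX; lia.
have k0' : (0 < k)%N by rewrite lt0n; apply/negP => /eqP E; apply: kX; rewrite /X E p0.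
have kn' : (k < n)%N.
  by rewrite ltn_neqAle kn andbT; apply/negP => /eqP E; apply: kX; rewrite /X E pn.
have [i /andP[ik iX] imax] : exists2 i, (i < k)%N && ((p i).1 != X) &
    forall j, (j < k)%N && ((p j).1 != X) -> (j <= i)%N.
  have ex : exists i, (i < k)%N && ((p i).1 != X) by exists 0%N; rewrite k0' p0 /= eq_sym; exact/eqP.
  have ub i : (i < k)%N && ((p i).1 != X) -> (i <= k)%N by move=> /andP[]; lia.
  by case: (ex_maxnP ex ub) => i ? ?; exists i.
have [j /andP[/andP[kj jn] jX] jmin] : exists2 j, (k < j)%N && (j <= n)%N && ((p j).1 != X) &
    forall l, (k < l)%N && (l <= n)%N && ((p l).1 != X) -> (j <= l)%N.
  have ex : exists j, (k < j)%N && (j <= n)%N && ((p j).1 != X).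
    by exists n; rewrite kn' leqnn pn /= eq_sym; exact/eqP.
  by case: (ex_minnP ex) => j ? ?; exists j.
have run l : (i < l)%N -> (l < j)%N -> (p l).1 = X.
  move=> il lj; have [lk|kl|->//] := ltngtP l k; apply/eqP; apply: contraT => lX.
    by have := imax l; rewrite lk lX => /(_ isT); lia.
  by have := jmin l; rewrite kl lX /= andbT => /(_ ltac:(lia)); lia.
have ei : p i = (X - a, (p i.+1).2).
  have := pad i ltac:(lia); have := run i.+1 ltac:(lia) ltac:(lia); have := kmax i ltac:(lia).
  move: iX; case: (p i) => u v; case: (p i.+1) => u' v'; rewrite /adj /= => /eqP uX uk ->.
  by move=> [[E _]|[-> E]]; [rewrite E in uX|rewrite (aX u) //; lia].
have ej : p j = (X - a, (p j.-1).2).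
  have := pad j.-1 ltac:(lia); have := run j.-1 ltac:(lia) ltac:(lia); have := kmax j ltac:(lia).
  rewrite prednK; last by lia.
  move: jX; case: (p j) => u v; case: (p j.-1) => u' v'; rewrite /adj /= => /eqP uX uk ->.
  by move=> [[E _]|[-> E]]; [rewrite -E in uX|rewrite (aX u) //; lia].
have L1 : (i + 2 < j)%N.
  have [//|E] := ltnP (i + 2) j.
  have E' : j = i.+2 by lia.
  by have /pinj := etrans ej (etrans (congr1 (fun l => (X - a, (p l.-1).2)) E') (esym ei)); lia.
pose y := (p i.+1).2; pose b := (p i.+2).2 - y.
have adr l : (i < l)%N -> (l.+1 < j)%N -> (p l.+1).2 = (p l).2 + 1 \/ (p l.+1).2 = (p l).2 - 1.
  move=> il lj; have := pad l ltac:(lia); have := run l il ltac:(lia); have := run l.+1 ltac:(lia) lj.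
  by rewrite /adj; lia.
have hb : b = 1 \/ b = -1 by have := adr i.+1 ltac:(lia) ltac:(lia); rewrite /b /y; lia.
have pairE (u v : pt) : u.1 = v.1 -> u.2 = v.2 -> u = v by case: u v => [? ?] [? ?] /= -> ->.
have mono l : (i.+1 + l.+1 < j)%N ->
    (p (i.+1 + l)%N).2 = y + b * l%:Z /\ (p (i.+1 + l.+1)%N).2 = y + b * l.+1%:Z.
  elim: l => [|l IH] lj; first by rewrite addn0 addn1 /b /y; split; lia.
  have [H1 H2] := IH ltac:(lia); split => //.
  have ne : (p (i.+1 + l.+2)%N).2 <> y + b * l%:Z.
    rewrite -H1 => E; have /pinj : p (i.+1 + l.+2)%N = p (i.+1 + l)%N.
      by apply: pairE => //; rewrite !run //; lia.
    by lia.
  have := adr (i.+1 + l.+1)%N ltac:(lia) ltac:(lia); rewrite -addnS; lia.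
exists a, b, (X - a), y, i, (j - i - 2)%N; split => //; try lia.
split => //.
- move=> l lL; rewrite (_ : i + 1 + l = i.+1 + l)%N; last by lia.
  apply: pairE => /=; first by rewrite run; lia.
  have [->|l0] := posnP l; first by rewrite addn0 /y; lia.
  have := (mono l.-1 ltac:(lia)).2; rewrite prednK //.
- rewrite (_ : i + (j - i - 2) + 2 = j)%N; last by lia.
  rewrite ej; congr pair.
  have := (mono (j - i - 3)%N ltac:(lia)).2.
  have -> : (i.+1 + (j - i - 3).+1 = j.-1)%N by lia.
  by have -> : ((j - i - 3).+1 = j - i - 2)%N by lia.
Qed.

Lemma straight_path n p : 0 < h -> lpath n p -> (forall k, (k <= n)%N -> (p k).1 = 0) ->
  h = n%:Z /\ forall k, (k <= n)%N -> p k = (0, k%:Z).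
Proof.
move=> h0 [p0 pn pad pinj pib] x0.
have pairE (u v : pt) : u.1 = v.1 -> u.2 = v.2 -> u = v by case: u v => [? ?] [? ?] /= -> ->.
have n0 : (0 < n)%N by rewrite lt0n; apply/negP => /eqP E; move: pn; rewrite E p0 => -[]; lia.
have p1 : (p 1%N).2 = 1.
  have := pad 0%N n0; rewrite p0 /adj /= x0 // => -[[_ E]|]; last lia.
  have [n1|n1] : n = 1%N \/ (1 < n)%N by lia.
    by move: pn E; rewrite n1 => -> /=; lia.
  by have := pib 1%N ltac:(lia); rewrite /ibox; lia.
have H k : (k < n)%N -> (p k).2 = k%:Z /\ (p k.+1).2 = k.+1%:Z.
  elim: k => [|k IH] kn; first by rewrite p0 p1.
  have [H1 H2] := IH ltac:(lia); split => //.
  have ne : (p k.+2).2 <> k%:Z.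
    rewrite -H1 => E; have /pinj : p k.+2 = p k by apply: pairE => //; rewrite !x0 //; lia.
    by lia.
  by have := pad k.+1 kn; rewrite /adj (x0 k.+1) 1?(x0 k.+2) //; lia.
have H' k : (k <= n)%N -> p k = (0, k%:Z).
  move=> kn; apply: pairE => /=; first exact: x0.
  have [->|k0] := posnP k; first by rewrite p0.
  by have := (H k.-1 ltac:(lia)).2; rewrite prednK.
by split => //; have := H' n (leqnn n); rewrite pn => -[].
Qed.

Lemma lpath_straightenable n p : 0 < h -> lpath n p -> straightenable n p.
Proof.
move=> h0; have [k] := ubnP n; elim: k n p => // k IH n p nk lp.
have [[q qn qx]|nx] := pselect (exists2 q, (q <= n)%N & (p q).1 <> 0).
  have [a [b [x [y [i [L U]]]]]] := Urun_ex lp (ex_intro2 _ _ q qn qx).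
  apply: (Urun_straightenable lp U) => p' lp'; apply: IH => //.
  have [_ _ L0 iL _] := U; lia.
have x0 q : (q <= n)%N -> (p q).1 = 0.
  by move=> qn; apply: contrapT => H; apply: nx; exists q.
have [hn pE] := straight_path h0 lp x0.
move=> V oV Vp; exists hid => // y /andP[y0 yh] /=.
have n0 : (0 < n)%N by rewrite -ltz_nat -hn.
have [l ln /andP[ly yl]] : exists2 l, (l < n)%N & l%:R <= y <= l.+1%:R.
  have /andP[t1 t2] := Num.Theory.truncn_itv y0.
  have [tn|tn] := ltnP (Num.truncn y) n.
    by exists (Num.truncn y) => //; rewrite t1 ltW.
  (* Here [y = h]: the truncation is [n], one past the last edge. *)
  exists n.-1; first by lia.
  rewrite prednK // hn in yh *.
  rewrite yh andbT; apply: le_trans t1; rewrite ler_nat; lia.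
apply: (Vp l ln); exists (y - l%:R); first by rewrite -addn1 natrD in yl; lra.
rewrite !pE //; last by lia.
by rewrite /lin /int_pt /= -!pmulrn -addn1 natrD; congr pair; ring.
Qed.

End Unknot2.

(** * Unknotting an arc in a slab *)

Section Walks.
Local Notation pt := (int * int)%type.
Variable S : set pt.
Implicit Types (u v : pt) (n : nat) (p : nat -> pt).

Definition walk n p u v : Prop :=
  [/\ p 0%N = u, p n = v, (forall k, (k < n)%N -> adj (p k) (p k.+1))
    & (forall k, (k <= n)%N -> S (p k))].
Definition walks u v := exists n p, walk n p u v.

Lemma walks_refl u : S u -> walks u u.
Proof. by move=> Su; exists 0%N, (fun=> u); split. Qed.

Lemma adj_sym u v : adj u v -> adj v u.
Proof. by rewrite /adj; lia. Qed.

Lemma walks_sym u v : walks u v -> walks v u.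
Proof.
move=> [n [p [p0 pn pa pS]]]; exists n, (fun k => p (n - k)%N); split.
- by rewrite subn0.
- by rewrite subnn.
- move=> k kn; apply: adj_sym; have -> : (n - k = (n - k.+1).+1)%N by lia.
  by apply: pa; lia.
- by move=> k kn; apply: pS; lia.
Qed.

Lemma walks_trans u v w : walks u v -> walks v w -> walks u w.
Proof.
move=> [n [p [p0 pn pa pS]]] [n' [p' [p0' pn' pa' pS']]].
exists (n + n')%N, (fun k => if (k <= n)%N then p k else p' (k - n)%N); split => //.
- case: leqP => nn; last by have -> : (n + n' - n = n')%N by lia.
  have E : n' = 0%N by lia.
  by rewrite E addn0 pn -p0' -pn' E.
- move=> k kn; case: (ltngtP k n) => kn'.
  + by apply: pa.
  + have -> : (k.+1 - n = (k - n).+1)%N by lia.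
    by apply: pa'; lia.
  + rewrite kn' pn -p0'; have -> : (n.+1 - n = 1)%N by lia.
    by apply: pa'; lia.
- by move=> k kn; case: leqP => kn'; [exact: pS|apply: pS'; lia].
Qed.

Lemma walks1 u v : S u -> S v -> adj u v -> walks u v.
Proof.
move=> Su Sv uv; exists 1%N, (fun k => if k is 0%N then u else v); split => //.
- by case.
- by case.
Qed.

(** Loop erasure: a repeated point allows the part between its two visits to be cut out. *)
Lemma short_walk u v : walks u v -> exists n p, walk n p u v /\
  (forall i j, (i <= n)%N -> (j <= n)%N -> p i = p j -> i = j).
Proof.
move=> [n [p w]]; have [k] := ubnP n; elim: k n p w => // k IH n p w nk.
have [inj|] := pselect (forall i j, (i <= n)%N -> (j <= n)%N -> p i = p j -> i = j).
  by exists n, p.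
move=> ni.
have [i [j [ij jn pij]]] : exists i j, [/\ (i < j)%N, (j <= n)%N & p i = p j].
  apply: contrapT => H; apply: ni => i j ni nj pij.
  have [ij|ij|//] := ltngtP i j; exfalso; apply: H; [by exists i, j|by exists j, i].
have [p0 pn pa pS] := w.
apply: (IH (i + (n - j))%N (fun k => if (k <= i)%N then p k else p (k - i + j)%N)); last by lia.
split => //.
- case: leqP => H; last by have -> : (i + (n - j) - i + j = n)%N by lia.
  have E : n = j by lia.
  by rewrite E subnn addn0 pij -pn E.
- move=> l lk; case: (ltngtP l i) => li.
  + by apply: pa; lia.
  + have -> : (l.+1 - i + j = (l - i + j).+1)%N by lia.
    by apply: pa; lia.
  + rewrite li pij; have -> : (i.+1 - i + j = j.+1)%N by lia.
    by apply: pa; lia.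
- by move=> l lk; case: leqP => li; apply: pS; lia.
Qed.

End Walks.

Lemma int_near (a b : int) : a < b + 2 -> b < a + 2 -> a = b \/ a = b + 1 \/ a = b - 1.
Proof. lia. Qed.

(** * From a curve to a lattice path *)

Section LemmaU.
Variable R : realType.
Local Notation P := (R * R)%type.
Local Notation pt := (int * int)%type.

(** The points of [S] occupy rows 1 to [N + 1], so the new ends in rows 0 and [N + 2] keep the path
    simple, and the walk itself becomes interior to the box. *)
Lemma lpath_extend (S : set pt) (m : int) (N : nat) :
  (forall u, S u -> - m < u.1 < m /\ 0 < u.2 < N.+2%:Z) -> 0 < m ->
  walks S (0, 1) (0, N.+1%:Z) ->
  exists n p, [/\ lpath m N.+2%:Z n.+2 p,
    (forall k, (0 < k < n.+2)%N -> S (p k)), p 1%N = (0, 1) & p n.+1 = (0, N.+1%:Z)].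
Proof.
move=> Sb m0 /short_walk[n [p [[p0 pn pa pS] inj]]].
exists n, (fun k => if k is k'.+1 then (if (k' <= n)%N then p k' else (0, N.+2%:Z)) else (0, 0)).
split; last 2 first.
- by rewrite p0.
- by rewrite leqnn pn.
- split => //.
  + by rewrite ltnn.
  + case => [_|k kn] /=; first by rewrite p0 /adj /=; lia.
    have -> : (k <= n)%N by lia.
    case: (leqP k.+1 n) => kn'; first exact: pa.
    have -> : k = n by lia.
    by rewrite pn /adj /=; lia.
  + have ne i : (i <= n)%N -> p i <> (0, N.+2%:Z).
      by move=> /pS/Sb; case: (p i) => u v /= H [E1 E2]; lia.
    have ne0 i : (i <= n)%N -> p i <> (0, 0).
      by move=> /pS/Sb; case: (p i) => u v /= H [E1 E2]; lia.
    have ne1 : (0, N.+2%:Z) <> (0, 0) :> pt by move=> [].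
    case => [|i] [|j] //= ii jj.
    * by case: leqP => jn E; exfalso; [apply: (ne0 j)|apply: ne1].
    * by case: leqP => jn E; exfalso; [apply: (ne0 i)|apply: ne1].
    * case: leqP => iin; case: leqP => jn E.
      -- by rewrite (inj _ _ iin jn E).
      -- by exfalso; apply: (ne i).
      -- by exfalso; apply: (ne j).
      -- by lia.
  + case => // k kn; have -> : (k <= n)%N by lia.
    by apply: Sb; apply: pS; lia.
- case => // k kn; have -> : (k <= n)%N by lia.
  by apply: pS; lia.
Qed.

(** The lattice of mesh [hh] has row 1 at the start of the curve and row [N + 1] at its end. The
    points kept lie within [2 * hh] of the curve; an edge from such a point stays within
    [3 * hh < e0] of it, hence in [O]. *)
Lemma unknot_grid (O : set P) (c : R -> P) (y0 y1 w w' hh e0 : R) (N : nat) (m : int) :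
  open O -> ctsf c -> c 0 = (0, y0) -> c 1 = (0, y1) ->
  (forall t : R, 0 <= t <= 1 -> `|(c t).1| <= w /\ y0 <= (c t).2 <= y1) ->
  (forall t : R, 0 <= t <= 1 -> bx (c t) e0 `<=` O) ->
  0 < hh -> N%:R * hh = y1 - y0 -> 4 * hh < e0 -> (0 < m) -> m%:~R * hh <= w' -> w < (m%:~R - 2) * hh ->
  exists2 G : homeo P,
    fixoff [set z | `|z.1| < w' /\ y0 - hh < z.2 < y1 + hh] G &
    forall y, y0 - hh <= y <= y1 + hh -> O (G (0, y)).
Proof.
move=> oO cc c0 c1 cO He0 hh0 Nhh hd1 m0 mh mw.
have [|La [LaE _]] := @aff_ex R (0, y0 - hh) (hh, 0) (0, hh).
  by rewrite /= mul0r subr0 mulf_neq0 // gt_eqF.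
have LaE' z : La z = (z.1 * hh, y0 - hh + z.2 * hh).
  by rewrite LaE /affmap /=; congr pair; ring.
pose near u t := `|u.1%:~R * hh - (c t).1| < 2 * hh /\ `|y0 - hh + u.2%:~R * hh - (c t).2| < 2 * hh.
pose S := [set u : pt | [/\ - m < u.1 < m, 0 < u.2 < N.+2%:Z & exists2 t, 0 <= t <= 1 & near u t]].
pose v t : pt := (Num.floor ((c t).1 / hh), Num.floor (((c t).2 - y0) / hh) + 1).
have vP t : (v t).1%:~R * hh <= (c t).1 < ((v t).1%:~R + 1) * hh /\
     y0 + ((v t).2%:~R - 1) * hh <= (c t).2 < y0 + (v t).2%:~R * hh.
  have /andP[a1 a2] := Num.Theory.floor_itv ((c t).1 / hh).
  have /andP[b1 b2] := Num.Theory.floor_itv (((c t).2 - y0) / hh).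
  rewrite /v /= intrD addrK; move: a1 a2 b1 b2; rewrite !intrD.
  rewrite ler_pdivlMr // ltr_pdivrMr // ler_pdivlMr // ltr_pdivrMr //; lra.
have vS t u : 0 <= t <= 1 -> (u.1 = (v t).1 \/ u.1 = (v t).1 + 1 \/ u.1 = (v t).1 - 1) ->
    u.2 = (v t).2 -> S u.
  move=> t01 hu1 hu2; have [cw /andP[cy0 cy1]] := cO t t01.
  have [/andP[a1 a2] /andP[b1 b2]] := vP t.
  move: cw; rewrite ler_norml => /andP[cw1 cw2].
  have u1 : (u.1%:~R - 1) * hh <= (c t).1 /\ (c t).1 < (u.1%:~R + 2) * hh.
    by case: hu1 => [->|[->|->]]; rewrite ?intrD ?intrB; clear -a1 a2 hh0; lra.
  have lt_hh (a b : int) : a%:~R * hh < b%:~R * hh -> a < b by rewrite ltr_pM2r // ltr_int.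
  split.
  - apply/andP; split; apply: lt_hh; rewrite ?mulrNz; lra.
  - rewrite hu2; apply/andP; split; apply: lt_hh; rewrite ?mul0r; first by lra.
    have -> : N.+2%:Z%:~R = N%:R + 2 :> R by rewrite -pmulrn -addn2 natrD.
    lra.
  - by exists t => //; split; rewrite ltr_norml ?hu2; apply/andP; split; clear -u1 b1 b2 hh0; lra.
have v0 : v 0 = (0, 1).
  by rewrite /v c0 /= mul0r subrr mul0r floor0.
have v1 : v 1 = (0, N.+1%:Z).
  rewrite /v c1 /= mul0r floor0 -Nhh mulfK ?gt_eqF // (pmulrn 1 N) intrKfloor -addn1 PoszD; congr pair.
have walk01 : walks S (v 0) (v 1).
  (* Instead of subdividing [[0, 1]], connectedness is applied to the relation of being joined by a
     walk. *)
  apply: (@itv_equiv R (fun s t => walks S (v s) (v t))) => //.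
  - by move=> s t u; exact: walks_trans.
  - by move=> s t; exact: walks_sym.
  - by apply: walks_refl; apply: (vS 0) => //; [lra|left].
  move=> t t01.
  have /cc : nbhs (c t) (bx (c t) hh) by apply/nbhs_bx; exists hh.
  move=> /nbhs_ballP[r r0 rH]; exists r => // s s01 /rH [h1 h2].
  have [/andP[a1 a2] /andP[b1 b2]] := vP t; have [/andP[a1' a2'] /andP[b1' b2']] := vP s.
  move: h1 h2; rewrite !ltr_norml => /andP[h1 h2] /andP[h3 h4].
  have lt_hh (a b : int) : a%:~R * hh < b%:~R * hh -> a < b by rewrite ltr_pM2r // ltr_int.
  have k1 : (v s).1 < (v t).1 + 2 by apply: lt_hh; rewrite intrD; lra.
  have k2 : (v t).1 < (v s).1 + 2 by apply: lt_hh; rewrite intrD; lra.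
  have k3 : (v s).2 < (v t).2 + 2 by apply: lt_hh; rewrite intrD; lra.
  have k4 : (v t).2 < (v s).2 + 2 by apply: lt_hh; rewrite intrD; lra.
  have St : S (v t) by apply: (vS t) => //; left.
  have Ss : S (v s) by apply: (vS s) => //; left.
  (* The cells at [s] and [t] differ by at most one in each coordinate; this mixed point turns a
     diagonal step into two admissible ones. *)
  have Sw : S ((v s).1, (v t).2) by apply: (vS t) => //; exact: int_near.
  have E1 (u u' : pt) : S u -> S u' -> u = u' \/ adj u u' -> walks S u u'.
    by move=> Su Su' [->|]; [exact: walks_refl|exact: walks1].
  move: (v s) (v t) k1 k2 k3 k4 Sw St Ss => [a b] [a' b'] /= k1 k2 k3 k4 Sw St Ss.
  apply: (@walks_trans _ _ (a, b')); apply: E1 => //.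
    have [|[|]] := int_near k1 k2 => E; [left|right|right]; rewrite E //.
      by right; split => //; left.
    by right; split => //; right.
  have [|[|]] := int_near k3 k4 => E; [left|right|right]; rewrite E //.
    by left; split => //; left.
  by left; split => //; right.
rewrite v0 v1 in walk01.
have [||n [p [lp pS p1 pn]]] := @lpath_extend S m N _ _ walk01.
- by move=> u [].
- by [].
have near_seg u u' t : 0 <= t <= 1 -> near u t -> adj u u' -> @seg R u u' `<=` [set z | O (La z)].
  move=> t01 [n1 n2] uu z [s s01 ->] /=; apply: (He0 t t01); rewrite LaE' /lin /int_pt /=.
  move: n1 n2; rewrite /bx /= !ltr_norml => /andP[n1 n2] /andP[n3 n4].
  have s1 : 0 <= s * hh <= hh by rewrite mulr_ge0 ?ler_piMl ?(ltW hh0) //; lra.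
  move: uu => [[<- [->|->]]|[<- [->|->]]]; rewrite ?intrD ?intrB; split;
    apply/andP; split; clear -n1 n2 n3 n4 s1 hd1 hh0; lra.
have near0 : near (0, 1) 0 by rewrite /near c0 /= !ltr_norml !mul0r; lra.
have near1 : near (0, N.+1%:Z) 1.
  have NE : N.+1%:Z%:~R = N%:R + 1 :> R by rewrite -pmulrn -addn1 natrD.
  have Nhh1 : (N%:R + 1) * hh = y1 - y0 + hh by rewrite mulrDl Nhh mul1r.
  by rewrite /near c1 /= NE Nhh1 mul0r !ltr_norml; lra.
have [||G0 G0b G0V] := @lpath_straightenable R m N.+2%:Z _ p _ lp _ (@hfun_open _ La O oO) _.
- by [].
- move=> k kn; have [p0 _ pad _ _] := lp.
  have [->|k0] := posnP k.
    rewrite seg_sym; apply: (near_seg _ _ 0); rewrite ?p1 //; first by lra.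
    by rewrite -p1; apply: adj_sym; exact: pad.
  have [_ _ [t t01 nt]] : S (p k) by apply: pS; lia.
  by apply: (near_seg _ _ t) => //; apply: pad.
exists (hconj La G0).
  apply: (fixoff_conj G0b) => q [] /=; rewrite LaE' /= => /andP[q1 q2] /andP[q3 q4]; split.
    have h1 : q.1 * hh < m%:~R * hh by rewrite ltr_pM2r.
    have h2 : - m%:~R * hh < q.1 * hh by rewrite ltr_pM2r.
    by rewrite ltr_norml; apply/andP; split; lra.
  have -> : y1 + hh = y0 - hh + (N.+2%:Z%:~R) * hh.
    have -> : N.+2%:Z%:~R = N%:R + 2 :> R by rewrite -pmulrn -addn2 natrD.
    by rewrite [(N%:R + _) * _]mulrDl Nhh; ring.
  by rewrite ltrDl mulr_gt0 // ltrD2l ltr_pM2r.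
move=> y /andP[ya yb] /=.
have -> : hinv La (0, y) = (0, (y - y0 + hh) / hh).
  apply: (@hfun_inj _ La); rewrite hinvK LaE' /= mul0r divfK ?gt_eqF //; congr pair; ring.
apply: G0V; rewrite divr_ge0 ?(ltW hh0) ?ler_pdivrMr //=; last by lra.
have -> : N.+2%:Z%:~R = N%:R + 2 :> R by rewrite -pmulrn -addn2 natrD.
by rewrite [(N%:R + _) * _]mulrDl Nhh; lra.
Qed.

(** Only the mesh remains to be chosen: [hh] divides [y1 - y0] exactly, so that both ends are
    lattice points, and the margin [e] by which the slab and the segment overshoot is one mesh. *)
Lemma unknot (O : set P) (c : R -> P) (y0 y1 w w' eta : R) : open O -> ctsf c ->
  c 0 = (0, y0) -> c 1 = (0, y1) -> y0 < y1 -> 0 <= w -> w < w' -> 0 < eta ->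
  (forall t : R, 0 <= t <= 1 -> [/\ O (c t), `|(c t).1| <= w & y0 <= (c t).2 <= y1]) ->
  exists2 e, 0 < e <= eta & exists2 G : homeo P,
    fixoff [set z | `|z.1| < w' /\ y0 - e < z.2 < y1 + e] G &
    forall y, y0 - e <= y <= y1 + e -> O (G (0, y)).
Proof.
move=> oO cc c0 c1 y01 w0 ww' eta0 cO.
have [|e0 e00 He0] := path_thick oO cc; first by move=> t /cO[].
have [d d0 [de0 [deta dw]]] : exists2 d, 0 < d & d <= e0 /\ d <= eta /\ d <= w' - w.
  exists (Num.min e0 (Num.min eta (w' - w))).
    by rewrite !lt_min e00 eta0 subr_gt0 ww'.
  by rewrite !ge_min !lexx !orbT.
have [N N0 Nd] : exists2 N, (0 < N)%N & 4 * (y1 - y0) / d < N%:R.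
  exists (Num.truncn (4 * (y1 - y0) / d)).+1 => //.
  have q0 : 0 <= 4 * (y1 - y0) / d by rewrite divr_ge0 ?(ltW d0) // mulr_ge0 // subr_ge0 ltW.
  by have /andP[] := Num.Theory.truncn_itv q0.
have NR0 : 0 < N%:R :> R by rewrite ltr0n.
have [hh hh0 Nhh] : exists2 hh, 0 < hh & N%:R * hh = y1 - y0.
  exists ((y1 - y0) / N%:R); first by rewrite divr_gt0 // subr_gt0.
  by rewrite mulrC divfK // gt_eqF.
have hd : 4 * hh < d.
  by move: Nd; rewrite ltr_pdivrMr // -Nhh mulrCA ltr_pM2l.
have [m m0 [mh mw]] : exists2 m : int, 0 < m & m%:~R * hh <= w' /\ w < (m%:~R - 2) * hh.
  exists ((Num.truncn (w / hh)).+3%:Z) => //.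
  have wh0 : 0 <= w / hh by rewrite divr_ge0 // ltW.
  have /andP[] := Num.Theory.truncn_itv wh0.
  move: (Num.truncn (w / hh)) => k; rewrite ler_pdivlMr // ltr_pdivrMr // => k1 k2.
  have -> : k.+3%:Z%:~R = k%:R + 3 :> R by rewrite -pmulrn -addn3 natrD.
  by move: k2; rewrite -addn1 natrD; lra.
have [||G Gb GO] := @unknot_grid O c y0 y1 w w' hh e0 N m oO cc c0 c1 _ He0 hh0 Nhh _ m0 mh mw.
- by move=> t /cO[].
- by lra.
by exists hh; [lra|exists G].
Qed.

End LemmaU.

(** * Products and explicit plane homeomorphisms *)

Lemma glue_cts (T U : topologicalType) (f : T -> U) :
  (forall z, exists2 A : set T, open A /\ A z & exists2 g : T -> U, continuous g & forall w, A w -> f w = g w) ->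
  continuous f.
Proof.
move=> H z; have [A [oA Az] [g cg fg]] := H z.
have nA : nbhs z A by exact: open_nbhs_nbhs.
rewrite /continuous_at (fg z Az); apply: (cvg_trans _ (cg z)).
apply: near_eq_cvg; apply: (filterS _ nA) => w Aw; exact: esym (fg w Aw).
Qed.

(** Innermost [min] and [max] are split first, so that the hypotheses of the cases are linear. *)
Ltac no_maxmin a := lazymatch a with
  | context [Num.min _ _] => fail | context [Num.max _ _] => fail | _ => idtac end.
Ltac maxmin_in := repeat match goal with
  | |- context [Num.min ?a ?b] => no_maxmin a; no_maxmin b; case: (leP a b) => ?
  | |- context [Num.max ?a ?b] => no_maxmin a; no_maxmin b; case: (ltP a b) => ? end.

Section Products.
Variable T : topologicalType.
Implicit Types (f g h : homeo T) (D : set T).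

Fixpoint iprod (G : nat -> homeo T) (n : nat) : homeo T :=
  if n is k.+1 then hcomp (G k) (iprod G k) else hid.

Lemma iprod_hprod G n : exists s, [/\ (size s <= n)%N, hprod s =1 iprod G n &
   forall f, List.In f s -> exists2 k, (k < n)%N & f = G k].
Proof.
elim: n => [|n [s [sn sE sG]]]; first by exists [::]; split.
exists (G n :: s); split => //.
  by move=> z /=; rewrite sE.
move=> f /= [<-|/sG[k kn ->]]; first by exists n.
by exists k => //; lia.
Qed.

Lemma iprod_disj (G : nat -> homeo T) (D : nat -> set T) n :
  (forall i, (i < n)%N -> fixoff (D i) (G i)) ->
  (forall i j z, (i < n)%N -> (j < n)%N -> D i z -> D j z -> i = j) ->
  (forall i z, (i < n)%N -> D i z -> iprod G n z = G i z) /\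
  (forall z, (forall i, (i < n)%N -> ~ D i z) -> iprod G n z = z).
Proof.
elim: n => [|n IH] HG HD; first by split.
have [IH1 IH2] := IH (fun i li => HG i (ltnW li)) (fun i j z li lj => HD i j z (ltnW li) (ltnW lj)).
split => [i z|z zD] /=.
  rewrite ltnS leq_eqVlt => /orP[/eqP -> Dz|ii Dz].
    rewrite IH2 // => j jn Djz; have := HD j n z (ltnW jn) (ltnSn n) Djz Dz.
    by move=> E; move: jn; rewrite E ltnn.
  rewrite (IH1 i) // (HG n) // => Dn.
  have Di : D i (G i z) by apply: fixoff_stable => //; apply: HG; exact: ltnW.
  have E := HD i n _ (ltnW ii) (ltnSn n) Di Dn.
  by move: ii; rewrite E ltnn.
rewrite IH2; first by apply: HG => //; exact: zD.
by move=> i ii; apply: zD; exact: ltnW.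
Qed.

Lemma iprod_conj h (G : nat -> homeo T) n : hconj h (iprod G n) =1 iprod (fun i => hconj h (G i)) n.
Proof.
elim: n => [|n IH] z /=; first by rewrite hinvK.
by rewrite -IH /= hfunK.
Qed.

Lemma iprod_eq (G G' : nat -> homeo T) n : (forall i, (i < n)%N -> G i =1 G' i) ->
  iprod G n =1 iprod G' n.
Proof.
elim: n => [//|n IH] H z /=; rewrite H // IH // => i ii; apply: H; exact: ltnW.
Qed.

Lemma hprod_conj h s : hconj h (hprod s) =1 hprod (map (hconj h) s).
Proof.
elim: s => [|f s IH] z /=; first by rewrite hinvK.
by rewrite -IH /= hfunK.
Qed.

(** Continuity at the frontier of [D] comes from [A]: a point outside [D] has the complement of [A]
    as a neighbourhood, and there the restriction is the identity. *)
Lemma restr_ex f D (A : set T) : open D -> closed A -> A `<=` D ->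
  (forall z, D z -> ~ A z -> f z = z) -> (forall z, D z -> D (f z)) ->
  (forall z, D z -> D (hinv f z)) ->
  exists2 g, fixoff D g & forall z, D z -> g z = f z.
Proof.
move=> oD cA AD fA fD fD'.
have fA' z : D z -> ~ A z -> hinv f z = z by move=> Dz Az; rewrite -[in LHS](fA z Dz Az) hfunK.
pose r (k : T -> T) z := if pselect (D z) then k z else z.
have rc (k : T -> T) : continuous k -> (forall z, D z -> ~ A z -> k z = z) -> continuous (r k).
  move=> ck kA; apply: glue_cts => z.
  have [Dz|Dz] := pselect (D z).
    exists D => //; exists k => // w Dw; rewrite /r; by case: pselect.
  exists (~` A); first by split; [exact: closed_openC|move=> /AD].
  exists id; first by move=> w; exact: cvg_id.
  by move=> w Aw; rewrite /r; case: pselect => // Dw; exact: kA.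
have rK (k k' : T -> T) : cancel k k' -> (forall z, D z -> D (k z)) -> cancel (r k) (r k').
  move=> kk kD z; rewrite /r; case: (pselect (D z)) => Dz; last by case: pselect.
  by case: pselect => [?|H]; [exact: kk|exfalso; apply: H; exact: kD].
exists (Homeo (rc f (@hfun_cts _ f) fA) (rc (hinv f) (@hinv_cts _ f) fA')
   (rK _ _ (@hfunK _ f) fD) (rK _ _ (@hinvK _ f) fD')).
  by move=> z Dz; rewrite /= /r; case: pselect.
by move=> z Dz; rewrite /= /r; case: pselect.
Qed.

End Products.

(** * Cut-offs, contractions and rescaled copies of a box *)

Section Constructions.
Variable R : realType.
Local Notation P := (R * R)%type.

Lemma lip_min (a a' b b' d : R) : `|a - a'| <= d -> `|b - b'| <= d ->
  `|Num.min a b - Num.min a' b'| <= d.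
Proof.
rewrite !ler_norml => /andP[h1 h2] /andP[h3 h4].
by case: (leP a b) => ?; case: (leP a' b') => ?; lra.
Qed.

(* plateau: 1 on [1 - r, r - 1], 0 outside [- r, r] *)
Definition trap (r u : R) := Num.min 1 (tent r u).

Lemma ctrap_cts k r c : continuous (fun y => k * trap r (y - c)).
Proof. by apply: (ctsfW (f := fun y => k * Num.min 1 (Num.max 0 (r - `|y - c|)))); cts. Qed.
Lemma trap_cts r : continuous (trap r).
Proof. by apply: (ctsfW (f := fun y => Num.min 1 (Num.max 0 (r - `|y|)))); cts. Qed.
Lemma trap_lip r x x' : `|trap r x - trap r x'| <= `|x - x'|.
Proof. by apply: lip_min; [rewrite subrr normr0|exact: tent_lip]. Qed.
Lemma trap1 r u : `|u| <= r - 1 -> trap r u = 1.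
Proof. by move=> h; apply/min_idPl; rewrite /tent le_max; apply/orP; right; lra. Qed.
Lemma trap0 r u : r <= `|u| -> trap r u = 0.
Proof. by move=> h; rewrite /trap tent_off //; exact/min_idPr. Qed.
Lemma trap01 r u : 0 <= trap r u <= 1.
Proof. by rewrite /trap le_min ler01 tent_ge0 ge_min lexx. Qed.

(* slope 1 on [-3g/4, 3g/4], then back to 0 at -g and g with slope -3 *)
Definition zig (g u : R) := Num.min (Num.max u (Num.min 0 (3 * (- g - u)))) (Num.max 0 (3 * (g - u))).

Lemma zig_slope g u u' : u < u' -> zig g u' - zig g u <= u' - u.
Proof.
have mn (a a' b b' e : R) : a' - a <= e -> b' - b <= e -> Num.min a' b' - Num.min a b <= e.
  by case: (leP a' b') => ?; case: (leP a b) => ?; lra.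
have mx (a a' b b' e : R) : a' - a <= e -> b' - b <= e -> Num.max a' b' - Num.max a b <= e.
  by case: (ltP a' b') => ?; case: (ltP a b) => ?; lra.
move=> uu; rewrite /zig; apply: (mn); first apply: (mx); [lra|apply: (mn); lra|].
by apply: (mx); lra.
Qed.

Lemma zig_id g u : 0 < g -> `|u| <= 3 * g / 4 -> zig g u = u.
Proof. by move=> g0; rewrite ler_norml => /andP[h1 h2]; rewrite /zig; maxmin_in; lra. Qed.

Lemma zig_off g u : 0 < g -> g <= `|u| -> zig g u = 0.
Proof.
by move=> g0; rewrite leNgt ltr_norml negb_and -!leNgt => /orP[h|h]; rewrite /zig; maxmin_in; lra.
Qed.

Lemma zig_bound g u : 0 < g -> `|zig g u| <= g.
Proof.
move=> g0; have [h|h] := leP g `|u|; first by rewrite zig_off // normr0 ltW.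
move: h; rewrite ltr_norml ler_norml => /andP[h1 h2]; rewrite /zig.
by maxmin_in; lra.
Qed.

Lemma hcontract (s : R -> R) (g c : R) : continuous s -> (forall y, 0 <= s y < 1) -> 0 < g ->
  exists f : homeo P, forall z, f z = (z.1 - s z.2 * zig g (z.1 - c), z.2).
Proof.
move=> cs s01 g0; pose m (x : R) := - zig g (x - c).
have cm : continuous m.
  by apply: (ctsfW (f := fun x => - Num.min (Num.max (x - c) (Num.min 0 (3 * (- g - (x - c))))) (Num.max 0 (3 * (g - (x - c)))))); cts.
have [y|y x|f fE] := @hshear_ex R s m g cs cm.
- have /andP[t0 t1] := s01 y.
  apply: (@bump_mono _ (s y) 1) => //; first by rewrite mulr1.
  by move=> x x' xx; have := @zig_slope g (x - c) (x' - c); rewrite /m; lra.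
- have /andP[t0 t1] := s01 y; rewrite /m mulrN normrN normrM (ger0_norm t0).
  by apply: le_trans (zig_bound (x - c) g0); rewrite ler_piMl // ltW.
by exists f => z; rewrite fE /m mulrN.
Qed.

Lemma vcontract (s : R -> R) (g c : R) : continuous s -> (forall x, 0 <= s x < 1) -> 0 < g ->
  exists f : homeo P, forall z, f z = (z.1, z.2 - s z.1 * zig g (z.2 - c)).
Proof.
move=> cs s01 g0; have [f fE] := hcontract c cs s01 g0.
have [w wE] := @swap_ex R.
by exists (hconj w f) => z /=; rewrite (wE z).2 fE (wE _).1.
Qed.

Definition O2 : P := (0, 0).

Lemma off_bx8 z : ~ bx O2 8 z -> 8 <= `|z.1| \/ 8 <= `|z.2|.
Proof.
rewrite /bx /= !subr0 => H.
by case: (leP 8 `|z.1|) => h1; [left|right; rewrite leNgt; apply/negP => h2; apply: H].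
Qed.

(** Conjugation by this map shrinks a motion of the unit box and places it on the axis. [zig 4] is
    linear up to 3 and [trap 7] is 1 up to 6, so both contractions and the shift are exact on the
    box of radius 2; all cut-offs vanish before 8. *)
Lemma box_copy (la a : R) : 0 < la < 1 -> 0 <= a < 1 ->
  exists2 h : homeo P, fixoff (bx O2 8) h &
    forall z, bx O2 2 z -> h z = (la * z.1, a + la * z.2).
Proof.
move=> /andP[l0 l1] /andP[a0 a1].
have cs (k : R) : continuous (fun y => k * trap 7 y).
  by apply: (ctsfW (f := fun y => k * Num.min 1 (Num.max 0 (7 - `|y|)))); cts.
have s01 y : 0 <= (1 - la) * trap 7 y < 1.
  have /andP[t0 t1] := trap01 7 y; have l2 : 0 <= 1 - la by lra.
  by rewrite mulr_ge0 //=; apply: (@le_lt_trans _ _ (1 - la)); [rewrite ler_piMr|lra].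
have [f fE] := hcontract 0 (cs (1 - la)) s01 (ltr0Sn R 3).
have [g gE] := vcontract 0 (cs (1 - la)) s01 (ltr0Sn R 3).
have ta y : `|a * trap 7 y| < 1.
  have /andP[t0 t1] := trap01 7 y.
  by rewrite ger0_norm ?mulr_ge0 //; apply: (@le_lt_trans _ _ a) => //; rewrite ler_piMr.
have tb x : `|trap 7 x| <= 1 by have /andP[t0 t1] := trap01 7 x; rewrite ger0_norm.
have [k kE] := vlip_ex (cs a) (@trap_cts 7) ta (@trap_lip 7) tb.
exists (hcomp k (hcomp g f)).
  have t70 x : 8 <= `|x| -> trap 7 x = 0 by move=> h; apply: trap0; lra.
  have z40 x : 8 <= `|x| -> zig 4 (x - 0) = 0 by move=> h; rewrite subr0 zig_off //; lra.
  have fo : fixoff (bx O2 8) f.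
    by move=> z /off_bx8[h|h]; rewrite fE; [rewrite z40 // mulr0|rewrite t70 // mulr0 mul0r];
      rewrite subr0; case: (z).
  have go : fixoff (bx O2 8) g.
    by move=> z /off_bx8[h|h]; rewrite gE; [rewrite t70 // mulr0 mul0r|rewrite z40 // mulr0];
      rewrite subr0; case: (z).
  have ko : fixoff (bx O2 8) k.
    move=> z /off_bx8[h|h]; rewrite kE; [rewrite (t70 z.1)|rewrite (t70 z.2)] => //;
      by rewrite ?mulr0 ?mul0r addr0; case: (z).
  by do 2 apply: fixoff_comp => //.
move=> z [] /=; rewrite !subr0 => z1 z2.
have tr1 x : `|x| < 2 -> trap 7 x = 1 by move=> h; apply: trap1; lra.
have zi x : `|x| < 2 -> zig 4 (x - 0) = x by move=> h; rewrite subr0 zig_id //; lra.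
have lz x : `|x| < 2 -> `|la * x| < 2.
  by move=> h; rewrite normrM (gtr0_norm l0); apply: (le_lt_trans _ h); rewrite ler_piMl // ltW.
have lE x : x - (1 - la) * 1 * x = la * x by ring.
have := lz _ z1; have := lz _ z2 => lz2 lz1.
by rewrite /= fE tr1 // zi // lE gE /= tr1 // zi // lE kE /= !tr1 // !mulr1 addrC.
Qed.

Lemma box_shift (a : R) : -1 <= a <= 1 ->
  exists2 h : homeo P, fixoff (bx O2 8) h &
    forall z, bx O2 3 z -> h z = (z.1 + a, z.2).
Proof.
move=> /andP[a1 a2].
have ca : continuous (fun y => a / 2 * trap 7 y).
  by apply: (ctsfW (f := fun y => a / 2 * Num.min 1 (Num.max 0 (7 - `|y|)))); cts.
have ta y : `|a / 2 * trap 7 y| < 1.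
  have /andP[t0 t1] := trap01 7 y.
  rewrite normrM (ger0_norm t0); apply: (@le_lt_trans _ _ `|a / 2|); first by rewrite ler_piMr.
  by rewrite ltr_norml; lra.
have tb x : `|trap 7 x| <= 1 by have /andP[t0 t1] := trap01 7 x; rewrite ger0_norm.
have [k kE] := hlip_ex ca (@trap_cts 7) ta (@trap_lip 7) tb.
have ko : fixoff (bx O2 8) k.
  have t70 x : 8 <= `|x| -> trap 7 x = 0 by move=> h; apply: trap0; lra.
  move=> z /off_bx8[h|h]; rewrite kE; [rewrite (t70 z.1)|rewrite (t70 z.2)] => //;
    by rewrite ?mulr0 ?mul0r addr0; case: (z).
(* Two half shifts: one shear needs an amplitude below 1, while [|a| = 1] is allowed. *)
exists (hcomp k k); first exact: fixoff_comp.
move=> z [] /=; rewrite !subr0 => z1 z2.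
have t6 : `|z.1 + a / 2| <= 7 - 1.
  by move: z1; rewrite ltr_norml ler_norml => /andP[h1 h2]; lra.
have t1 : trap 7 z.1 = 1 by apply: trap1; apply: ltW; apply: (lt_trans z1); lra.
have t2 : trap 7 z.2 = 1 by apply: trap1; apply: ltW; apply: (lt_trans z2); lra.
rewrite /= !kE /= t1 t2 !mulr1 trap1 // mulr1; congr pair; lra.
Qed.

End Constructions.

(** * Compressing the vertical axis *)

Section Compression.
Variable R : realType.
Local Notation P := (R * R)%type.

Lemma axis_thick (W : set P) (x a b : R) : open W -> a <= b ->
  (forall y, a <= y <= b -> W (x, y)) ->
  exists2 e, 0 < e & forall y, a <= y <= b -> bx (x, y) e `<=` W.
Proof.
move=> oW ab H.
have [|t /andP[t0 t1]|e e0 He] := @path_thick R (fun t => (x, (1 - t) * a + t * b)) W oW; first by cts.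
  by apply: H; apply/andP; split; nra.
exists e => // y /andP[ya yb].
move: ab; rewrite le_eqVlt => /orP[/eqP E|ab].
  have -> : y = (1 - 0) * a + 0 * b by lra.
  by apply: He; lra.
have ba : b - a != 0 by rewrite gt_eqF // subr_gt0.
have -> : y = (1 - (y - a) / (b - a)) * a + (y - a) / (b - a) * b by field.
apply: He; rewrite divr_ge0 ?subr_ge0 ?(ltW ab) //= ler_pdivrMr ?subr_gt0 //; lra.
Qed.

(* [a, b] is pushed down the axis into [a, a + eta]; the slope [kap] of the push is positive, so that it is injective *)
Lemma compress_ex (W : set P) (a b eta : R) : open W -> a < b -> 0 < eta ->
  (forall y, a <= y <= b -> W (0, y)) ->
  exists2 f : homeo P, fixoff W f &
    (forall y, y <= a -> f (0, y) = (0, y)) /\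
    forall y, a <= y <= b -> exists2 y', a <= y' <= a + eta & f (0, y) = (0, y').
Proof.
move=> oW ab eta0 HW.
have [e e0 He] := axis_thick oW (ltW ab) HW.
pose e' := e / 2; have e'0 : 0 < e' by rewrite divr_gt0.
have ee' : e' < e by rewrite /e'; lra.
have ba : 0 < b - a by rewrite subr_gt0.
have [kap [k0 k1] kE] : exists2 k, 0 < k /\ k <= 1 / 2 & k * (b - a) <= eta.
  exists (Num.min (1 / 2) (eta / (b - a))).
    by rewrite lt_min divr_gt0 // ge_min lexx !divr_gt0.
  have : Num.min (1 / 2) (eta / (b - a)) <= eta / (b - a) by rewrite ge_min lexx orbT.
  by rewrite ler_pdivlMr.
(* With this slope the falling branch of [M] has height [b - a] at [y = b], so it does not clip the
   rising branch on [[a, b]], and it vanishes at [b + e']. A steep fall of [M] is harmless because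
   the displacement is [- M]. *)
pose K := (b - a) / e'; have K0 : 0 < K by rewrite divr_gt0.
have KE : K * e' = b - a by rewrite /K divfK // gt_eqF.
pose M y := Num.max 0 (Num.min ((1 - kap) * (y - a)) (K * (b + e' - y))).
have M0 y : 0 <= M y by rewrite /M le_max lexx.
have Mslope y y' : y < y' -> M y' - M y <= (1 - kap) * (y' - y).
  move=> yy; have := M0 y; have l : 0 <= (1 - kap) * (y' - y) by rewrite mulr_ge0 //; lra.
  have Kl : K * (b + e' - y') <= K * (b + e' - y) by rewrite ler_pM2l //; lra.
  by rewrite /M; clear -l Kl; maxmin;  lra.
have MC y : M y <= b + e - a.
  have l : 0 <= b + e - a by lra.
  have [yb|yb] := ltP y (b + e').
    rewrite /M ge_max l ge_min; apply/orP; left.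
    have [ya|ya] := ltP y a; last by nra.
    by apply: (@le_trans _ _ 0) => //; rewrite mulr_ge0_le0; lra.
  rewrite /M ge_max l ge_min; apply/orP; right.
  by apply: (@le_trans _ _ 0) => //; rewrite mulr_ge0_le0; lra.
pose s x := tent e x / e.
have s0 x : 0 <= s x by apply: divr_ge0; [exact: tent_ge0|exact: ltW].
have s1 x : s x <= 1 by rewrite /s ler_pdivrMr // mul1r tent_le // ltW.
have cs : continuous s.
  by apply: (ctsfW (f := fun x => Num.max 0 (e - `|x|) / e)); cts.
have cM : continuous (fun y => - M y).
  by apply: (ctsfW (f := fun y => - Num.max 0 (Num.min ((1 - kap) * (y - a)) (K * (b + e' - y))))); cts.
have [||f fE] := @vshear_ex R s (fun y => - M y) (b + e - a) cs cM.
- move=> x; apply: (@bump_mono _ (s x) (1 - kap)) => //.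
    by apply: (@le_lt_trans _ _ (1 - kap)); [rewrite ler_piMl //; lra|lra].
  by move=> y y' yy; have := Mslope y y' yy; lra.
- move=> x y; rewrite mulrN normrN (ger0_norm (mulr_ge0 (s0 x) (M0 y))).
  by apply: (le_trans _ (MC y)); rewrite ler_piMl.
have Ma y : y <= a -> M y = 0.
  move=> ya; apply/max_idPl; rewrite ge_min; apply/orP; left; rewrite mulr_ge0_le0 //; lra.
have s00 : s 0 = 1 by rewrite /s tent0 ?divff ?gt_eqF // ltW.
exists f.
  move=> [x y] nW; rewrite fE /=; congr pair.
  have [xe|xe] := ltP `|x| e; last by rewrite /s tent_off // mul0r mul0r addr0.
  have [ya|ya] := leP y a; first by rewrite Ma // oppr0 mulr0 addr0.
  have [yb|yb] := ltP y (b + e').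
    exfalso; apply: nW; have [yb'|yb'] := leP y b.
      by apply: (He y); [lra|split => /=; rewrite ?subr0 ?subrr ?normr0].
    apply: (He b); first lra.
    by split => /=; rewrite ?subr0 // ger0_norm; lra.
  suff -> : M y = 0 by rewrite oppr0 mulr0 addr0.
  apply/max_idPl; rewrite ge_min; apply/orP; right.
  by rewrite mulr_ge0_le0 //; lra.
split => [y ya|y /andP[ya yb]]; rewrite fE /= s00 mul1r.
  by rewrite Ma // oppr0 addr0.
exists (y - M y) => //.
have -> : M y = (1 - kap) * (y - a).
  rewrite /M; have -> : Num.min ((1 - kap) * (y - a)) (K * (b + e' - y)) = (1 - kap) * (y - a).
    apply/min_idPl; apply: (@le_trans _ _ (b - a)); first by nra.
    by rewrite -KE ler_pM2l //; lra.
  by apply/max_idPr; rewrite mulr_ge0 //; lra.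
have : kap * (y - a) <= kap * (b - a) by rewrite ler_pM2l //; lra.
have : 0 <= kap * (y - a) by rewrite mulr_ge0 //; lra.
by move=> h1 h2; lra.
Qed.

(** From the top down: the last interval is compressed so close to its lower end that it lands in
    the preceding set; the chain is then one shorter, its last breakpoint raised by [eta]. The
    topmost map acts first, hence [rcons]. *)
Lemma chain_compress (W : nat -> set P) K : (forall k, open (W k)) ->
  forall y : nat -> R, (forall k, (k <= K)%N -> y k < y k.+1) ->
  (forall k t, (k <= K)%N -> y k <= t <= y k.+1 -> W k (0, t)) ->
  exists s : seq (homeo P), [/\ (size s <= K)%N,
     forall f, List.In f s -> exists2 k, (k <= K)%N & fixoff (W k) f &
     forall t, y 0%N <= t <= y K.+1 -> W 0%N (hprod s (0, t))].
Proof.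
move=> oW; elim: K => [|K IH] y yy HW.
  by exists [::]; split => // t ht; apply: (HW 0%N).
have [e e0 He] : exists2 e, 0 < e & bx (0, y K.+1) e `<=` W K.
  by apply: open_bx => //; apply: HW => //; rewrite ltW ?lexx //; apply: yy.
pose eta := e / 2; have eta0 : 0 < eta by rewrite divr_gt0.
have [|f fW [f1 f2]] := compress_ex (oW K.+1) (yy K.+1 (leqnn _)) eta0; first by move=> t; exact: HW.
pose y' k := if k == K.+1 then y K.+1 + eta else y k.
have [||s [sK sW sy]] := IH y'.
- move=> k kK; rewrite /y' ifF; last by lia.
  have h := yy k (leqW kK); case: eqP => [E|_]; last by [].
  by move: E h => [->] h; lra.
- move=> k t kK; rewrite /y' ifF; last by lia.
  have [[kE]|ne] := eqVneq k.+1 K.+1; last by apply: HW; lia.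
  rewrite kE => /andP[t1 t2]; have [tK|tK] := leP t (y K.+1); first by apply: HW => //; rewrite t1.
  apply: He; split => /=; rewrite ?subrr ?normr0 // ger0_norm; rewrite /eta in t2; lra.
exists (rcons s f); split.
- by rewrite size_rcons.
- move=> g; rewrite -cats1 => /List.in_app_iff[/sW[k kK]|[<-|//]]; last by exists K.+1.
  by exists k => //; lia.
move=> t /andP[t1 t2]; rewrite -cats1 hprod_cat /=.
have y'E : y' K.+1 = y K.+1 + eta by rewrite /y' eqxx.
have y'0 : y' 0%N = y 0%N by [].
have yK : y 0%N <= y K.+1.
  have mono k : (k <= K.+1)%N -> y 0%N <= y k.
    elim: k => // k IHk kK; apply: (le_trans (IHk _)); first by lia.
    by apply/ltW/yy; lia.
  exact: mono.
rewrite y'E y'0 in sy.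
have [tK|tK] := leP t (y K.+1); first by rewrite f1 //; apply: sy; lra.
have [|t' /andP[t'1 t'2] ->] := f2 t; first by rewrite ltW.
by apply: sy; lra.
Qed.

(** [T] is the infimum of the times with value at least [v]. Stopping a curve there confines it to a
    slab or to a chart. *)
Lemma first_hit (g : R -> R) (v : R) : ctsf g -> g 0 < v -> v <= g 1 ->
  exists2 T, 0 <= T <= 1 & g T = v /\ forall t, 0 <= t <= T -> g t <= v.
Proof.
move=> cg g0 g1.
pose A := [set t : R | 0 <= t <= 1 /\ v <= g t].
have A1 : A 1 by split => //; lra.
have lbA : has_inf A by split; [exists 1|exists 0 => t [/andP[]]].
pose T := inf A.
have lb t : A t -> T <= t by move=> At; apply: ge_inf => //; exact: lbA.2.
have T0 : 0 <= T by apply: lb_le_inf; [exists 1|move=> t [/andP[]]].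
have T1 : T <= 1 by exact: lb.
have below t : 0 <= t -> t < T -> g t < v.
  move=> t0 tT; rewrite ltNge; apply/negP => vg.
  have : A t by split => //; lra.
  by move/lb; lra.
have gT : v <= g T.
  rewrite leNgt; apply/negP => gTv.
  have e0 : 0 < v - g T by rewrite subr_gt0.
  have /cg /nbhs_ballP[d d0 Hd] : nbhs (g T) (ball (g T) (v - g T)) by apply/nbhs_ballP; exists (v - g T).
  have [t At tTd] := inf_adherent d0 lbA.
  have Tt := lb t At; rewrite -/T in tTd.
  have : ball T d t by rewrite /ball /= distrC ger0_norm; lra.
  move=> /Hd; rewrite /ball /= distrC ltr_norml => /andP[_].
  by case: At => _ vg; lra.
have gTE : g T = v.
  apply/eqP; rewrite eq_le gT andbT leNgt; apply/negP => vgT.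
  have [||c cI cE] := @IVT R g 0 T v T0.
  - by apply: continuous_subspaceT.
  - by rewrite ge_min le_max (ltW g0) gT orbT.
  move: cI; rewrite in_itv /= => /andP[c0 cT].
  have : T <= c by apply: lb; split; [lra|rewrite cE].
  move=> Tc; have E : c = T by lra.
  by move: vgT; rewrite -E cE ltxx.
exists T; first by rewrite T0 T1.
split => // t /andP[t0]; rewrite le_eqVlt => /orP[/eqP ->|tT]; first by rewrite gTE.
by apply/ltW/below.
Qed.

End Compression.

(** * Neighbourhoods of the identity in the plane *)

Lemma choice_below (A : Type) (a0 : A) (Q : nat -> A -> Prop) n :
  (forall i, (i < n)%N -> exists a, Q i a) -> exists f, forall i, (i < n)%N -> Q i (f i).
Proof.
move=> H.
have /choice[f fQ] : forall i, exists a, (i < n)%N -> Q i a.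
  move=> i; have [/H[a Qa]|_] := boolP (i < n)%N; first by exists a.
  by exists a0.
by exists f.
Qed.

Lemma cvx_lt (R : realFieldType) (t x y m : R) : 0 <= t <= 1 -> `|x| < m -> `|y| < m ->
  `|(1 - t) * x + t * y| < m.
Proof.
move=> /andP[t0 t1] xm ym; pose k := Num.max `|x| `|y|.
have km : k < m by rewrite gt_max xm.
apply: le_lt_trans km; apply: (le_trans (ler_normD _ _)).
rewrite !normrM (ger0_norm t0) ger0_norm ?subr_ge0 //.
have -> : k = (1 - t) * k + t * k by ring.
by apply: lerD; apply: ler_wpM2l; rewrite ?subr_ge0 // le_max lexx ?orbT.
Qed.

Section PlaneDefs.
Variable R : realType.
Local Notation P := (R * R)%type.
Local Notation O2 := (O2 R).

Definition sup8 (f : homeo P) := fixoff (bx O2 8) f.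

(** What the plane argument retains of sigma: identity neighbourhoods, tested on homeomorphisms
    supported in the box of radius 8. [nn_small] says that sigma is coarser than the compact-open
    topology; [nn_move], with one [q] for all [N], that it is strictly coarser near the bad
    point. *)
Record group_nbhds (NN : set (set (P -> P))) : Prop := GroupNbhds {
  nn_mul : forall N, NN N -> exists2 M, NN M & forall f g : homeo P, sup8 f -> sup8 g ->
    M f -> M g -> N (f \o g);
  nn_inv : forall N, NN N -> exists2 M, NN M & forall f : homeo P, sup8 f -> M f -> N (hinv f);
  nn_conj : forall N (h : homeo P), NN N -> sup8 h ->
    exists2 M, NN M & forall f : homeo P, sup8 f -> M f -> N (hconj h f);
  nn_dir : forall N N', NN N -> NN N' -> exists2 M, NN M & M `<=` N `&` N';
  nn_small : forall N, NN N -> exists2 e, 0 < e & forall f : homeo P, sup8 f ->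
    (forall z, bx z e (f z)) -> N f;
  nn_move : exists q : P, [/\ bx O2 1 q, q <> O2 & (forall N, NN N ->
    exists f : homeo P, [/\ fixoff (bx O2 1) f, N f & f O2 = q])] }.

Lemma sup8_comp f g : sup8 f -> sup8 g -> sup8 (hcomp f g).
Proof. exact: fixoff_comp. Qed.
Lemma sup8_conj h f : sup8 h -> sup8 f -> sup8 (hconj h f).
Proof. by move=> h8 f8; do 2 apply: fixoff_comp => //; exact: fixoff_opp. Qed.

End PlaneDefs.

Section PlaneNbhds.
Variables (R : realType) (NN : set (set ((R * R) -> (R * R)))).
Hypothesis HN : group_nbhds NN.
Local Notation P := (R * R)%type.
Local Notation O2 := (O2 R).

Lemma nn_id N : NN N -> N (hid : homeo P).
Proof.
move=> /(nn_small HN)[e e0 H]; apply: H; first exact: fixoff_id.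
by move=> z; exact: bx_self.
Qed.

Lemma nn_eq (N : set (P -> P)) (f g : homeo P) : f =1 g -> N f -> N g.
Proof. by move=> /funext ->. Qed.

(** [M] depends on the length bound [k] but not on the word, so each construction below fixes its
    number of letters before it chooses a neighbourhood. *)
Lemma nn_word N k : NN N -> exists2 M, NN M & forall s : seq (homeo P), (size s <= k)%N ->
  (forall f, List.In f s -> sup8 f /\ (M f \/ M (hinv f))) -> N (hprod s).
Proof.
move=> NNN; elim: k N NNN => [|k IH] N NNN.
  by exists N => // -[|//] _ _; exact: nn_id.
have [M1 NM1 H1] := nn_mul HN NNN.
have [M2 NM2 H2] := IH _ NM1.
have [M3 NM3 H3] := nn_inv HN NM1.
have [M4 NM4 H4] := nn_dir HN NM1 NM2.
have [M NM HM] := nn_dir HN NM3 NM4.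
exists M => // -[|f s] /= ss Hs; first exact: nn_id.
have [f8 Mf] := Hs f (or_introl erefl).
have s8 : sup8 (hprod s) by apply: fixoff_prod => g gs; have [] := Hs g (or_intror gs).
apply: H1 => //.
  case: Mf => [/HM[_ /H4[]] //|Mf].
  by have := H3 (hopp f) (fixoff_opp f8) (HM _ Mf).1.
apply: H2 => // g gs; have [g8 Mg] := Hs g (or_intror gs); split => //.
by case: Mg => /HM[_ /H4[_]] ?; [left|right].
Qed.

Lemma nn_iprod N k : NN N -> exists2 M, NN M & forall (G : nat -> homeo P) n, (n <= k)%N ->
  (forall i, (i < n)%N -> sup8 (G i) /\ M (G i)) -> N (iprod G n).
Proof.
move=> /(@nn_word _ k)[M NM HM]; exists M => // G n nk HG.
have [s [sn sE sG]] := iprod_hprod G n.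
apply: (nn_eq sE); apply: HM; first exact: leq_trans nk.
by move=> f /sG[i ii ->]; have [G8 GM] := HG i ii; split => //; left.
Qed.

Lemma sup8_iprod (G : nat -> homeo P) n : (forall i, (i < n)%N -> sup8 (G i)) -> sup8 (iprod G n).
Proof.
elim: n => [|n IH] H /=; first exact: fixoff_id.
by apply: sup8_comp; [exact: H|apply: IH => i ii; apply: H; exact: ltnW].
Qed.

Lemma move_half N : NN N ->
  exists f : homeo P, [/\ fixoff (bx O2 1) f, N f & f O2 = (0, 1 / 2)].
Proof.
have n2 : (1 / 2 : R) != 0 by rewrite mul1r invr_eq0 pnatr_eq0.
have h1 : `|1 / 2 : R| < 1 by rewrite ltr_norml; lra.
have b18 : bx O2 1 `<=` bx O2 8 by apply: bxS; lra.
move=> NNN; have [q [q1 q0 Hq]] := nn_move HN.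
(* The box without its centre, as a union of two open sets that readily contain axis-parallel
   segments. The conjugator must fix the centre. *)
pose O := bx O2 1 `&` [set z : P | 0 < `|z.1|] `|` bx O2 1 `&` [set z : P | 0 < `|z.2|].
have oO : open O.
  have o1 : open [set z : P | 0 < `|z.1|].
    by apply: (@open_comp _ _ (fun z : P => `|z.1|) [set t | 0 < t]); [move=> z _; apply: ctsfW z; cts|exact: open_gt].
  have o2 : open [set z : P | 0 < `|z.2|].
    by apply: (@open_comp _ _ (fun z : P => `|z.2|) [set t | 0 < t]); [move=> z _; apply: ctsfW z; cts|exact: open_gt].
  by apply: openU; apply: openI => //; exact: bx_open.
have vert (x y y' : R) : `|x| < 1 -> `|y| < 1 -> `|y'| < 1 -> x != 0 -> reach O (x, y) (x, y').
  move=> x1 y1 y'1 x0.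
  have := @path_reach R O (fun t => (x, (1 - t) * y + t * y')) 0 1 oO.
  rewrite !mul0r !mul1r subr0 subrr mul0r mul1r addr0 add0r; apply => //; first by cts.
  move=> t /andP[t0 t1]; left; split; last by rewrite /= normr_gt0.
  split; rewrite /= !subr0 //.
  by apply: cvx_lt; rewrite ?t0.
have hor (x x' y : R) : `|x| < 1 -> `|x'| < 1 -> `|y| < 1 -> y != 0 -> reach O (x, y) (x', y).
  move=> x1 x'1 y1 y0.
  have := @path_reach R O (fun t => ((1 - t) * x + t * x', y)) 0 1 oO.
  rewrite !mul0r !mul1r subr0 subrr mul0r mul1r addr0 add0r; apply => //; first by cts.
  move=> t /andP[t0 t1]; right; split; last by rewrite /= normr_gt0.
  split; rewrite /= !subr0 //.
  by apply: cvx_lt; rewrite ?t0.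
have h0 : `|0 : R| < 1 by rewrite normr0.
have tgt (x y : R) : `|x| < 1 -> `|y| < 1 -> x != 0 -> reach O (x, y) (0, 1 / 2).
  move=> x1 y1 x0; apply: (@reach_trans _ _ _ (x, 1 / 2)); first exact: vert.
  exact: hor.
have [kap kO kq] : reach O q (0, 1 / 2).
  case: q q1 q0 {Hq} => x y [/=]; rewrite !subr0 => x1 y1 q0.
  have [x0|x0] := eqVneq x 0; last exact: tgt.
  have y0 : y != 0 by apply/eqP => y0; apply: q0; rewrite x0 y0.
  apply: (@reach_trans _ _ _ (1 / 2, y)); first exact: hor.
  exact: tgt.
have kb : fixoff (bx O2 1) kap by apply: fixoffS kO => z [] [].
have [M NM HM] := nn_conj HN NNN (fixoffS b18 kb).
have [f [f1 Mf fq]] := Hq M NM.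
exists (hconj kap f); split.
- by do 2 apply: fixoff_comp => //; exact: fixoff_opp.
- by apply: HM => //; exact: fixoffS f1.
have k0 : hopp kap O2 = O2.
  by apply: (fixoff_opp kO) => -[] [] _ /=; rewrite normr0 ltxx.
by move: k0 => /= k0; rewrite /= k0 fq.
Qed.

(** A chain of [K] rescaled copies of [move_half], each advancing by [s] inside a box of radius
    [2 * s] that fits in the tube. [K] is determined by the geometry, so the neighbourhood for [K]
    factors comes before the factors. *)
Lemma slide N (w yb a b yt : R) : NN N -> 0 < w <= 1 -> 0 <= yb -> yb < a -> a < b -> b < yt -> yt <= 1 ->
  exists H : homeo P, [/\ N H, fixoff [set z | `|z.1| < w /\ yb < z.2 < yt] H & H (0, a) = (0, b)].
Proof.
move=> NNN /andP[w0 w1] yb0 yba ab byt yt1.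
have [m m0 [[mw ma mb] m2]] : exists2 m, 0 < m & [/\ m <= w, m <= a - yb & m <= yt - b] /\ m <= 1 / 2.
  exists (Num.min (Num.min w (a - yb)) (Num.min (yt - b) (1 / 2))).
    by rewrite !lt_min w0; apply/andP; split; lra.
  by rewrite !ge_min !lexx !orbT.
have [K K0 KE] : exists2 K : nat, (0 < K)%N & 2 * (b - a) < m * K%:R.
  pose r := 2 * (b - a) / m.
  have r0 : 0 <= r by rewrite /r divr_ge0 ?(ltW m0) //; lra.
  exists (Num.bound r).+1 => //.
  have : r < (Num.bound r).+1%:R.
    by apply: (lt_trans (archi_boundP r0)); rewrite ltr_nat.
  by rewrite /r ltr_pdivrMr // (mulrC m).
have KR : 0 < K%:R :> R by rewrite ltr0n.
pose s := (b - a) / K%:R.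
have s0 : 0 < s by rewrite divr_gt0 // subr_gt0.
have sK : s * K%:R = b - a by rewrite /s divfK // gt_eqF.
have s2 : 2 * s < m.
  by rewrite -(ltr_pM2r KR) -mulrA sK; lra.
pose ai i := a + i%:R * s.
have aib i : (i < K)%N -> a <= ai i /\ ai i < b.
  move=> iK; rewrite /ai lerDl mulr_ge0 ?(ltW s0) // -ltrBrDl -sK mulrC ltr_pM2l // ltr_nat; split=> //.
have [M NM HM] := nn_iprod K NNN.
have ex i : (i < K)%N -> exists G : homeo P,
    [/\ M G, fixoff [set z | `|z.1| < w /\ yb < z.2 < yt] G & G (0, ai i) = (0, ai i.+1)].
  move=> iK; have [ai1 ai2] := aib i iK.
  have [||h h8 hE] := @box_copy R (2 * s) (ai i); [lra|lra|].
  have [M' NM' HM'] := nn_conj HN NM h8.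
  have [f [f1 fM f0]] := move_half NM'.
  have b18 : bx O2 1 `<=` bx O2 8 by apply: bxS; lra.
  exists (hconj h f); split.
  - by apply: HM' => //; exact: fixoffS f1.
  - apply: (fixoff_conj f1) => -[x y] xy; rewrite hE; last by apply: bxS xy; lra.
    case: xy => /=; rewrite !subr0 !ltr_norml => /andP[x1 x2] /andP[y1 y2].
    by split; apply/andP; split; clear -x1 x2 y1 y2 s0 s2 mw ma mb ai1 ai2; nra.
  have hO : h O2 = (0, ai i).
    by rewrite hE /= ?mulr0 ?addr0 //; apply: bx_self; lra.
  have b2 : bx O2 2 (0, 1 / 2) by split => /=; rewrite subr0 ?normr0 ?ltr_norml; lra.
  have -> : ai i.+1 = ai i + 2 * s * (1 / 2) by rewrite /ai -natr1; field.
  by rewrite -[in LHS]hO /= hfunK f0 (hE _ b2) /= mulr0.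
have [G HG] := choice_below (hid : homeo P) ex.
exists (iprod G K); split.
- apply: HM => // i iK; have [MG Gf _] := HG i iK; split => //.
  apply: (fixoffS _ Gf) => z /= [z1 /andP[z2 z3]]; split => /=; rewrite subr0.
    by apply: (lt_le_trans z1); lra.
  by rewrite ltr_norml; lra.
- have : forall k, (k <= K)%N -> fixoff [set z | `|z.1| < w /\ yb < z.2 < yt] (iprod G k).
    elim => [_|k IH kK] /=; first exact: fixoff_id.
    by apply: fixoff_comp; [have [] := HG k kK|exact: IH (ltnW kK)].
  exact.
have : forall k, (k <= K)%N -> iprod G k (0, a) = (0, ai k).
  elim => [_|k IH kK] /=; first by rewrite /ai mul0r addr0.
  by rewrite (IH (ltnW kK)); have [] := HG k kK.
move=> /(_ K (leqnn K)) ->; rewrite /ai mulrC sK; congr pair; lra.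
Qed.

End PlaneNbhds.

Section PlaneNbhds.
Variables (R : realType) (NN : set (set ((R * R) -> (R * R)))).
Hypothesis HN : group_nbhds NN.
Local Notation P := (R * R)%type.
Local Notation O2 := (O2 R).

Lemma fixoff_small (p : P) (r : R) (f : homeo P) : 0 < r -> fixoff (bx p r) f ->
  forall z, bx z (2 * r) (f z).
Proof.
move=> r0 fp z; have [hz|/fp ->] := pselect (bx p r z); last by apply: bx_self; rewrite mulr_gt0.
have := fixoff_stable fp hz; case: hz => h3 h4 [h1 h2]; move: h1 h2 h3 h4.
rewrite /bx /= !ltr_norml; clear; move=> /andP[? ?] /andP[? ?] /andP[? ?] /andP[? ?].
by split; apply/andP; split; lra.
Qed.

(** The arc starts as the image under [H] of an axis segment of length [rh], whose bottom [H] fixes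
    and whose top it slides up. It is cut where it first reaches height [y1], and the small map [zt]
    pushes its end onto the axis, so that [unknot] applies. [O] is the image of a small box under
    [zt] after [H]; a map supported in [O] is a five-letter word in [zt], [H], a small map [g] and
    inverses. *)
Lemma slab N (w u v d : R) : NN N -> 0 < w <= 1 -> 0 <= u -> u < v -> v <= 1 -> 0 < d ->
  exists (G : homeo P) (O : set P) (a b : R),
  [/\ u < a < u + d, v - d < b < v, a < b, fixoff [set z | `|z.1| < w /\ a < z.2 < b] G &
   [/\ open O, O `<=` bx O2 8, (forall y, a <= y <= b -> O (G (0, y))) &
     forall f : homeo P, sup8 f -> fixoff O f -> N f]].
Proof.
move=> NNN /andP[w0 w1] u0 uv v1 d0.
have [M NM HM] := @nn_word _ _ HN _ 5 NNN.
have [e e0 He] := nn_small HN NM.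
have [rh r0 [re rd rw rv]] : exists2 rh, 0 < rh & [/\ 8 * rh <= e, 8 * rh <= d, 8 * rh <= w & 16 * rh <= v - u].
  exists (Num.min (Num.min e d) (Num.min w ((v - u) / 2)) / 8).
    by rewrite divr_gt0 // !lt_min e0 d0 w0 divr_gt0 // subr_gt0.
  set m := Num.min _ _.
  have [m1 m2 m3 m4] : [/\ m <= e, m <= d, m <= w & m <= (v - u) / 2].
    by rewrite /m !ge_min !lexx !orbT.
  by move: m1 m2 m3 m4; clearbody m => m1 m2 m3 m4; split; lra.
pose yb := u + 2 * rh.
have [||||||H [MH Hf Hm]] := @slide _ _ HN M rh yb (yb + rh) (v - 3 * rh) (v - 2 * rh) NM; rewrite /yb; try lra.
rewrite -/yb in Hf Hm.
have Hyb : H (0, yb) = (0, yb) by apply: Hf => /= -[_ /andP[]]; rewrite ltxx.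
have hgt y : yb <= y <= yb + rh -> `|(H (0, y)).1| < rh /\ yb <= (H (0, y)).2.
  move=> /andP[y1 y2]; have [hy|hy] := pselect ([set z : P | `|z.1| < rh /\ yb < z.2 < v - 2 * rh] (0, y)).
    by have [h1 /andP[/ltW h2 _]] := fixoff_stable Hf hy; split.
  by rewrite (Hf _ hy) /= normr0.
pose c0 (t : R) : P := H (0, yb + t * rh).
pose y1 := v - 4 * rh.
have [|||T /andP[T0 T1] [cT cTle]] := @first_hit R (fun t => (c0 t).2) y1.
- by rewrite /c0; cts.
- by rewrite /c0 mul0r addr0 Hyb /= /y1 /yb; lra.
- by rewrite /c0 mul1r Hm /= /y1; lra.
pose x1 := (c0 T).1.
have c0b (t : R) : 0 <= t <= 1 -> `|(c0 t).1| < rh /\ yb <= (c0 t).2.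
  move=> /andP[t0 t1]; apply: hgt; have := ltW r0 => r0'.
  by rewrite lerDl (mulr_ge0 t0 r0') lerD2l ler_piMl.
have x1r : `|x1| < 2 * rh by have [|h _] := c0b T; [rewrite T0 T1|apply: (lt_trans h); lra].
have [||zt [ztf zt1 zt2]] := @hpush _ (x1, y1) 0 (2 * rh) (2 * rh); [by rewrite sub0r normrN|lra|].
rewrite -/(bx (x1, y1) (2 * rh)) in ztf.
have b28 : bx (x1, y1) (2 * rh) `<=` bx O2 8.
  move=> z [] /=; move: x1r; rewrite /bx /= !subr0 !ltr_norml => /andP[h1 h2] /andP[h3 h4].
  by rewrite /y1 => /andP[h5 h6]; split; apply/andP; split; clear -h1 h2 h3 h4 h5 h6 r0 rv u0 v1 rw w1; lra.
have zt8 : sup8 zt by apply: fixoffS ztf.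
have H8 : sup8 H.
  apply: (fixoffS _ Hf) => z /= [h1 /andP[h2 h3]]; rewrite /yb in h2; split; rewrite /= subr0.
    by apply: (lt_trans h1); lra.
  by rewrite ltr_norml; apply/andP; split; lra.
pose O := [set z : P | bx (0, yb) (2 * rh) (hinv H (hinv zt z))].
pose c (t : R) : P := zt (c0 (t * T)).
have cE t : c t = zt (c0 (t * T)) by [].
have Tt (t : R) : 0 <= t <= 1 -> 0 <= t * T <= T /\ t * T <= 1.
  move=> /andP[t0 t1]; have h : t * T <= T by rewrite ler_piMl.
  by rewrite mulr_ge0 // h; split => //; apply: (le_trans h).
have cin (t : R) : 0 <= t <= 1 -> [/\ O (c t), `|(c t).1| <= 3 * rh & yb <= (c t).2 <= y1].
  move=> /Tt[/andP[t0 tT] t1]; split.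
  - rewrite /O /= cE hfunK /c0 hfunK; split; rewrite /= ?subrr ?normr0; first lra.
    have -> : yb + t * T * rh - yb = t * T * rh by ring.
    rewrite (ger0_norm (mulr_ge0 t0 (ltW r0))).
    by apply: (@le_lt_trans _ _ (1 * rh)); [apply: ler_wpM2r => //; exact: ltW|lra].
  - have [h|h] := pselect (bx (x1, y1) (2 * rh) (c0 (t * T))).
      have [h1 _] := fixoff_stable ztf h; have [|h2 _] := c0b T; first by rewrite T0 T1.
      rewrite /= in h1; rewrite cE.
      have := ler_normD (((zt (c0 (t * T))).1) - x1) x1; rewrite subrK => h3.
      by apply: (le_trans h3); rewrite -/x1 in h2; lra.
    rewrite cE (ztf _ h); have [|h2 _] := c0b (t * T); first by rewrite t0.
    by apply: (le_trans (ltW h2)); lra.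
  - rewrite cE zt2; have [|_ ->] := c0b (t * T); first by rewrite t0.
    by apply: cTle; rewrite t0.
have oO : open O := hinv_open zt (hinv_open H (@bx_open R (0, yb) (2 * rh))).
have [||||||||ee /andP[ee0 eer] [G Gf GO]] := @unknot R O c yb y1 (3 * rh) (4 * rh) rh oO.
- by rewrite /c /c0; cts.
- rewrite /c mul0r /c0 mul0r addr0 Hyb; apply: ztf; case=> /= _.
  by rewrite ltr_norml /yb /y1 => /andP[h1 _]; lra.
- have -> : c 1 = zt (x1, y1) by rewrite cE mul1r -cT /x1 -surjective_pairing.
  exact: zt1.
- by rewrite /yb /y1; lra.
- by lra.
- by lra.
- by lra.
- exact: cin.
exists G, O, (yb - ee), (y1 + ee); rewrite /yb /y1; split; try (clear -ee0 eer r0 rd rv; lra).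
- by apply: (fixoffS _ Gf) => z /= [z1 z2]; split=> //; apply: (lt_le_trans z1); lra.
- split => //.
  move=> z Oz; have -> : z = zt (H (hinv H (hinv zt z))) by rewrite !hinvK.
  apply: (fixoff_stable zt8); apply: (fixoff_stable H8).
  move: Oz; rewrite /O /=; move: (hinv H _) => q [].
  rewrite /bx /= !subr0 !ltr_norml /yb => /andP[h1 h2] /andP[h3 h4].
  by split; apply/andP; split; clear -h1 h2 h3 h4 r0 rv u0 uv v1; lra.
move=> f f8 fO.
pose g := hconj (hcomp (hopp H) (hopp zt)) f.
have g8 : sup8 g by apply: sup8_conj => //; apply: sup8_comp; exact: fixoff_opp.
have gf : fixoff (bx (0, yb) (2 * rh)) g.
  by apply: (fixoff_conj fO).
have Mg : M g.
  by apply: He => // z; apply: (bxS _ (fixoff_small _ gf z)); clear -re r0; lra.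
have Mz : M zt.
  by apply: He => // z; apply: (bxS _ (fixoff_small _ ztf z)); clear -re r0; lra.
apply: (@nn_eq _ _ (hprod [:: zt; H; g; hopp H; hopp zt])).
  by move=> z /=; rewrite !hinvK.
apply: HM => // k /= [<-|[<-|[<-|[<-|[<-|//]]]]]; split => //; try by left.
- exact: fixoff_opp.
- by right.
- exact: fixoff_opp.
- by right.
Qed.

End PlaneNbhds.

Lemma uphalf_oddS k : odd k -> uphalf k = k./2.+1. Proof. lia. Qed.
Lemma uphalf_evenS k : ~~ odd k -> uphalf k = k./2. Proof. lia. Qed.
Lemma half_le_double k r : (k <= r.*2)%N -> (k./2 <= r)%N. Proof. lia. Qed.
Lemma half_odd_lt k r : odd k -> (k <= r.*2)%N -> (k./2 < r)%N. Proof. lia. Qed.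

(** * A neighbourhood of the axis segment *)

Section AxisNbhd.
Variables (R : realType) (NN : set (set ((R * R) -> (R * R)))).
Hypothesis HN : group_nbhds NN.
Local Notation P := (R * R)%type.
Local Notation O2 := (O2 R).

Lemma archi_nat (e : R) : 0 < e -> exists2 r : nat, (0 < r)%N & 1 < e * r%:R.
Proof.
move=> e0; have h : 0 <= e^-1 by rewrite invr_ge0 ltW.
exists (Num.bound e^-1).+1 => //.
have : e^-1 < (Num.bound e^-1).+1%:R.
  by apply: (lt_trans (archi_boundP h)); rewrite ltr_nat.
have <- : e * e^-1 = 1 by rewrite mulfV // gt_eqF.
by rewrite ltr_pM2l.
Qed.

(* [psi] is a product of slab maps, small because the slabs are low; it puts long pieces of the axis, and trivially the short gaps between them, into sets all of whose homeomorphisms are admissible. A chain of compressions then moves the whole axis segment into the first of these sets. *)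
Lemma axis_nbhd N : NN N -> exists O : set P, [/\ open O, O `<=` bx O2 8,
  (forall y, 0 <= y <= 1 -> O (0, y)) & forall f : homeo P, sup8 f -> fixoff O f -> N f].
Proof.
move=> NNN.
have [M1 NM1 H1] := @nn_word _ _ HN _ 5 NNN.
have [e e0 He] := nn_small HN NM1.
have [r r0 re] := archi_nat e0.
(* The number [r] of slabs is dictated by the smallness of [psi] alone, so the later compressions,
   at most [2 * r], are counted before [M] is chosen. *)
have [M2 NM2 H2] := @nn_word _ _ HN _ r.*2 NM1.
have [M NM HM] := nn_dir HN NM1 NM2.
have [de d0 Hd] := nn_small HN NM.
have rR : 0 < r%:R :> R by rewrite ltr0n.
pose q (j : nat) : R := j%:R / r%:R.
have q0 : q 0%N = 0 by rewrite /q mul0r.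
have qr : q r = 1 by rewrite /q divff // gt_eqF.
have qle i j : (i <= j)%N -> q i <= q j by move=> ij; rewrite /q ler_pM2r ?invr_gt0 // ler_nat.
have qlt i j : q i < q j -> (i < j)%N by rewrite /q ltr_pM2r ?invr_gt0 // ltr_nat.
have qS j : q j < q j.+1 by rewrite /q ltr_pM2r ?invr_gt0 // ltr_nat.
have qe j : q j.+1 - q j < e.
  by rewrite /q -mulrBl -natr1 addrAC subrr add0r ltr_pdivrMr.
have [w /andP[w0 w1] we] : exists2 w, 0 < w <= 1 & 2 * w <= e.
  exists (Num.min 1 (e / 2)); first by rewrite lt_min ltr01 divr_gt0 // ge_min lexx.
  have : Num.min 1 (e / 2) <= e / 2 by rewrite ge_min lexx orbT.
  by move: (Num.min _ _) => m; lra.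
have [dd dd0 [dde dd1]] : exists2 dd, 0 < dd & 2 * dd <= de /\ dd <= 1.
  exists (Num.min 1 (de / 2)); first by rewrite lt_min ltr01 divr_gt0.
  have : Num.min 1 (de / 2) <= de / 2 by rewrite ge_min lexx orbT.
  have : Num.min 1 (de / 2) <= 1 by rewrite ge_min lexx.
  by move: (Num.min _ _) => m h1 h2; split; lra.
have ex j : (j < r)%N -> exists t : (homeo P * set P * R * R)%type, let: (G, V, a, b) := t in
  [/\ q j < a < q j + dd, q j.+1 - dd < b < q j.+1, a < b, fixoff [set z | `|z.1| < w /\ a < z.2 < b] G &
   [/\ open V, V `<=` bx O2 8, (forall y, a <= y <= b -> V (G (0, y))) &
     forall f : homeo P, sup8 f -> fixoff V f -> M f]].
  move=> jr; have [| | | | |G [O [a [b H]]]] := @slab _ _ HN M w (q j) (q j.+1) dd NM.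
  - by rewrite w0.
  - by rewrite -q0 qle.
  - exact: qS.
  - by rewrite -qr qle.
  - exact: dd0.
  by exists (G, O, a, b).
have [tt Htt] := choice_below ((hid, setT, 0, 0) : (homeo P * set P * R * R)%type) ex.
have [GG [OO [a [b HG]]]] : exists (GG : nat -> homeo P) (OO : nat -> set P) (a b : nat -> R),
  forall j, (j < r)%N -> [/\ q j < a j < q j + dd, q j.+1 - dd < b j < q j.+1, a j < b j,
   fixoff [set z | `|z.1| < w /\ a j < z.2 < b j] (GG j) &
   [/\ open (OO j), OO j `<=` bx O2 8, (forall y, a j <= y <= b j -> OO j (GG j (0, y))) &
     forall f : homeo P, sup8 f -> fixoff (OO j) f -> M f]].
  exists (fun j => (tt j).1.1.1), (fun j => (tt j).1.1.2), (fun j => (tt j).1.2), (fun j => (tt j).2).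
  by move=> j /Htt; case: (tt j) => [[[]]].
clear tt Htt ex.
have ab j : (j < r)%N -> [/\ q j < a j < q j + dd, q j.+1 - dd < b j < q j.+1 & a j < b j] by move=> /HG[].
pose D j := [set z : P | `|z.1| < w /\ a j < z.2 < b j].
have uniq_slab i j y : (i < r)%N -> (j < r)%N -> a i < y < b i -> a j <= y <= b j -> i = j.
  move=> /ab[/andP[i1 _] /andP[_ i2] _] /ab[/andP[j1 _] /andP[_ j2] _] /andP[y1 y2] /andP[y3 y4].
  have /qlt : q i < q j.+1 by lra.
  have /qlt : q j < q i.+1 by lra.
  by rewrite !ltnS => h1 h2; apply/eqP; rewrite eqn_leq h1 h2.
pose psi := iprod GG r.
have [psiD psioff] : (forall i z, (i < r)%N -> D i z -> psi z = GG i z) /\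
  (forall z, (forall i, (i < r)%N -> ~ D i z) -> psi z = z).
  apply: iprod_disj => [i /HG[] //|i j z ir jr [_ zi] [_ /andP[zj1 zj2]]].
  by apply: (uniq_slab i j z.2) => //; rewrite !ltW.
have GG8 j : (j < r)%N -> sup8 (GG j).
  move=> jr; have [/andP[h1 _] /andP[_ h2] _ Gf _] := HG j jr; apply: (fixoffS _ Gf) => z [/= z1 /andP[z2 z3]].
  have h3 : 0 <= q j by rewrite -q0 qle.
  have h4 : q j.+1 <= 1 by rewrite -qr qle.
  split; rewrite /= subr0; first by apply: (lt_le_trans z1); lra.
  by rewrite ltr_norml; apply/andP; split; lra.
have psi8 : sup8 psi by apply: sup8_iprod.
have Mpsi : M1 psi.
  apply: He => // z.
  have [[i ir Di]|nD] := pselect (exists2 i, (i < r)%N & D i z); last first.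
    by rewrite psioff; [exact: bx_self|move=> i ir Di; apply: nD; exists i].
  rewrite (psiD i) //; have [/andP[h1 _] /andP[_ h2] _ Gf _] := HG i ir.
  have := fixoff_stable Gf Di; have := qe i; case: Di => z1 z2 h3 [z3 z4].
  move: z1 z2 z3 z4 h1 h2 h3 we; rewrite /= /bx !ltr_norml; clear.
  move=> /andP[? ?] /andP[? ?] /andP[? ?] /andP[? ?] *.
  by split; rewrite /= ltr_norml; apply/andP; split; lra.
have psi1 j y : (j < r)%N -> a j <= y <= b j -> psi (0, y) = GG j (0, y).
  move=> jr yj; have [Dj|nD] := pselect (D j (0, y)); first exact: psiD.
  have [_ _ _ Gf _] := HG j jr; rewrite (Gf _ nD); apply: psioff => i ir Di; apply: nD.
  by rewrite -(uniq_slab i j y) //; case: Di.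
have psi2 y : (forall i, (i < r)%N -> ~ (a i < y < b i)) -> psi (0, y) = (0, y).
  by move=> H; apply: psioff => i ir [_]; exact: H.
(* The axis is cut at [0, a 0, b 0, a 1, ..., b (r - 1), 1]. Odd [k = 2 * j + 1] stands for the long
   piece in slab [j]; even [k = 2 * j] for the gap around [q j], contained in a box so small that
   [nn_small] applies. *)
pose OO' k := if odd k && (k./2 < r)%N then OO k./2 else bx (0, q k./2) dd.
have OO'o k : open (OO' k).
  rewrite /OO'; case: ifP => [/andP[_ kr]|_]; last exact: bx_open.
  by have [_ _ _ _ []] := HG _ kr.
have OO'8 k : (k <= r.*2)%N -> OO' k `<=` bx O2 8.
  move=> kr; rewrite /OO'; case: ifP => [/andP[_ kr']|_]; first by have [_ _ _ _ []] := HG _ kr'.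
  have k1 : q k./2 <= 1 by rewrite -qr qle // half_le_double.
  have k2 : 0 <= q k./2 by rewrite -q0 qle.
  move=> z [/=]; rewrite /bx /= !subr0 !ltr_norml => /andP[h1 h2] /andP[h3 h4].
  by split; apply/andP; split; clear -h1 h2 h3 h4 k1 k2 dd1; lra.
have OO'M k (f : homeo P) : sup8 f -> fixoff (OO' k) f -> M f.
  rewrite /OO' => f8; case: ifP => [/andP[_ kr'] fO|_ fO].
    by have [_ _ _ _ [_ _ _]] := HG _ kr'; apply.
  by apply: Hd => // z; apply: (bxS dde); exact: (fixoff_small dd0 fO).
pose W k := [set z : P | OO' k (psi z)].
have oW k : open (W k) by apply: hfun_open.
pose a' j := if (j < r)%N then a j else 1.
pose b' j := if j is i.+1 then b i else 0.
pose yy k := if odd k then a' k./2 else b' k./2.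
have yy0 : yy 0%N = 0 by [].
have yyr : yy r.*2.+1 = 1 by rewrite /yy /= odd_double /= uphalf_double /a' ltnn.
have b'q j : (j <= r)%N -> q j - dd < b' j <= q j.
  case: j => [_|j jr] /=; first by rewrite q0; lra.
  by have [_ /andP[h1 h2] _] := ab j jr; rewrite h1 ltW.
have a'q j : (j <= r)%N -> q j <= a' j < q j + dd.
  rewrite leq_eqVlt => /orP[/eqP->|jr]; first by rewrite /a' ltnn qr; lra.
  by rewrite /a' jr; have [/andP[h1 h2] _ _] := ab j jr; rewrite h2 ltW.
have b'a' j : (j <= r)%N -> b' j < a' j.
  move=> jr; have [] := (b'q j jr, a'q j jr).
  move: jr; rewrite leq_eqVlt => /orP[/eqP E|jr].
    have -> : a' j = 1 by rewrite /a' E ltnn.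
    case: j E => [E|i E] /=; first by move: r0; rewrite -E.
    have ir : (i < r)%N by rewrite -E.
    by have [_ /andP[h1 h2] _] := ab i ir; move: h2; rewrite E qr => h2 _ _.
  have [/andP[h1 h2] _ _] := ab j jr; have -> : a' j = a j by rewrite /a' jr.
  by move=> /andP[_ h3] _; lra.
have gap j y : (j <= r)%N -> b' j <= y <= a' j -> forall i, (i < r)%N -> ~ (a i < y < b i).
  move=> jr /andP[y1 y2] i ir /andP[y3 y4].
  have [/andP[i1 i2] /andP[i3 i4] i5] := ab i ir.
  have [ij|ji] := ltnP i j.
    case: j ij jr y1 y2 => // j ij jr /= y1 _.
    rewrite ltnS leq_eqVlt in ij; case/orP: ij => [/eqP E|ij]; first by move: y1; rewrite -E; lra.
    have [/andP[j1 j2] _ j5] := ab j jr; have := qle i.+1 j ij; lra.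
  have jr' := leq_ltn_trans ji ir; rewrite /a' jr' in y2.
  rewrite leq_eqVlt in ji; case/orP: ji => [/eqP E|ji]; first by move: y2; rewrite E; lra.
  by have [_ /andP[_ j2] j5] := ab j jr'; have := qle j.+1 i ji; lra.
have [||s [ss sW sy]] := @chain_compress R W r.*2 oW yy.
- move=> k kr; rewrite /yy /=; have [ko|ke] := boolP (odd k) => /=.
    have -> : uphalf k = k./2.+1 by apply: uphalf_oddS.
    have kr' : (k./2 < r)%N by apply: half_odd_lt.
    by rewrite /a' kr' /=; have [] := ab _ kr'.
  have -> : uphalf k = k./2 by apply: uphalf_evenS.
  by apply: b'a'; exact: half_le_double.
- move=> k y kr; rewrite /yy /W /OO' /=; have [ko|ke] := boolP (odd k) => /=.
    have -> : uphalf k = k./2.+1 by apply: uphalf_oddS.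
    have kr' : (k./2 < r)%N by apply: half_odd_lt.
    rewrite /a' kr' /= => hy; rewrite (psi1 _ _ kr' hy).
    by have [_ _ _ _ [_ _ H _]] := HG _ kr'; exact: H.
  have -> : uphalf k = k./2 by apply: uphalf_evenS.
  have kr' : (k./2 <= r)%N by apply: half_le_double.
  move=> hy; rewrite (psi2 _ (gap _ _ kr' hy)).
  have := b'q _ kr'; have := a'q _ kr'; case/andP: hy => [y1 y2] /andP[h1 h2] /andP[h3 h4].
  by split; rewrite /= ?subrr ?normr0 // ltr_norml; apply/andP; split; clear -h1 h2 h3 h4 y1 y2; lra.
rewrite yy0 yyr in sy.
pose th' := hconj psi (hprod s).
have th'E := hprod_conj psi s.
have sP f : List.In f s -> sup8 (hconj psi f) /\ M2 (hconj psi f).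
  move=> /sW[k kr fW].
  have fO : fixoff (OO' k) (hconj psi f) by apply: (fixoff_conj fW).
  have f8 : sup8 (hconj psi f) by apply: (fixoffS _ fO); exact: OO'8.
  by split => //; have [] := HM _ (OO'M k _ f8 fO).
have th'8 : sup8 th'.
  have h : sup8 (hprod (map (hconj psi) s)).
    by apply: fixoff_prod => f /List.in_map_iff[g [<- /sP[]]].
  by move=> z /h; exact: etrans (th'E z).
have Mth : M1 th'.
  apply: (nn_eq (fsym th'E)); apply: H2; first by rewrite size_map.
  by move=> f /List.in_map_iff[g [<- /sP[? ?]]]; split => //; left.
pose c := hcomp th' psi.
have c8 : sup8 c by exact: sup8_comp.
have cE z : c z = psi (hprod s z) by rewrite /= hfunK.
(* [c] moves the whole segment into the box [OO' 0] around the origin, where every supported map is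
   small. *)
exists [set z | OO' 0%N (c z)]; split.
- exact: hfun_open.
- by move=> z Oz; apply: (fixoff_in c8); apply: OO'8 Oz.
- by move=> y /sy; rewrite /W /= hfunK.
move=> f f8 fO.
pose f0 := hconj c f.
have f08 : sup8 f0 by exact: sup8_conj.
have Mf0 : M1 f0.
  by have [] := HM _ (OO'M 0%N f0 f08 (fixoff_conj fO (fun u Ou => Ou))).
apply: (@nn_eq _ _ (hprod [:: hopp psi; hopp th'; f0; th'; psi])).
  by move=> z /=; rewrite !hfunK.
apply: H1 => // k /= [<-|[<-|[<-|[<-|[<-|//]]]]].
- by split; [exact: fixoff_opp|right].
- by split; [exact: fixoff_opp|right].
- by split; [|left].
- by split; [|left].
- by split; [|left].
Qed.

End AxisNbhd.

(** * Narrow columns and the vertical shear *)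

Section Squeeze.
Variable R : realType.
Local Notation P := (R * R)%type.

(** A contraction of rows by the factor [kap], exact where [zig g] is linear; this is the origin of
    the half-width [3 * g / 4] of the columns. The vertical cut-off is 1 on [[0, 1]] and 0 off
    [(-1, 2)]. *)
Lemma squeeze (c g e : R) : 0 < g -> 0 < e -> exists f : homeo P,
  [/\ fixoff [set z : P | `|z.1 - c| < g /\ -1 < z.2 < 2] f, forall z, (f z).2 = z.2 &
   forall z : P, `|z.1 - c| < 3 * g / 4 -> 0 <= z.2 <= 1 -> `|(f z).1 - c| < e].
Proof.
move=> g0 e0.
have [kap /andP[k0 k1] kg] : exists2 k, 0 < k < 1 & k * g <= e.
  exists (Num.min (1 / 2) (e / g)).
    by rewrite lt_min divr_gt0 // divr_gt0 //= gt_min; apply/orP; left; lra.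
  have : Num.min (1 / 2) (e / g) <= e / g by rewrite ge_min lexx orbT.
  by rewrite ler_pdivlMr.
have cs : continuous (fun y : R => (1 - kap) * trap (3 / 2) (y - 1 / 2)) by exact: ctrap_cts.
have [y|f fE] := hcontract c cs _ g0.
  have /andP[t0 t1] := trap01 (3 / 2) (y - 1 / 2); have l2 : 0 <= 1 - kap by lra.
  by rewrite mulr_ge0 //=; apply: (@le_lt_trans _ _ (1 - kap)); [rewrite ler_piMr|lra].
exists f; split.
- move=> z nz; rewrite fE.
  have [h|h] := ltP `|z.1 - c| g; last by rewrite zig_off // mulr0 subr0; case: (z).
  rewrite trap0 ?mulr0 ?mul0r ?subr0; first by case: (z).
  rewrite leNgt; apply/negP; rewrite ltr_norml => /andP[h1 h2].
  by apply: nz; split => //=; lra.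
- by move=> z; rewrite fE.
move=> z z1 /andP[y0 y1]; rewrite fE /= trap1; last by rewrite ler_norml; lra.
rewrite mulr1 zig_id //; last exact: ltW.
have -> : z.1 - (1 - kap) * (z.1 - c) - c = kap * (z.1 - c) by ring.
rewrite normrM (gtr0_norm k0); apply: lt_le_trans kg.
by rewrite ltr_pM2l //; apply: (lt_le_trans z1); lra.
Qed.

End Squeeze.

Section PlaneTheorem.
Variables (R : realType) (NN : set (set ((R * R) -> (R * R)))).
Hypothesis HN : group_nbhds NN.
Local Notation P := (R * R)%type.
Local Notation O2 := (O2 R).

Definition column (c w : R) := [set z : P | `|z.1 - c| < w /\ 0 < z.2 < 1].

Lemma strip_bx8 (c r : R) (z : P) : `|c| <= 1 -> r <= 1 -> `|z.1 - c| < r -> -1 < z.2 < 2 -> bx O2 8 z.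
Proof.
rewrite ler_norml ltr_norml; clear => /andP[? ?] ? /andP[? ?] ?.
by split; rewrite /= subr0 ltr_norml; apply/andP; split; lra.
Qed.

(** The bound [e] must not depend on [n]. The product [psi] of the squeezing maps moves points along
    rows inside disjoint strips of width [2 * g < e], so it is small for every [n]. The squeezed
    maps are [n] factors, but [M'] is chosen once [n] is known, and the squeezing is then made
    strong enough for [M']. *)
Lemma columns N : NN N -> exists2 e, 0 < e & forall (g : R) (n : nat) (c : nat -> R) (E : nat -> homeo P),
  0 < g -> 2 * g < e -> (forall i, (i < n)%N -> `|c i| <= 1) ->
  (forall i j, (i < n)%N -> (j < n)%N -> i <> j -> 2 * g <= `|c i - c j|) ->
  (forall i, (i < n)%N -> fixoff (column (c i) (3 * g / 4)) (E i)) -> N (iprod E n).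
Proof.
move=> NNN.
have [M NM HM] := @nn_word _ _ HN _ 3 NNN.
have [e e0 He] := nn_small HN NM.
exists (Num.min 1 e); first by rewrite lt_min ltr01.
move=> g n c E g0; rewrite lt_min => /andP[g1 ge] c1 cc EC.
have [M' NM' HM'] := @nn_iprod _ _ HN _ n NM.
have ex i : (i < n)%N -> exists f : homeo P,
  [/\ fixoff [set z : P | `|z.1 - c i| < g /\ -1 < z.2 < 2] f, forall z, (f z).2 = z.2 &
     sup8 (hconj f (E i)) /\ M' (hconj f (E i))].
  (* [T] brings the axis to the line [x = c i]; passing from [M'] to [M''] absorbs the conjugation
     by it. *)
  move=> ilt; have [|T T8 TE] := @box_shift R (c i); first by have := c1 i ilt; rewrite ler_norml.
  have [M'' NM'' HM''] := nn_conj HN NM' T8.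
  have [O [oO _ O01 OM]] := axis_nbhd HN NM''.
  have oO3 : open (O `&` bx O2 3) by apply: openI => //; exact: bx_open.
  have [|d d0 Hd] := @axis_thick R _ 0 0 1 oO3 ler01.
    move=> y /andP[y0 y1]; split; first by apply: O01; rewrite y0.
    by split; rewrite /= subr0 ger0_norm //; lra.
  have [f [ff f2 f1]] := @squeeze R (c i) g d g0 d0.
  exists f; split => //.
  have Ef : fixoff [set z : P | (O `&` bx O2 3) (hinv T z)] (hconj f (E i)).
    apply: (fixoff_conj (EC i ilt)) => u [u1 u2] /=.
    have h1 := f1 u u1; have h2 : 0 <= u.2 <= 1 by lra.
    have Od : (O `&` bx O2 3) ((f u).1 - c i, u.2).
      by apply: (Hd u.2 h2); split => /=; rewrite ?subr0 ?subrr ?normr0 //; exact: h1.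
    have -> : f u = T ((f u).1 - c i, u.2).
      by rewrite TE /=; [rewrite subrK -f2 -surjective_pairing|case: Od].
    by rewrite hfunK.
  have f8 : sup8 f.
    apply: (fixoffS _ ff) => z [z1 z2]; apply: (strip_bx8 (c1 i ilt) _ z1); lra.
  have E8 : sup8 (E i).
    apply: (fixoffS _ (EC i ilt)) => z [z1 z2]; apply: (strip_bx8 (c1 i ilt) _ z1); lra.
  have h8 : sup8 (hconj f (E i)) by exact: sup8_conj.
  split => //.
  pose k := hconj (hopp T) (hconj f (E i)).
  have k8 : sup8 k by apply: sup8_conj => //; exact: fixoff_opp.
  have kO : fixoff O k by apply: (fixoff_conj Ef) => u [].
  have := HM'' k k8 (OM k k8 kO); apply: nn_eq => z /=.
  by rewrite !hinvK.
have [F HF] := choice_below (hid : homeo P) ex.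
pose D i := [set z : P | `|z.1 - c i| < g].
have D_inj i j z : (i < n)%N -> (j < n)%N -> D i z -> D j z -> i = j.
  move=> ilt jlt; rewrite /D /= => zi zj; apply: contrapT => /(cc _ _ ilt jlt); apply/negP; rewrite -ltNge.
  have -> : c i - c j = - (z.1 - c i) + (z.1 - c j) by ring.
  by apply: (le_lt_trans (ler_normD _ _)); rewrite normrN; lra.
have FD i : (i < n)%N -> fixoff (D i) (F i).
  by move=> /HF[Ff _ _]; apply: (fixoffS _ Ff) => z [].
pose psi := iprod F n.
have [psiD psi0] := iprod_disj FD D_inj.
have psi8 : sup8 psi.
  apply: sup8_iprod => i ilt; have [ff _ _] := HF i ilt.
  apply: (fixoffS _ ff) => z [z1 z2]; apply: (strip_bx8 (c1 i ilt) _ z1); lra.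
have Mpsi : M psi.
  apply: He => // z.
  have [[i ilt Di]|nD] := pselect (exists2 i, (i < n)%N & D i z); last first.
    by rewrite /psi psi0; [exact: bx_self|move=> i ilt Di; apply: nD; exists i].
  rewrite /psi (psiD i) //; have [_ F2 _] := HF i ilt.
  have := fixoff_stable (FD i ilt) Di; move: Di; rewrite /D /= => h1 h2.
  split; rewrite /= ?F2 ?subrr ?normr0 //.
  have -> : (F i z).1 - z.1 = ((F i z).1 - c i) - (z.1 - c i) by ring.
  by apply: (le_lt_trans (ler_normB _ _)); lra.
pose Fe := hconj psi (iprod E n).
(* On the strip [D i] the map [psi] acts as [F i], and off that strip both conjugates of [E i] are
   the identity. *)
have FeE : Fe =1 iprod (fun i => hconj (F i) (E i)) n.
  apply: (ftrans (iprod_conj psi E n)); apply: iprod_eq => i ilt z /=.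
  have sub u : column (c i) (3 * g / 4) u -> D i u.
    by move=> [h _]; rewrite /D /=; apply: (lt_trans h); lra.
  have [Dz|Dz] := pselect (D i z).
    have Fz : D i (hinv (F i) z) by exact: (fixoff_stable (fixoff_opp (FD i ilt))).
    have E1 : hinv psi z = hinv (F i) z.
      by rewrite -[in LHS](hinvK (F i) z) -(psiD i _ ilt Fz) hfunK.
    rewrite E1; apply: psiD => //; exact: (fixoff_stable (fixoffS sub (EC i ilt)) Fz).
  have E1 : hinv (F i) z = z by apply: (fixoff_opp (FD i ilt)).
  rewrite E1 (fixoffS sub (EC i ilt) Dz) (FD i ilt _ Dz).
  suff nD : ~ D i (hinv psi z).
    by rewrite (fixoffS sub (EC i ilt) nD) hinvK.
  move=> Dp; apply: Dz; have := fixoff_stable (FD i ilt) Dp.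
  by rewrite -(psiD i _ ilt Dp) hinvK.
have Fe8 : sup8 Fe.
  have h : sup8 (iprod (fun i => hconj (F i) (E i)) n).
    by apply: sup8_iprod => i /HF[_ _ []].
  by move=> z /h; exact: etrans (FeE z).
have MFe : M Fe.
  by apply: (nn_eq (fsym FeE)); apply: HM' => // i /HF[_ _ []].
apply: (@nn_eq _ _ (hprod [:: hopp psi; Fe; psi])).
  by move=> z /=; rewrite !hfunK.
apply: HM => // k /= [<-|[<-|[<-|//]]].
- by split; [exact: fixoff_opp|right].
- by split; [|left].
- by split; [|left].
Qed.

Definition comb (b g : R) (i : nat) : R := b + 2 * i%:R * g.

Lemma comb_spaced b g i j : 0 < g -> i <> j -> 2 * g <= `|comb b g i - comb b g j|.
Proof.
move=> g0; wlog ij : i j / (i < j)%N => [H|_].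
  by move=> ne; case: (ltngtP i j) => // h; [|rewrite distrC]; apply: H => //; lia.
have h : (i%:R + 1) * g <= j%:R * g by rewrite ler_pM2r // natr1 ler_nat.
by rewrite distrC; apply: le_trans (ler_norm _); rewrite /comb; lra.
Qed.

(** Two combs of spacing [2 * g], offset by [g]: a point of [(-1, 1)] far from the odd teeth is near
    an even one. Since [n * g = 1], the even comb runs from -1 to 1 inclusive and has one tooth
    more. *)
Lemma comb_cover (g x : R) n : 0 < g -> n%:R * g = 1 ->
  (forall i, (i < n)%N -> g / 2 < `|x - comb (g - 1) g i|) ->
  1 <= `|x| \/ exists2 k, (k < n.+1)%N & `|x - comb (- 1) g k| <= g / 2.
Proof.
move=> g0 ng H; have [h|x1] := leP 1 `|x|; [by left|right].
move: x1; rewrite ltr_norml => /andP[x1 x2].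
have exk : exists k, x <= comb (- 1) g k + g / 2.
  by exists n; rewrite /comb -mulrA ng; lra.
case: (ex_minnP exk) => k kx kmin.
have kn : (k <= n)%N by apply: kmin; rewrite /comb -mulrA ng; lra.
exists k => //; case: k kx kmin kn => [|j] kx kmin kn.
  by move: kx; rewrite /comb mulr0 mul0r addr0 ler_norml => h; lra.
have jx : comb (- 1) g j + g / 2 < x by rewrite ltNge; apply/negP => /kmin; rewrite ltnn.
have := H j kn; move: kx jx; rewrite /comb -[j.+1%:R]natr1 => kx jx.
have [h|h] := leP x (g - 1 + 2 * j%:R * g).
  by rewrite ler0_norm; [|lra]; move=> h2; rewrite ler_norml; lra.
by rewrite gtr0_norm; [|lra]; move=> h2; rewrite ler_norml; lra.
Qed.

Lemma open_fst_far (c r : R) : open [set z : P | r < `|z.1 - c|].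
Proof.
by apply: (@open_comp _ _ (fun z : P => `|z.1 - c|) [set t | r < t]);
  [move=> z _; apply: ctsfW z; cts|exact: open_gt].
Qed.

Lemma open_fst_near (c r : R) : open [set z : P | `|z.1 - c| < r].
Proof.
by apply: (@open_comp _ _ (fun z : P => `|z.1 - c|) [set t | t < r]);
  [move=> z _; apply: ctsfW z; cts|exact: open_lt].
Qed.

Lemma comb_disj b g r i j x : 0 < g -> r <= g -> `|x - comb b g i| < r -> `|x - comb b g j| < r -> i = j.
Proof.
move=> g0 rg xi xj; apply: contrapT => /(comb_spaced b g0); apply/negP; rewrite -ltNge.
have -> : comb b g i - comb b g j = - (x - comb b g i) + (x - comb b g j) by ring.
by apply: (le_lt_trans (ler_normD _ _)); rewrite normrN; lra.
Qed.

(* [S = F_odd o F_even]: both factors are products of column-supported maps, [F_even] agreeing with [S] on wide strips around the even columns. *)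
Lemma shear_in_all : exists S : homeo P, [/\ sup8 S, exists z, S z <> z & forall N, NN N -> N S].
Proof.
(* The amplitude stays at most 1/2 and [mu] is 1-Lipschitz, so [S] and its truncations are injective
   on vertical lines. *)
pose la (x : R) := tent 1 x / 2.
pose mu (y : R) := tent (1 / 2) (y - 1 / 2).
have l0 x : 0 <= la x <= 1 / 2.
  by have := tent_ge0 1 x; have := tent_le x ler01; rewrite /la => h1 h2; lra.
have cmu : continuous mu by exact: tent_cts.
have muL x x' : `|mu x - mu x'| <= `|x - x'|.
  by have := tent_lip (1 / 2) (x - 1 / 2) (x' - 1 / 2); rewrite opprB addrA subrK.
have h0 : 0 <= 1 / 2 :> R by lra.
have muB x : `|mu x| <= 1 / 2 by rewrite (ger0_norm (tent_ge0 _ _)) tent_le.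
have mu_off y : ~ (0 < y < 1) -> mu y = 0.
  move=> h; apply: tent_off; rewrite leNgt; apply/negP; rewrite ltr_norml => /andP[h1 h2].
  by apply: h; lra.
have [S SE] : exists S : homeo P, forall z, S z = (z.1, z.2 + la z.1 * mu z.2).
  apply: (vlip_ex _ cmu _ muL muB).
    by apply: (ctsfW (f := fun x : R => Num.max 0 (1 - `|x|) / 2)); cts.
  by move=> x; have := l0 x; rewrite ltr_norml; lra.
have la_off x : 1 <= `|x| -> la x = 0 by move=> h; rewrite /la tent_off // mul0r.
have Sid z : la z.1 = 0 \/ ~ (0 < z.2 < 1) -> S z = z.
  by rewrite SE => -[->|/mu_off ->]; rewrite ?mul0r ?mulr0 addr0; case: (z).
exists S; split.
- move=> z nz; apply: Sid; have [h|/la_off] := ltP `|z.1| 1; [right|by left].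
  move=> h2; apply: nz; split; rewrite /= subr0; first lra.
  by rewrite ltr_norml; lra.
- exists (0, 1 / 2); rewrite SE /= /la /mu subrr !tent0 ?ler01 //.
  by case=> h; lra.
move=> N NNN; have [M NM HM] := nn_mul HN NNN.
have [e e0 He] := columns NM.
have [n n0 ne] := @archi_nat R (e / 2) (divr_gt0 e0 (ltr0Sn R 1)).
have nR : 0 < n%:R :> R by rewrite ltr0n.
pose g : R := n%:R^-1.
have g0 : 0 < g by rewrite invr_gt0.
have ng : n%:R * g = 1 by rewrite mulfV // gt_eqF.
have g2 : 2 * g < e.
  have h : 1 * g < e / 2 * n%:R * g by rewrite ltr_pM2r.
  by move: h; rewrite -mulrA ng; lra.
have ig i : (i <= n)%N -> 0 <= i%:R * g <= 1.
  by move=> iN; rewrite (mulr_ge0 (ler0n R i) (ltW g0)) /= -[X in _ <= X]ng ler_pM2r // ler_nat.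
pose c := comb (- 1) g; pose o := comb (g - 1) g.
(* At distance at most [g / 2] from [c i] the second term is at least 1/2, the maximum of [la]; from
   [3 * g / 4] on it vanishes. *)
pose lc i (x : R) := Num.min (la x) (tent (3 * g / 4) (x - c i) * (2 / g)).
have lc0 i x : 0 <= lc i x <= la x.
  have := l0 x; have t0 := tent_ge0 (3 * g / 4) (x - c i).
  have h2 : 0 <= 2 / g by rewrite divr_ge0 // ltW.
  by have := mulr_ge0 t0 h2; rewrite /lc; maxmin_in; lra.
have lc_off i x : 3 * g / 4 <= `|x - c i| -> lc i x = 0.
  by move=> h; have := lc0 i x; have := l0 x; rewrite /lc tent_off // mul0r; maxmin_in; lra.
have lc_in i x : `|x - c i| <= g / 2 -> lc i x = la x.
  move=> h; have : 1 / 2 <= tent (3 * g / 4) (x - c i) * (2 / g).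
    have t0 : g / 4 <= tent (3 * g / 4) (x - c i) by rewrite /tent le_max; apply/orP; right; lra.
    have -> : 1 / 2 = g / 4 * (2 / g) :> R by field; rewrite gt_eqF.
    by rewrite ler_pM2r // divr_gt0.
  by have := l0 x; rewrite /lc; maxmin_in; lra.
have exE i : exists E : homeo P, forall z, E z = (z.1, z.2 + lc i z.1 * mu z.2).
  apply: (vlip_ex _ cmu _ muL muB).
    by apply: (ctsfW (f := fun x : R => Num.min (Num.max 0 (1 - `|x|) / 2) (Num.max 0 (3 * g / 4 - `|x - c i|) * (2 / g)))); cts.
  by move=> x; have := lc0 i x; have := l0 x; rewrite ltr_norml; lra.
have [E EE] := choice exE.
have Ec i : fixoff (column (c i) (3 * g / 4)) (E i).
  move=> z nz; rewrite EE; have [h|h] := ltP `|z.1 - c i| (3 * g / 4).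
    by rewrite mu_off ?mulr0 ?addr0 => [|h2]; [case: (z)|apply: nz].
  by rewrite lc_off // mul0r addr0; case: (z).
pose Fe := iprod E n.+1.
have c1 i : (i <= n)%N -> `|c i| <= 1.
  by move=> /ig /andP[h1 h2]; rewrite /c /comb -mulrA ler_norml; lra.
have MFe : M Fe.
  by apply: (He g n.+1 c) => // i j _ _; exact: comb_spaced.
have [FeD Fe0] : (forall i z, (i < n.+1)%N -> column (c i) (3 * g / 4) z -> Fe z = E i z) /\
    (forall z, (forall i, (i < n.+1)%N -> ~ column (c i) (3 * g / 4) z) -> Fe z = z).
  apply: iprod_disj => [i _|i j z _ _ [h1 _] [h2 _]]; first exact: Ec.
  by apply: (@comb_disj (- 1) g (3 * g / 4) i j z.1) => //; lra.
have Fex z : (Fe z).1 = z.1.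
  have : forall k, (iprod E k z).1 = z.1 by elim=> //= k IH; rewrite EE IH.
  exact.
have FeS z : (forall i, (i < n)%N -> g / 2 < `|z.1 - o i|) -> Fe z = S z.
  move=> /(comb_cover g0 ng)[x1|[k kn xk]].
    rewrite [RHS]Sid; last by left; exact: la_off.
    have [[i ilt Di]|nD] := pselect (exists2 i, (i < n.+1)%N & column (c i) (3 * g / 4) z); last first.
      by apply: Fe0 => i ilt Di; apply: nD; exists i.
    rewrite (FeD i) // EE; have : lc i z.1 = 0 by have := lc0 i z.1; rewrite la_off //; lra.
    by move=> ->; rewrite mul0r addr0; case: (z).
  have [y01|y01] := pselect (0 < z.2 < 1); last first.
    by rewrite Sid; [apply: Fe0 => i _ [_]|right].
  rewrite (FeD k) // ?EE ?lc_in ?SE //; split=> //; apply: (le_lt_trans xk); lra.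
pose F' := hcomp S (hopp Fe).
have invx z : (hinv Fe z).1 = z.1 by rewrite -Fex hinvK.
have F'x z : (F' z).1 = z.1 by rewrite /= SE /= invx.
have F'ix z : (hinv F' z).1 = z.1 by rewrite -F'x hinvK.
have F'id z : (forall i, (i < n)%N -> g / 2 < `|z.1 - o i|) -> F' z = z.
  by move=> H; rewrite /= -FeS ?hinvK // invx.
have F'y z : ~ (0 < z.2 < 1) -> F' z = z.
  move=> y01; have Fz : Fe z = z by apply: Fe0 => i _ [_].
  have E1 : hinv Fe z = z by rewrite -[in LHS]Fz hfunK.
  by rewrite /F' /= -/Fe; move: E1 => /= ->; apply: Sid; right.
have exO i : (i < n)%N -> exists G : homeo P, fixoff (column (o i) (3 * g / 4)) G /\
    forall z, `|z.1 - o i| < 3 * g / 4 -> G z = F' z.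
  move=> ilt.
  (* [F'] is the identity outside the strips of half-width [g / 2] around the odd columns, so it can
     be cut at half-width [3 * g / 4]. *)
  have [||||||G GD GE] := @restr_ex P F' [set z : P | `|z.1 - o i| < 3 * g / 4] [set z : P | ~ (g / 2 < `|z.1 - o i|)].
  - exact: open_fst_near.
  - by apply: open_closedC; exact: open_fst_far.
  - by move=> z /= /negP; rewrite -leNgt => h; apply: (le_lt_trans h); lra.
  - move=> z /= h1 h2; apply: F'id => j jlt.
    have [<-|nij] := pselect (i = j); first exact: contrapT h2.
    have := comb_spaced (g - 1) g0 nij.
    have -> : comb (g - 1) g i - comb (g - 1) g j = - (z.1 - o i) + (z.1 - o j) by rewrite /o; ring.
    by move=> h; have := le_trans h (ler_normD _ _); rewrite normrN; lra.
  - by move=> z; rewrite /= F'x.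
  - by move=> z; rewrite /= F'ix.
  exists G; split=> // z nz; have [h|h] := pselect (`|z.1 - o i| < 3 * g / 4); last exact: GD.
  by rewrite GE //; apply: F'y => h2; apply: nz.
have [G HG] := choice_below (hid : homeo P) exO.
have MF' : M F'.
  have [GD G0] : (forall i z, (i < n)%N -> `|z.1 - o i| < 3 * g / 4 -> iprod G n z = G i z) /\
    (forall z, (forall i, (i < n)%N -> ~ `|z.1 - o i| < 3 * g / 4) -> iprod G n z = z).
    apply: (@iprod_disj P G (fun i => [set z : P | `|z.1 - o i| < 3 * g / 4])).
      by move=> i ilt; apply: (fixoffS _ (HG i ilt).1) => z [].
    by move=> i j z _ _ h1 h2; apply: (@comb_disj (g - 1) g (3 * g / 4) i j z.1) => //; lra.
  apply: (@nn_eq _ _ (iprod G n)).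
    move=> z; have [[i ilt Di]|nD] := pselect (exists2 i, (i < n)%N & `|z.1 - o i| < 3 * g / 4).
      by rewrite (GD i) // (HG i ilt).2.
    have nD' i : (i < n)%N -> ~ `|z.1 - o i| < 3 * g / 4 by move=> ilt Di; apply: nD; exists i.
    rewrite G0 // F'id // => i /nD' /negP; rewrite -leNgt => h; apply: lt_le_trans h; lra.
  apply: (He g n o) => // [i ilt|i j _ _|i ilt]; [|exact: comb_spaced|by have [] := HG i ilt].
  have /andP[h1 _] := ig i (ltnW ilt); have /andP[_ h2] := ig i.+1 ilt.
  by move: h1 h2; rewrite /o /comb -[i.+1%:R]natr1 ler_norml; lra.
have c8 i : (i <= n)%N -> column (c i) (3 * g / 4) `<=` bx O2 8.
  move=> iN z [z1 z2]; have /andP[_ g1] := ig 1%N n0; rewrite mul1r in g1.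
  by apply: (strip_bx8 (c1 i iN) _ z1); lra.
have Fe8 : sup8 Fe.
  by apply: sup8_iprod => i ilt; apply: (fixoffS _ (Ec i)); exact: c8.
have S8 : sup8 S.
  move=> z nz; apply: Sid; have [h|/la_off] := ltP `|z.1| 1; [right|by left].
  move=> h2; apply: nz; split; rewrite /= subr0; first lra.
  by rewrite ltr_norml; lra.
have F'8 : sup8 F' by apply: sup8_comp => //; exact: fixoff_opp.
apply: (@nn_eq _ _ (hcomp F' Fe)); first by move=> z; exact: (congr1 S (hfunK Fe z)).
exact: HM.
Qed.

End PlaneTheorem.

(** * Charts and transport *)

(** Replaces finite subcovers: the index runs over maps near a given one, growing compact sets, or
    shrinking radii. *)
Lemma cover_uniform (X : topologicalType) (K : set X) (I : Type) (F : set_system I)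
    (Q : I -> X -> Prop) : compact K -> Filter F ->
  (forall x, K x -> exists (A : set X) (B : set I), [/\ nbhs x A, F B &
     forall i y, B i -> A y -> Q i y]) ->
  F [set i | forall y, K y -> Q i y].
Proof.
rewrite compact_near_coveringP => cK FF H.
apply: (cK I F Q FF) => x /H[A [B [nA FB HAB]]].
by exists (A, B) => //= -[y i] [/= Ay Bi]; exact: HAB.
Qed.

Lemma filter_seq (I : Type) (T : eqType) (F : set_system I) (s : seq T) (Q : T -> set I) :
  Filter F -> (forall p, p \in s -> F (Q p)) -> F [set i | forall p, p \in s -> Q p i].
Proof.
move=> FF; elim: s => [|p s IH] H; first by apply: (@filterS _ _ FF setT) => //; exact: filterT.
have h1 := IH (fun q qs => H q (mem_behead (s := p :: s) qs)).
apply: (@filterS _ _ FF _ _ _ (filterI (H p (mem_head _ _)) h1)) => i [Qp Qs] q.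
by rewrite inE => /orP[/eqP ->|/Qs].
Qed.

Section Charts.
Variables (R : realType) (X : topologicalType).
Local Notation P := (R * R)%type.
Local Notation O2 := (O2 R).

Definition cbx (r : R) : set P := [set z | `|z.1| <= r /\ `|z.2| <= r].

Lemma cbx_compact r : compact (cbx r).
Proof.
have -> : cbx r = `[- r, r]%classic `*` `[- r, r]%classic.
  by apply/seteqP; split => z; rewrite /cbx /= !in_itv /= !ler_norml.
by apply: compact_setX; exact: segment_compact.
Qed.

Lemma bx_cbx r s : r <= s -> bx O2 r `<=` cbx s.
Proof.
move=> rs z [/=]; rewrite !subr0 => z1 z2.
by split; apply: ltW; apply: lt_le_trans rs.
Qed.

Lemma cbx_bx r s : r < s -> cbx r `<=` bx O2 s.
Proof. by move=> rs z [z1 z2]; split; rewrite /= subr0; apply: le_lt_trans rs. Qed.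

(** Radius 16 against supports of radius 8 leaves room to paste with the identity off a compact
    core. Both maps are total, with arbitrary values off the box and [cE]. The chart lies in [U], so
    leaving [U] means leaving the chart. *)
Record chart (x0 : X) (U : set X) := Chart {
  ce : P -> X;
  ci : X -> P;
  cE : set X;
  cE_open : open cE;
  cE_sub : cE `<=` U;
  ce_in : forall z, bx O2 16 z -> cE (ce z);
  ceK : forall z, bx O2 16 z -> ci (ce z) = z;
  ci_in : forall x, cE x -> bx O2 16 (ci x);
  ciK : forall x, cE x -> ce (ci x) = x;
  ce_cts : forall z, bx O2 16 z -> continuous_at z ce;
  ci_cts : forall x, cE x -> continuous_at x ci;
  ce0 : ce O2 = x0 }.

Hypothesis hX : hausdorff_space X.
Variables (x0 : X) (U : set X) (c : chart x0 U).
Local Notation e := (ce c).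
Local Notation i := (ci c).
Local Notation E := (cE c).

Lemma ci_open (O : set P) : open O -> open [set x | E x /\ O (i x)].
Proof.
move=> oO; rewrite openE => x [Ex Ox]; apply: filterI.
  exact: (open_nbhs_nbhs (conj (cE_open c) Ex)).
apply: (ci_cts Ex); exact: (open_nbhs_nbhs (conj oO Ox)).
Qed.

Lemma ce_open (A : set X) : open A -> open [set z | bx O2 16 z /\ A (e z)].
Proof.
move=> oA; rewrite openE => z [z16 Az]; apply: filterI.
  exact: (open_nbhs_nbhs (conj (@bx_open _ _ _) z16)).
apply: (ce_cts z16); exact: (open_nbhs_nbhs (conj oA Az)).
Qed.

Lemma ce_compact (K : set P) : compact K -> K `<=` bx O2 16 -> compact (e @` K).
Proof.
move=> cK K16; apply: continuous_compact => //; apply: continuous_in_subspaceT => z.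
by rewrite inE => /K16; exact: ce_cts.
Qed.

Definition core r := e @` cbx r.
Lemma core_compact r : r < 16 -> compact (core r).
Proof. by move=> r16; apply: ce_compact; [exact: cbx_compact|exact: cbx_bx]. Qed.
Lemma core_closed r : r < 16 -> closed (core r).
Proof. by move=> r16; apply: compact_closed => //; exact: core_compact. Qed.
Lemma core_in r x : E x -> cbx r (i x) -> core r x.
Proof. by move=> Ex h; exists (i x) => //; exact: ciK. Qed.
Lemma core_out r x : r < 16 -> core r x -> E x /\ cbx r (i x).
Proof.
move=> r16 [z zr <-]; have z16 : bx O2 16 z by exact: cbx_bx zr.
by rewrite ceK //; split => //; exact: ce_in.
Qed.
Lemma lt816 : (8 : R) < 16. Proof. lra. Qed.

(** [core 8] is compact, hence closed as [X] is Hausdorff, so its complement and the chart form an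
    open cover. The map [p] admits parameters: for isotopies it is the projection [fst]. *)
Lemma chart_glue (T Y : topologicalType) (p : T -> X) (f : T -> Y) (g : T -> Y) : continuous p ->
  (forall t, E (p t) -> continuous_at t f) -> continuous g ->
  (forall t, ~ core 8 (p t) -> f t = g t) -> continuous f.
Proof.
move=> cp cf cg fg t; have [Et|nE] := pselect (E (p t)); first exact: cf.
have nC : ~ core 8 (p t) by move=> /(core_out lt816)[].
have oC : open [set s | ~ core 8 (p s)].
  by apply: (@open_comp _ _ p (~` core 8)) => [s _|]; [exact: cp|apply: closed_openC; exact: core_closed lt816].
have nbC : nbhs t [set s | ~ core 8 (p s)] by exact: open_nbhs_nbhs.
rewrite /continuous_at (fg t nC); apply: (cvg_trans _ (cg t)).
by apply: near_eq_cvg; apply: (filterS _ nbC) => s /fg.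
Qed.

Definition tr (f : P -> P) (x : X) : X := if pselect (E x) then e (f (i x)) else x.

Lemma trE f x : E x -> tr f x = e (f (i x)).
Proof. by rewrite /tr; case: pselect. Qed.
Lemma tr_out f x : ~ E x -> tr f x = x.
Proof. by rewrite /tr; case: pselect. Qed.
Lemma tr_ce (f : P -> P) z : bx O2 16 z -> tr f (e z) = e (f z).
Proof. by move=> z16; rewrite trE ?ceK //; exact: ce_in. Qed.

Lemma fix16 (f : homeo P) z : sup8 f -> bx O2 16 z -> bx O2 16 (f z).
Proof.
move=> f8; apply: fixoff_stable; apply: (fixoffS _ f8); apply: bxS; lra.
Qed.

Lemma tr_fix (O : set P) (f : homeo P) : fixoff O f -> forall x, ~ (E x /\ O (i x)) -> tr f x = x.
Proof.
move=> fO x nx; have [Ex|/tr_out //] := pselect (E x).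
by rewrite trE // fO ?ciK // => Ox; apply: nx.
Qed.

Lemma tr_core (f : homeo P) x : sup8 f -> ~ core 8 x -> tr f x = x.
Proof.
move=> f8 nx; apply: (tr_fix f8) => -[Ex ix]; apply: nx; apply: core_in => //.
exact: bx_cbx ix.
Qed.

Lemma tr_comp (f g : homeo P) : sup8 f -> sup8 g -> tr (f \o g) = tr f \o tr g.
Proof.
move=> f8 g8; apply/funext => x /=; have [Ex|nE] := pselect (E x); last by rewrite !tr_out.
rewrite (trE g Ex) tr_ce ?(trE _ Ex) //; apply: fix16 => //; exact: ci_in.
Qed.

Lemma tr_id : tr id = id.
Proof.
apply/funext => x /=; have [Ex|nE] := pselect (E x); last by rewrite tr_out.
by rewrite trE // ciK.
Qed.

Lemma tr_cts (f : homeo P) : sup8 f -> continuous (tr f).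
Proof.
move=> f8; apply: (@chart_glue X X id _ id) => // [x|x Ex|x|x].
- exact: cvg_id.
- have h : {for x, continuous (e \o (f \o i))}.
    apply: continuous_comp; last by apply: ce_cts; apply: fix16 => //; exact: ci_in.
    by apply: continuous_comp; [exact: ci_cts|exact: hfun_cts].
  have nE : nbhs x E by exact: (open_nbhs_nbhs (conj (cE_open c) Ex)).
  rewrite /continuous_at trE //; apply: (cvg_trans _ h).
  by apply: near_eq_cvg; apply: (filterS _ nE) => y Ey; rewrite trE.
- exact: cvg_id.
- by move=> nx; rewrite tr_core.
Qed.

Lemma tr_can (f : homeo P) : sup8 f -> cancel (tr f) (tr (hinv f)).
Proof.
move=> f8 x; have := congr1 (fun h => h x) (tr_comp (fixoff_opp f8) f8) => /= <-.
have -> : hinv f \o f = id by apply/funext => z /=; rewrite hfunK.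
by rewrite tr_id.
Qed.

Lemma tr_inj (f g : homeo P) : sup8 f -> sup8 g -> tr f = tr g -> f =1 g.
Proof.
move=> f8 g8 fg z; have [z16|nz] := pselect (bx O2 16 z); last first.
  have n8 : ~ bx O2 8 z by move=> h; apply: nz; apply: bxS h; lra.
  by rewrite f8 // g8.
have := congr1 (fun h => i (h (e z))) fg; rewrite /= !tr_ce // !ceK //; exact: fix16.
Qed.

(** The norm in the chart, truncated at 1 so that it extends continuously by 1; [nu x < 1] then
    certifies that [x] lies in the chart. *)
Definition nu (x : X) : R := if pselect (E x) then Num.min 1 (Num.max `|(i x).1| `|(i x).2|) else 1.

Lemma nuE x : E x -> nu x = Num.min 1 (Num.max `|(i x).1| `|(i x).2|).
Proof. by rewrite /nu; case: pselect. Qed.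
Lemma nu_out x : ~ E x -> nu x = 1.
Proof. by rewrite /nu; case: pselect. Qed.

Lemma nu_ce z : bx O2 1 z -> nu (e z) = Num.max `|z.1| `|z.2|.
Proof.
move=> z1; have z16 : bx O2 16 z by apply: bxS z1; lra.
rewrite nuE ?ceK //; last exact: ce_in.
by apply/min_idPr; rewrite ge_max; have /bx_cbx := z1 => /(_ _ (lexx _))[-> ->].
Qed.

Lemma cE0 : E x0.
Proof. by rewrite -{2}(ce0 c); apply: ce_in; exact: bx_self. Qed.
Lemma ci0 : i x0 = O2.
Proof. by rewrite -{2}(ce0 c) ceK //; exact: bx_self. Qed.
Lemma nu0 : nu x0 = 0.
Proof. by rewrite nuE ?ci0 /= ?normr0 ?maxxx ?(min_idPr _) //; exact: cE0. Qed.

Lemma nu_cts : continuous nu.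
Proof.
apply: (@chart_glue X R id _ (fun=> 1)) => // [x|x Ex|x|x nx].
- exact: cvg_id.
- have cm : continuous (fun z : P => Num.min 1 (Num.max `|z.1| `|z.2|)) by cts.
  have h : {for x, continuous ((fun z : P => Num.min 1 (Num.max `|z.1| `|z.2|)) \o i)}.
    by apply: continuous_comp; [exact: ci_cts|exact: cm].
  have nE : nbhs x E by exact: (open_nbhs_nbhs (conj (cE_open c) Ex)).
  rewrite /continuous_at nuE //; apply: (cvg_trans _ h).
  by apply: near_eq_cvg; apply: (filterS _ nE) => y Ey; rewrite nuE.
- exact: cvg_cst.
have [Ex|/nu_out //] := pselect (E x).
rewrite nuE //; apply/min_idPl; rewrite le_max; apply: contrapT => /negP.
rewrite negb_or -!ltNge => /andP[h1 h2]; apply: nx; apply: core_in => //.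
by split; apply: ltW; [apply: (lt_trans h1)|apply: (lt_trans h2)]; lra.
Qed.

Lemma nu_lt1 x : nu x < 1 -> E x /\ bx O2 1 (i x).
Proof.
have [Ex|/nu_out ->] := pselect (E x); last by rewrite ltxx.
rewrite nuE // gt_min ltxx /= gt_max => /andP[h1 h2]; split => //.
by split; rewrite /= subr0.
Qed.

(** Extends paths and isotopies from [[0, 1]] to the line, so that continuity is stated without
    subspaces. *)
Definition clamp (t : R) := Num.min 1 (Num.max 0 t).
Lemma clamp01 t : 0 <= clamp t <= 1. Proof. by rewrite /clamp; maxmin_in; lra. Qed.
Lemma clampE t : 0 <= t <= 1 -> clamp t = t. Proof. by rewrite /clamp; maxmin_in; lra. Qed.

Definition cseg (z w : P) (t : R) : P :=
  ((1 - clamp t) * z.1 + clamp t * w.1, (1 - clamp t) * z.2 + clamp t * w.2).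

Lemma cseg_in r z w t : bx O2 r z -> bx O2 r w -> bx O2 r (cseg z w t).
Proof.
move=> [/=]; rewrite !subr0 => z1 z2 [/=]; rewrite !subr0 => w1 w2.
by split; rewrite /= subr0; apply: cvx_lt => //; exact: clamp01.
Qed.
Lemma cseg0 z w : cseg z w 0 = z.
Proof. by rewrite /cseg clampE ?lexx ?ler01 // subr0 !mul1r !mul0r !addr0; case: z. Qed.
Lemma cseg1 z w : cseg z w 1 = w.
Proof. by rewrite /cseg clampE ?lexx ?ler01 // subrr !mul1r !mul0r !add0r; case: w. Qed.

Lemma ce_cseg_cts z w : bx O2 8 z -> bx O2 8 w -> continuous (fun t => e (cseg z w t)).
Proof.
move=> z8 w8 t; apply: (@continuous_comp _ _ _ (cseg z w) e t).
  move: t; apply: ctsfW; rewrite /cseg /clamp; cts.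
by apply: ce_cts; apply: (bxS _ (cseg_in t z8 w8)); lra.
Qed.

End Charts.

(** * The Alexander isotopy *)

Section Alexander.
Variable R : realType.
Local Notation P := (R * R)%type.
Local Notation O2 := (O2 R).

(** The Alexander trick: [f] conjugated by the dilation of ratio [s], completed by the identity at
    [s = 0]. *)
Definition alex (f : P -> P) (s : R) (z : P) : P :=
  if 0 < s then (s * (f (z.1 / s, z.2 / s)).1, s * (f (z.1 / s, z.2 / s)).2) else z.

Lemma alex_homeo (f : homeo P) (s : R) : sup8 f -> 0 <= s <= 1 ->
  exists2 h : homeo P, sup8 h & hfun h = alex f s.
Proof.
move=> f8 /andP[s0 s1]; rewrite /alex; have [s_gt0|_] := ltP 0 s; last by exists hid.
have sn : s != 0 by rewrite gt_eqF.
have [|m [mE _]] := @aff_ex R (0, 0) (s, 0) (0, s).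
  by rewrite /= mul0r subr0 mulf_neq0.
have mE' z : m z = (s * z.1, s * z.2).
  by rewrite mE /affmap /= !mulr0 !addr0 !add0r ![s * _]mulrC.
have mi z : hinv m z = (z.1 / s, z.2 / s).
  rewrite -[in LHS](_ : m (z.1 / s, z.2 / s) = z) ?hfunK // mE' /=.
  by rewrite ![s * _]mulrC !divfK //; case: z.
exists (hconj m f); last by apply/funext => z /=; rewrite mi mE'.
apply: (fixoff_conj f8) => u [/=]; rewrite !subr0 => u1 u2.
rewrite mE'; split; rewrite /= subr0 normrM (gtr0_norm s_gt0);
  [apply: le_lt_trans u1|apply: le_lt_trans u2]; by rewrite ler_piMl.
Qed.

Lemma alex_near (f : homeo P) (s : R) (z : P) : sup8 f -> 0 <= s ->
  `|(alex f s z).1 - z.1| <= 16 * s /\ `|(alex f s z).2 - z.2| <= 16 * s.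
Proof.
move=> f8 s0; rewrite /alex; case: ltP => [s_gt0|sle].
  have [h1 h2] := @fixoff_small R O2 8 f ltac:(by lra) f8 (z.1 / s, z.2 / s).
  have sn : s != 0 by rewrite gt_eqF.
  have E (a b : R) : s * a - b = (a - b / s) * s by field.
  by split; rewrite /= E normrM (gtr0_norm s_gt0) ler_pM2r //; apply: ltW;
    [apply: (lt_le_trans h1)|apply: (lt_le_trans h2)]; lra.
by rewrite !subrr normr0 mulr_ge0.
Qed.

Lemma ctsV (T : topologicalType) (f : T -> R) : (forall x, f x != 0) -> ctsf f ->
  ctsf (fun x => (f x)^-1).
Proof. by move=> f0 cf x; exact: (cvgV (f0 x) (cf x)). Qed.

(** Where [s] is positive it is replaced locally with [max s (s q0 / 2)], which never vanishes;
    where [s = 0], the displacement bound [16 * s] of [alex_near] gives continuity. *)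
Lemma alex_cts (f : homeo P) : sup8 f ->
  continuous (fun q : P * R => alex f (1 - clamp q.2) q.1).
Proof.
move=> f8 q0; pose s (q : P * R) := 1 - clamp q.2.
have s01 q : 0 <= s q <= 1 by have := clamp01 q.2; rewrite /s; lra.
have cfs : ctsf (fun q : P * R => q.1) by move=> q; exact: cvg_fst.
have csn : ctsf (fun q : P * R => q.2) by move=> q; exact: cvg_snd.
have cs : ctsf s by rewrite /s /clamp; apply: (@ctsD R); [cts|apply: (@ctsN R); apply: (@cts_min R); cts; exact: csn].
have [s_gt0|s_le0] := ltP 0 (s q0).
  pose s' q := Num.max (s q) (s q0 / 2).
  have s'0 q : 0 < s' q by rewrite /s' lt_max; apply/orP; right; rewrite divr_gt0.
  have cs' : ctsf s' by rewrite /s'; apply: (@cts_max R) => //; cts.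
  have cV : ctsf (fun q => (s' q)^-1) by apply: ctsV => // q; rewrite gt_eqF.
  have cB : continuous (fun q => alex f (s' q) q.1).
    have -> : (fun q => alex f (s' q) q.1) = (fun q =>
       (s' q * (f (q.1.1 * (s' q)^-1, q.1.2 * (s' q)^-1)).1, s' q * (f (q.1.1 * (s' q)^-1, q.1.2 * (s' q)^-1)).2)).
      by apply/funext => q; rewrite /alex s'0.
    have c1 : ctsf (fun q : P * R => q.1.1) by exact: (cts_fst cfs).
    have c2 : ctsf (fun q : P * R => q.1.2) by exact: (cts_snd cfs).
    pose w (q : P * R) : P := (q.1.1 * (s' q)^-1, q.1.2 * (s' q)^-1).
    have cw : ctsf w by apply: (@cts_pair R); apply: (@ctsM R).
    have c3 : ctsf (fun q => f (w q)) := cts_comp (@hfun_cts _ f) cw.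
    by apply: (@cts_pair R); apply: (@ctsM R) => //; [exact: (cts_fst c3)|exact: (cts_snd c3)].
  have nb : nbhs q0 [set q | s q0 / 2 < s q].
    apply: open_nbhs_nbhs; split; last by rewrite /=; lra.
    by apply: (@open_comp _ _ s [set t | s q0 / 2 < t]) => [q _|]; [exact: cs|exact: open_gt].
  have sE q : s q0 / 2 < s q -> s' q = s q by move=> h; apply/max_idPl; exact: ltW.
  have E0 : alex f (1 - clamp q0.2) q0.1 = alex f (s' q0) q0.1 by rewrite sE //; lra.
  rewrite /continuous_at E0; apply: (cvg_trans _ (cB q0)).
  apply: near_eq_cvg; apply: (filterS _ nb) => q /= /sE; rewrite /s => ->; by [].
have s0 : s q0 = 0 by have /andP[h _] := s01 q0; apply/eqP; rewrite eq_le h s_le0.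
have E0 : alex f (1 - clamp q0.2) q0.1 = q0.1 by rewrite -/(s q0) s0 /alex ltxx.
rewrite /continuous_at E0 => A /nbhs_bx[e e0 eA].
have n1 : nbhs q0 [set q | bx q0.1 (e / 2) q.1].
  by apply: (cfs q0); apply/nbhs_bx; exists (e / 2); rewrite ?divr_gt0.
have n2 : nbhs q0 [set q | s q < e / 32].
  apply: open_nbhs_nbhs; split; last by rewrite /= s0 divr_gt0.
  by apply: (@open_comp _ _ s [set t | t < e / 32]) => [q _|]; [exact: cs|exact: open_lt].
apply: (filterS _ (filterI n1 n2)) => q [[/= h1 h2] h3]; apply: eA.
have /andP[sq0 _] := s01 q.
have [h4 h5] := @alex_near f (s q) q.1 f8 sq0.
split; [apply: (le_lt_trans (ler_distD q.1.1 _ _)); have := h1|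
        apply: (le_lt_trans (ler_distD q.1.2 _ _)); have := h2]; rewrite /s in h3 h4 h5; lra.
Qed.

Variables (X : topologicalType) (hX : hausdorff_space X) (x0 : X) (U : set X) (c : chart R x0 U).

Lemma tr_isotopy_cts (f : homeo P) : sup8 f ->
  continuous (fun p : X * R => tr c (alex f (1 - clamp p.2)) p.1).
Proof.
move=> f8.
have s01 (t : R) : 0 <= 1 - clamp t <= 1 by have := clamp01 t; lra.
apply: (@chart_glue R X hX x0 U c (X * R)%type X fst _ fst).
- by move=> p; exact: cvg_fst.
- move=> p Ep.
  pose m (q : X * R) : P * R := (ci c q.1, q.2).
  have h0 : {for p, continuous m}.
    have h1 : (ci c q.1) @[q --> p] --> ci c p.1.
      by apply: (cvg_comp fst (ci c)); [exact: cvg_fst|exact: (ci_cts Ep)].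
    have h2 : q.2 @[q --> p] --> p.2 by exact: cvg_snd.
    exact: (cvg_pair h1 h2).
  have h : {for p, continuous (ce c \o ((fun q : P * R => alex f (1 - clamp q.2) q.1) \o m))}.
    apply: continuous_comp; first by apply: continuous_comp => //; exact: alex_cts.
    apply: ce_cts; rewrite /=; have [k k8 <-] := alex_homeo f8 (s01 p.2).
    by apply: fix16 => //; exact: ci_in.
  have nE : nbhs p [set q : X * R | cE c q.1].
    apply: (@cvg_fst _ _ (nbhs p.1) (nbhs p.2)).
    exact: (open_nbhs_nbhs (conj (cE_open c) Ep)).
  rewrite /continuous_at trE //; apply: (cvg_trans _ h).
  by apply: near_eq_cvg; apply: (filterS _ nE) => q Eq; rewrite trE.
- by move=> p; exact: cvg_fst.
move=> p np; have [k k8 <-] := alex_homeo f8 (s01 p.2).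
exact: tr_core.
Qed.

End Alexander.

Section SurfaceCharts.
Local Notation P := (RR * RR)%type.
Variable X : topologicalType.

(** The Alexander isotopy with [s = 1 - t], constant off the compact core. This is how
    homeomorphisms supported in a chart are known to belong to [G]. *)
Lemma tr_Hc0 (hX : hausdorff_space X) (x0 : X) (U : set X) (c : chart RR x0 U) (f : homeo P) :
  sup8 f -> in_Hc0 (tr c f).
Proof.
move=> f8.
have th (h : homeo P) : sup8 h -> is_homeo (tr c h).
  move=> h8; split; first exact: tr_cts.
  exists (tr c (hinv h)); split; last exact: (tr_can c (fixoff_opp h8)).
    exact: (@tr_cts _ _ hX _ _ c (hopp h) (fixoff_opp h8)).
  exact: tr_can.
split; first exact: th.
have s01 (t : RR) : 0 <= 1 - clamp t <= 1 by have := clamp01 t; lra.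
exists (fun x t => tr c (alex f (1 - clamp t)) x), (core c 8); split.
- by apply: continuous_subspaceT; exact: tr_isotopy_cts.
- by move=> t _; have [k k8 <-] := alex_homeo f8 (s01 t); exact: th.
- have -> : alex f (1 - clamp (0 : RR)) = f; last by [].
  apply/funext => z; rewrite clampE ?lexx ?ler01 // subr0 /alex ltr01 !divr1 !mul1r.
  by rewrite -!surjective_pairing.
- have -> : alex f (1 - clamp (1 : RR)) = id; last exact: tr_id.
  by apply/funext => z; rewrite clampE ?lexx ?ler01 // subrr /alex ltxx.
split; first by apply: core_compact; exact: lt816.
move=> t _ x nx; have [k k8 <-] := alex_homeo f8 (s01 t).
exact: tr_core.
Qed.

Lemma chart_ex (x0 : X) (U' : set X) : locally_euclidean2 X -> open U' -> U' x0 ->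
  inhabited (chart RR x0 U').
Proof.
move=> /(_ x0)[U [V [phi [psi [[oU Ux0 oV phiUV] [cphi cpsi psiK phiK]]]]]] oU' U'x0.
have cphi' x : U x -> continuous_at x phi.
  by move=> Ux; move: cphi; rewrite continuous_open_subspace // => /(_ x); rewrite inE; exact.
have cpsi' v : V v -> continuous_at v psi.
  by move=> Vv; move: cpsi; rewrite continuous_open_subspace // => /(_ v); rewrite inE; exact.
have psiU v : V v -> U (psi v) by rewrite -phiUV => -[u Uu <-]; rewrite psiK.
have phiV u : U u -> V (phi u) by move=> Uu; rewrite -phiUV; exists u.
pose p0 := phi x0.
have nW : nbhs p0 [set v | V v /\ U' (psi v)].
  apply: filterI; first by apply: open_nbhs_nbhs; split => //; exact: phiV.
  apply: (cpsi' _ (phiV _ Ux0)); rewrite psiK //; exact: open_nbhs_nbhs.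
have [r r0 rW] := (nbhs_bx _ _).1 nW.
pose k := r / 16; have k0 : 0 < k by rewrite divr_gt0.
have kn : k != 0 by rewrite gt_eqF.
pose a (z : P) : P := (p0.1 + k * z.1, p0.2 + k * z.2).
pose b (v : P) : P := ((v.1 - p0.1) / k, (v.2 - p0.2) / k).
have ab v : a (b v) = v by rewrite /a /b /= ![k * _]mulrC !divfK // ![_ + (_ - _)]addrC !subrK; case: v.
have ba z : b (a z) = z by rewrite /a /b /= ![_ + k * _]addrC !addrK ![k * _]mulrC !mulfK //; case: z.
have ca : ctsf a by rewrite /a; cts.
have cb : ctsf b by rewrite /b; cts.
have a16 z : bx (O2 RR) 16 z -> bx p0 r (a z).
  move=> [/=]; rewrite !subr0 => z1 z2.
  have rE : r = k * 16 by rewrite /k divfK // pnatr_eq0.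
  by split; rewrite /= addrC addKr normrM (gtr0_norm k0) rE ltr_pM2l.
have b16 v : bx p0 r v -> bx (O2 RR) 16 (b v).
  have rE : r = 16 * k by rewrite mulrC /k divfK // pnatr_eq0.
  by move=> [v1 v2]; split; rewrite /= subr0 normrM normfV (gtr0_norm k0) ltr_pdivrMr // -rE.
pose E := [set x | U x /\ bx p0 r (phi x)].
constructor; apply: (@Chart RR X x0 U' (psi \o a) (b \o phi) E).
- rewrite openE => x [Ux xr]; apply: filterI; first exact: open_nbhs_nbhs.
  by apply: (cphi' _ Ux); apply: open_nbhs_nbhs; split => //; exact: bx_open.
- by move=> x [Ux /rW[_]]; rewrite psiK.
- move=> z /a16 az; have [Vz _] := rW _ az; split => /=; first exact: psiU.
  by rewrite phiK.
- by move=> z /a16/rW[Vz _] /=; rewrite phiK // ba.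
- by move=> x [_ /b16].
- by move=> x [Ux _] /=; rewrite ab psiK.
- move=> z /a16/rW[Vz _]; apply: continuous_comp; [exact: ca|exact: cpsi'].
- move=> x [Ux _]; apply: continuous_comp; [exact: cphi'|exact: cb].
- by rewrite /= /a /= !mulr0 !addr0 -surjective_pairing psiK.
Qed.

End SurfaceCharts.

(** * The compact-open topology *)

(** Topologies on [G] are bare families of sets; this filter makes [cover_uniform] applicable to
    them. *)
Definition nbhd_filter (T : Type) (tau : set (set T)) (f : T) : set_system T :=
  [set A | exists W, [/\ tau W, W f & W `<=` A]].

Lemma nbhd_filterP (T : Type) (G : set T) (tau : set (set T)) f :
  topology_on G tau -> G f -> Filter (nbhd_filter tau f).
Proof.
move=> [tG _ tT tI _] Gf; split.
- by exists G; split.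
- move=> A B [W1 [t1 f1 s1]] [W2 [t2 f2 s2]]; exists (W1 `&` W2); split; [exact: tI|by []|].
  by move=> g [/s1 ? /s2 ?].
- by move=> A B AB [W [tW Wf WA]]; exists W; split => // g /WA /AB.
Qed.

Lemma topology_local (T : Type) (G : set T) (tau : set (set T)) (W : set T) :
  topology_on G tau -> (forall f, W f -> nbhd_filter tau f W) -> tau W.
Proof.
move=> [_ _ _ _ tU] H.
have -> : W = \bigcup_(V in [set V | tau V /\ V `<=` W]) V.
  apply/seteqP; split => [f /H[V [tV Vf VW]]|f [V [_ VW] /VW //]].
  by exists V.
by apply: tU => V [].
Qed.

Section CompactOpen.
Variables (X : topologicalType) (G : set (X -> X)).
Hypotheses (hX : hausdorff_space X) (lX : locally_euclidean2 X) (GX : homeo_subgroup G).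
Local Notation P := (RR * RR)%type.
Local Notation co := (compact_open_on G).

Lemma G_inv f : G f -> exists f', [/\ G f', cancel f f' & cancel f' f].
Proof.
case: GX => Gh _ _ Gi Gf; have [_ [g [_ fg gf]]] := Gh f Gf.
by exists g; split => //; exact: (Gi f).
Qed.

Lemma G_cts f : G f -> continuous f.
Proof. by case: GX => Gh _ _ _ /Gh[]. Qed.

Lemma co_topology : topology_on G co.
Proof.
split.
- by move=> W [].
- by split => // f [].
- by split => // f Gf; exists [::]; split.
- move=> W1 W2 [G1 H1] [G2 H2]; split; first by move=> f [/G1].
  move=> f [/H1[s1 [c1 f1 g1]] /H2[s2 [c2 f2 g2]]]; exists (s1 ++ s2); split.
  + by move=> p; rewrite mem_cat => /orP[/c1|/c2].
  + by move=> p; rewrite mem_cat => /orP[/f1|/f2].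
  + move=> g Gg H; split; [apply: g1 => // p ps|apply: g2 => // p ps]; apply: H;
      by rewrite mem_cat ps ?orbT.
- move=> F FF; split; first by move=> f [W /FF[WG _] /WG].
  move=> f [W FW Wf]; have [WG WH] := FF W FW; have [s [c1 f1 g1]] := WH f Wf.
  by exists s; split => // g Gg H; exists W => //; exact: g1.
Qed.

Lemma co_basic K U : compact K -> open U -> co [set f | G f /\ co_sub K U f].
Proof.
move=> cK oU; split; first by move=> f [].
move=> f [Gf fKU]; exists [:: (K, U)]; split.
- by move=> p; rewrite inE => /eqP ->.
- by move=> p; rewrite inE => /eqP ->.
- by move=> g Gg /(_ (K, U) (mem_head _ _)).
Qed.

Lemma co_nbhd K U f : compact K -> open U -> G f -> co_sub K U f ->
  nbhd_filter co f [set g | co_sub K U g].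
Proof.
move=> cK oU Gf fKU; exists [set g | G g /\ co_sub K U g]; split => //.
  exact: co_basic.
by move=> g [].
Qed.

(** Each point of [K] is interior to a compact chart core inside [U]. The filter in use is that of
    compact subsets of [U] growing under inclusion, directed by unions. *)
Lemma compact_thicken K U : compact K -> open U -> K `<=` U ->
  exists L : set X, [/\ compact L, L `<=` U & forall x, K x -> L^° x].
Proof.
move=> cK oU KU.
pose FF : set_system (set X) := filter_from [set L0 : set X | compact L0 /\ L0 `<=` U]
  (fun L0 => [set L | [/\ compact L, L `<=` U & L0 `<=` L]]).
have fFF : Filter FF.
  apply: filter_from_filter; first by exists set0; split => //; exact: compact0.
  move=> L0 L1 [c0 s0] [c1 s1]; exists (L0 `|` L1).
    by split; [exact: compactU|move=> x [/s0|/s1]].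
  by move=> L [cL LU H]; split; split => // x Lx; apply: H; [left|right].
have := cover_uniform (Q := fun L x => L^° x) cK fFF.
case=> [x Kx|L0 [c0 s0] H].
  have [c] := chart_ex lX oU (KU x Kx).
  have oA := @ci_open RR X x U c (bx (O2 RR) 8) (@bx_open _ _ _).
  exists [set y | cE c y /\ bx (O2 RR) 8 (ci c y)], [set L | [/\ compact L, L `<=` U & core c 8 `<=` L]]; split.
  - apply: open_nbhs_nbhs; split => //.
    by split; [exact: cE0|rewrite ci0; exact: bx_self].
  - exists (core c 8) => //; split; first by apply: core_compact; exact: lt816.
    by move=> y /(core_out (lt816 _))[/cE_sub].
  - move=> L y [_ _ HL] Ay; apply: (filterS _ (open_nbhs_nbhs (conj oA Ay))).
    by move=> z [Ez iz]; apply: HL; apply: core_in => //; exact: bx_cbx iz.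
by exists L0; split => //; apply: (H L0 (And3 c0 s0 (@subset_refl _ L0))).
Qed.

Lemma co_mul f g W : G f -> G g -> co W -> W (f \o g) ->
  exists U V, [/\ co U, co V, U f, V g & forall u v, U u -> V v -> W (u \o v)].
Proof.
move=> Gf Gg [WG WH] Wfg; have [s [sc sf sg]] := WH _ Wfg.
have [_ _ coT coI _] := co_topology.
have : exists U V, [/\ co U, co V, U f, V g & forall u v, U u -> V v -> forall p, p \in s -> co_sub p.1 p.2 (u \o v)].
  elim: s sc sf {sg} => [|p s IH] sc sf.
    by exists G, G; split.
  have [|| U [V [cU cV Uf Vg H]]] := IH.
  - by move=> q qs; apply: sc; rewrite inE qs orbT.
  - by move=> q qs; apply: sf; rewrite inE qs orbT.
  have [cK oU] := sc p (mem_head _ _); have fgp := sf p (mem_head _ _).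
  have oU' : open (f @^-1` p.2) by apply: open_comp => // x _; exact: G_cts.
  have cK' : compact (g @` p.1).
    by apply: continuous_compact => //; apply: continuous_subspaceT; exact: G_cts.
  (* The compact [L] between the image of [p.1] under [g] and the preimage of [p.2] under [f]
     decouples the factors: [u] is controlled on [L], and [v] sends [p.1] into its interior. *)
  have [|L [cL LU KL]] := compact_thicken cK' oU'.
    by move=> _ [x Kx <-]; apply: fgp; exists x.
  exists (U `&` [set u | G u /\ co_sub L p.2 u]), (V `&` [set v | G v /\ co_sub p.1 (L^°) v]); split.
  - by apply: coI => //; exact: co_basic.
  - by apply: coI => //; apply: co_basic => //; exact: open_interior.
  - by split => //; split => // _ [x /LU fx <-].
  - by split => //; split => // _ [x Kx <-]; apply: KL; exists x.
  - move=> u v [Uu [Gu uL]] [Vv [Gv vK]] q; rewrite inE => /orP[/eqP ->|]; last exact: H.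
    move=> _ [x Kx <-]; apply: uL; exists (v x) => //; apply: interior_subset; apply: vK.
    by exists x.
move=> [U [V [cU cV Uf Vg H]]]; exists U, V; split => // u v Uu Vv.
case: GX => _ _ Gm _; apply: sg; last exact: H.
by apply: Gm; [have [h _] := cU|have [h _] := cV]; exact: h.
Qed.

(* If [u] is close to [f] on the sphere [nu = 1/2] around [f^-1 y] and at its centre, an arc of [f(small box)] from [u(centre)] cannot leave [u(chart)], as its preimage would cross the sphere. *)
Lemma co_inv_local K U f : compact K -> open U -> G f -> (forall x, K (f x) -> U x) ->
  nbhd_filter co f [set u | forall y, K y -> forall x, G u -> u x = y -> U x].
Proof.
move=> cK oU Gf fKU.
apply: (@cover_uniform X K _ _ (fun u y => forall x, G u -> u x = y -> U x) cK (nbhd_filterP co_topology Gf)).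
move=> y Ky; have [f' [Gf' fK' f'K]] := G_inv Gf.
have Ux : U (f' y) by apply: fKU; rewrite f'K.
have [c] := chart_ex lX oU Ux.
pose e := ce c; pose nuc := nu c.
have cnu : continuous nuc by exact: nu_cts.
have cf := G_cts Gf.
have cf' := G_cts Gf'.
pose S := core c 1 `&` [set x | nuc x = 1 / 2].
have cS : compact S.
  have -> : S = core c 1 `&` nuc @^-1` [set 1 / 2] by [].
  apply: compact_closedI; first by apply: core_compact; lra.
  by apply: preimage_closed => [x _|]; [exact: cnu|exact: closed_eq].
pose M := [set y | nuc (f' y) < 1 / 4].
have oM : open M by apply: (@open_comp _ _ (nuc \o f') [set t | t < 1 / 4]) => [x _|]; [apply: continuous_comp; [exact: cf'|exact: cnu]|exact: open_lt].
pose N := [set y | 1 / 4 < nuc (f' y)].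
have oN : open N by apply: (@open_comp _ _ (nuc \o f') [set t | 1 / 4 < t]) => [x _|]; [apply: continuous_comp; [exact: cf'|exact: cnu]|exact: open_gt].
have nu0 : nuc (f' y) = 0 by exact: nu0.
have q0 : (0 : RR) < 1 / 4 by lra.
exists M, ([set u | co_sub [set f' y] M u] `&` [set u | co_sub S N u]); split.
- by apply: open_nbhs_nbhs; split => //; rewrite /M /= nu0.
- apply: (@filterI _ _ (nbhd_filterP co_topology Gf)).
    apply: co_nbhd => //; first exact: compact_set1.
    by move=> _ [_ -> <-]; rewrite /M /= fK' nu0.
  apply: co_nbhd => // _ [x [_ Sx] <-]; rewrite /N /= fK' Sx; lra.
move=> u y' [ux uS] My' x Gu uxy.
have [u' [Gu' uK' u'K]] := G_inv Gu.
have cu' := G_cts Gu'.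
have Mux : M (u (f' y)) by apply: ux; exists (f' y).
have in14 w : nuc w < 1 / 4 -> cE c w /\ bx (O2 RR) (1 / 4) (ci c w).
  move=> h; have [|Ew [w1 w2]] := @nu_lt1 _ _ _ _ c w; first by apply: (lt_trans h); lra.
  split=> //; move: h; rewrite /nuc nuE // gt_min gt_max => /orP[|/andP[h1 h2]]; first by lra.
  by split; rewrite /= subr0.
have [E0 b0] := in14 _ Mux; have [E1 b1] := in14 _ My'.
pose z0 := ci c (f' (u (f' y))); pose z1 := ci c (f' y').
have b48 : bx (O2 RR) (1 / 4) `<=` bx (O2 RR) 8 by apply: bxS; lra.
have b41 : bx (O2 RR) (1 / 4) `<=` bx (O2 RR) 1 by apply: bxS; lra.
pose h (t : RR) := u' (f (e (cseg z0 z1 t))).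
have ch : continuous h.
  move=> t; apply: (@continuous_comp _ _ _ (fun t => f (e (cseg z0 z1 t))) u'); last exact: cu'.
  apply: (@continuous_comp _ _ _ (fun t => e (cseg z0 z1 t)) f); last exact: cf.
  by apply: ce_cseg_cts; exact: b48.
have h0 : h 0 = f' y by rewrite /h cseg0 /e /z0 ciK // f'K uK'.
have h1 : h 1 = x by rewrite /h cseg1 /e /z1 ciK // f'K -uxy uK'.
suff : nuc x < 1 / 2 by move=> hx; have [|/cE_sub] := @nu_lt1 _ _ _ _ c x; first by apply: (lt_trans hx); lra.
rewrite ltNge; apply/negP => nx.
have cnh : ctsf (fun t => nuc (h t)).
  by move=> t; apply: (@continuous_comp _ _ _ h nuc); [exact: ch|exact: cnu].
have [||T T01 [nT _]] := first_hit (v := 1 / 2) cnh; rewrite ?h0 ?h1 ?nu0 //; first lra.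
have Sh : S (h T).
  split => //; have [|Eh bh] := @nu_lt1 _ _ _ _ c (h T); first by rewrite -/nuc nT; lra.
  by apply: core_in => //; apply: bx_cbx bh.
(* On the other hand [u (h T)] is [f] of a point in the box of radius 1/4, where [nu] is below
   1/4. *)
have : N (u (h T)) by apply: uS; exists (h T).
have sT := cseg_in T b0 b1.
rewrite /N /h /= u'K fK' /nuc nu_ce; last exact: b41.
by rewrite lt_max; case: sT; rewrite /= !subr0 => /ltW; rewrite leNgt => /negbTE -> /ltW; rewrite leNgt => /negbTE ->.
Qed.

Lemma co_inv f finv W : G f -> cancel f finv -> cancel finv f -> co W -> W finv ->
  exists U, co U /\ U f /\ forall u uinv, U u -> G uinv -> cancel u uinv -> cancel uinv u -> W uinv.
Proof.
move=> Gf ff' f'f [WG WH] Wf; have [s [sc sf sg]] := WH _ Wf.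
have FF := nbhd_filterP co_topology Gf.
have : nbhd_filter co f [set u | forall uinv, G u -> G uinv -> cancel u uinv -> cancel uinv u ->
    forall p, p \in s -> co_sub p.1 p.2 uinv].
  apply: (filterS _ (filter_seq (s := s) FF (Q := fun p => [set u | forall y, p.1 y -> forall x, G u -> u x = y -> p.2 x]) _)).
    move=> u H uinv Gu _ _ u'K p ps _ [y Ky <-].
    by apply: (H p ps y Ky (uinv y) Gu); exact: u'K.
  move=> p ps; have [cK oU] := sc p ps; apply: co_inv_local => // x Kx.
  by apply: (sf p ps); exists (f x) => //; exact: ff'.
move=> [U [cU Uf UH]]; exists U; split => //; split => // u uinv Uu Gu' uK u'K.
by apply: sg => //; apply: (UH u Uu) => //; have [h _] := cU; exact: h.
Qed.

Lemma co_hausdorff_group : hausdorff_group_topology G co.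
Proof.
split; first split.
- exact: co_topology.
- by move=> f g Gf Gg W; exact: co_mul.
- by move=> f finv Gf fK f'K W; exact: co_inv.
move=> f g Gf Gg fg.
have [x fgx] : exists x, f x <> g x.
  by apply: contrapT => H; apply: fg; apply/funext => x; apply: contrapT => h; apply: H; exists x.
have := hX; rewrite open_hausdorff => /(_ (f x) (g x)).
case; first exact/eqP.
move=> [A B] /= [/set_mem Af /set_mem Bg] [oA oB /eqP AB].
exists [set h | G h /\ co_sub [set x] A h], [set h | G h /\ co_sub [set x] B h]; split.
- by apply: co_basic => //; exact: compact_set1.
- by apply: co_basic => //; exact: compact_set1.
- by split => // _ [_ -> <-].
- by split => // _ [_ -> <-].
apply/seteqP; split => // h [[_ hA] [_ hB]].
have : (A `&` B) (h x) by split; [apply: hA; exists x|apply: hB; exists x].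
by rewrite AB.
Qed.

End CompactOpen.

(** * Coarser topologies *)

Section Minimality.
Variables (X : topologicalType) (G : set (X -> X)) (sigma : set (set (X -> X))).
Hypotheses (hX : hausdorff_space X) (lX : locally_euclidean2 X) (GX : homeo_subgroup G)
  (GHc0 : forall h, in_Hc0 h -> G h)
  (hsig : hausdorff_group_topology G sigma) (sub : sigma `<=` compact_open_on G).
Local Notation P := (RR * RR)%type.
Local Notation O2 := (O2 RR).
Local Notation co := (compact_open_on G).

Let st : topology_on G sigma. Proof. by case: hsig => -[]. Qed.
Let sG W f : sigma W -> W f -> G f. Proof. by case: st => h _ _ _ _ /h; exact. Qed.
Let sI W V : sigma W -> sigma V -> sigma (W `&` V). Proof. by case: st => _ _ _ h _; exact: h. Qed.
Let Gid : G id. Proof. by case: GX. Qed.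
Let Gm f g : G f -> G g -> G (f \o g). Proof. by case: GX => _ _ h _; exact: h. Qed.

Let s_mul f g W : G f -> G g -> sigma W -> W (f \o g) ->
  exists U V, [/\ sigma U, sigma V, U f, V g & forall u v, U u -> V v -> W (u \o v)].
Proof. by case: hsig => -[_ h _] _ Gf Gg; apply: h. Qed.

Let nid W := sigma W /\ W id.

Let nidI W V : nid W -> nid V -> nid (W `&` V).
Proof. by move=> [sW Wi] [sV Vi]; split => //; exact: sI. Qed.

Let nid_mul W : nid W -> exists2 V, nid V & forall u v, V u -> V v -> W (u \o v).
Proof.
move=> [sW Wi]; have [U [V [sU sV Ui Vi H]]] := s_mul Gid Gid sW Wi.
by exists (U `&` V); [exact: nidI|move=> u v [Uu _] [_ Vv]; exact: H].
Qed.

Let nid_inv W : nid W -> exists2 V, nid V &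
  forall u u', V u -> G u' -> cancel u u' -> cancel u' u -> W u'.
Proof.
case: hsig => -[_ _ h] _ [sW Wi].
have [V [sV [Vi H]]] := h id id Gid (fun _ => erefl) (fun _ => erefl) W sW Wi.
by exists V.
Qed.

Let conj_at a W : G a -> sigma W -> W a -> exists2 V, nid V &
  forall g g', V g -> G g' -> cancel g g' -> cancel g' g -> W (g \o a \o g').
Proof.
move=> Ga sW Wa.
have [U1 [V1 [sU1 sV1 U1a V1i H1]]] := s_mul Ga Gid sW Wa.
have [U2 [V2 [sU2 sV2 U2i V2a H2]]] := s_mul Gid Ga sU1 U1a.
have [V3 nV3 H3] := nid_inv (conj sV1 V1i).
exists (U2 `&` V3); first exact: (nidI (conj sU2 U2i)).
by move=> g g' [U2g V3g] Gg' gK g'K; apply: H1; [exact: H2|exact: (H3 g)].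
Qed.

Let conj_fix h h' W : G h -> G h' -> cancel h' h -> nid W ->
  exists2 V, nid V & forall u, V u -> W (h \o u \o h').
Proof.
move=> Gh Gh' hK [sW Wi].
have W1 : W (h \o h') by have -> : h \o h' = id by apply/funext.
have [U1 [V1 [sU1 sV1 U1a V1i H1]]] := s_mul Gh Gh' sW W1.
have [U2 [V2 [sU2 sV2 U2i V2a H2]]] := s_mul Gh Gid sU1 U1a.
by exists V2 => // u Vu; apply: H1 => //; exact: H2.
Qed.

Let nid_conj W : nid W -> exists2 V, nid V &
  forall g k g', V g -> V k -> G g' -> cancel g g' -> cancel g' g -> W (g \o k \o g').
Proof.
move=> nW; have [V1 nV1 H1] := nid_mul nW; have [V2 nV2 H2] := nid_mul nV1.
have [V3 nV3 H3] := nid_inv nV1.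
exists (V2 `&` V3); first exact: nidI.
move=> g k g' [g2 g3] [k2 _] Gg' gK g'K; apply: H1; first exact: H2.
exact: (H3 g).
Qed.

(** If every [[K, U]] with [K] inside [U] contained a sigma-neighbourhood of the identity, finite
    intersections and left translations would make every compact-open set sigma-open. Translation by
    [f] turns a condition [[K, U]] at [f] into [[K, f^-1 U]] at the identity. *)
Lemma bad_pair : sigma <> co -> exists K U, [/\ compact K, open U, K `<=` U &
  forall W, nid W -> exists g x, [/\ W g, K x & ~ U (g x)]].
Proof.
move=> ne; apply: contrapT => H; apply: ne; apply/seteqP; split => // W [WG WH].
apply: (topology_local st) => f Wf; have Gf := WG f Wf.
have [f' [Gf' fK f'K]] := G_inv GX Gf.
have [s [sc sf sg]] := WH f Wf.
have [V [sV Vi VH]] : nbhd_filter sigma id [set u : X -> X | forall p, p \in s -> co_sub p.1 p.2 (f \o u)].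
  apply: (@filter_seq _ _ _ s (fun p => [set u : X -> X | co_sub p.1 p.2 (f \o u)]) (nbhd_filterP st Gid)).
  move=> p ps; have [cK oU] := sc p ps; apply: contrapT => nV; apply: H.
  exists p.1, (f @^-1` p.2); split => //.
  - by apply: open_comp => // x _; exact: (G_cts GX).
  - by move=> x Kx; apply: (sf p ps); exists x.
  move=> V [sV Vi]; apply: contrapT => H2; apply: nV; exists V; split => // u Vu _ [x Kx <-].
  by apply: contrapT => nU; apply: H2; exists u, x.
have Vff : V (f' \o f) by have -> : f' \o f = id by apply/funext.
have [U1 [V1 [sU1 sV1 U1f V1f HH]]] := s_mul Gf' Gf sV Vff.
exists V1; split => // v V1v; apply: sg; first exact: (sG sV1).
have := VH (f' \o v) (HH _ _ U1f V1v).
by rewrite /mkset; have -> : f \o (f' \o v) = v by apply/funext => x /=; rewrite f'K.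
Qed.

(** Otherwise each point of [K] has a neighbourhood that some sigma-neighbourhood of the identity
    keeps inside [U], and compactness of [K] makes this uniform. *)
Lemma bad_point K U : compact K -> (forall W, nid W -> exists g x, [/\ W g, K x & ~ U (g x)]) ->
  exists2 x0, K x0 & forall W A, nid W -> nbhs x0 A -> exists g x, [/\ W g, A x & ~ U (g x)].
Proof.
move=> cK H; apply: contrapT => nx.
have := cover_uniform (Q := fun g x => U (g x)) cK (nbhd_filterP st Gid).
case=> [x Kx|V [sV Vi HV]].
  apply: contrapT => nA; apply: nx; exists x => // W A [sW Wi] nA'.
  apply: contrapT => H2; apply: nA; exists A, W; split => //; first by exists W; split.
  by move=> g y Wg Ay; apply: contrapT => nU; apply: H2; exists g, y.
have [g [x [Vg Kx]]] := H V (conj sV Vi).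
by apply; apply: HV.
Qed.

(** * The chart at the bad point *)

Section AtBadPoint.
Variables (x0 : X) (U : set X) (c : chart RR x0 U).
Hypothesis bad : forall W A, nid W -> nbhs x0 A -> exists g x, [/\ W g, A x & ~ U (g x)].
Local Notation e := (ce c).
Local Notation i := (ci c).
Local Notation E := (cE c).

Let Gtr (f : homeo P) : sup8 f -> G (tr c f).
Proof. by move=> f8; apply: GHc0; exact: tr_Hc0. Qed.

Let B d := [set x | E x /\ bx O2 d (i x)].

Let B_open d : open (B d). Proof. by apply: ci_open; exact: bx_open. Qed.

Let B_ce d z : d <= 8 -> bx O2 d z -> B d (e z).
Proof.
move=> d8 zd; have z16 : bx O2 16 z by apply: bxS zd; lra.
by split; [exact: ce_in|rewrite ceK].
Qed.

Let stay (A : set X) (h : X -> X) : G h -> (forall x, ~ A x -> h x = x) -> forall x, A x -> A (h x).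
Proof.
move=> Gh hA x Ax; apply: contrapT => nA; apply: (nA).
have [h' [_ hK _]] := G_inv GX Gh.
by have /(can_inj hK) -> := hA _ nA.
Qed.

(** As sigma is coarser than the compact-open topology, finitely many conditions [[K, U]] with [K]
    inside [U] decide. If [x0] is in [U], the box is taken inside [U]; if not, it is taken off the
    closed set [K]. *)
Lemma small_support W : nid W -> exists2 d, 0 < d <= 1 / 4 & forall h, G h ->
  (forall x, ~ B d x -> h x = x) -> W h.
Proof.
move=> [/sub[WG WH] Wi]; have [s [sc sf sg]] := WH id Wi.
have [d d0 Hd] : exists2 d, 0 < d <= 1 / 4 & forall h, G h -> (forall x, ~ B d x -> h x = x) ->
    forall p, p \in s -> co_sub p.1 p.2 h.
  elim: s sc sf {sg} => [|p s IH] sc sf; first by exists (1 / 4) => //; lra.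
  have [d d0 Hd] := IH (fun q qs => sc q (mem_behead (s := p :: s) qs)) (fun q qs => sf q (mem_behead (s := p :: s) qs)).
  have [cK oU] := sc p (mem_head _ _); have fp := sf p (mem_head _ _).
  have KU x : p.1 x -> p.2 x by move=> Kx; apply: fp; exists x.
  have [r r0 Hr] : exists2 r, 0 < r & (forall z, bx O2 r z -> p.2 (e z)) \/ (forall z, bx O2 r z -> ~ p.1 (e z)).
    have b16 : bx O2 16 O2 by exact: bx_self.
    have [Ux|nU] := pselect (p.2 x0).
      have [|r r0 Hr] := open_bx (ce_open (c := c) oU) (z := O2); first by rewrite /= ce0.
      by exists r => //; left => z /Hr[].
    have oK : open (~` p.1) by apply: closed_openC; exact: compact_closed.
    have [|r r0 Hr] := open_bx (ce_open (c := c) oK) (z := O2).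
      by split => //; rewrite ce0 => /KU.
    by exists r => //; right => z /Hr[].
  have [m m0 [md mr]] : exists2 m, 0 < m & m <= d /\ m <= r.
    exists (Num.min d r); first by rewrite lt_min r0 andbT; lra.
    by rewrite !ge_min !lexx orbT.
  exists m; first lra.
  move=> h Gh hB q.
  have hBd x : ~ B d x -> h x = x.
    by move=> nB; apply: hB => -[Ex ix]; apply: nB; split => //; apply: bxS ix.
  rewrite inE => /orP[/eqP ->|]; last exact: Hd.
  move=> _ [x Kx <-]; have [Bx|nB] := pselect (B m x); last by rewrite hB //; exact: KU.
  have eB y : B m y -> bx O2 r (i y) /\ e (i y) = y.
    by move=> [Ey iy]; split; [apply: bxS iy|exact: ciK].
  have [b1 E1] := eB _ Bx; have [b2 E2] := eB _ (stay Gh hB Bx).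
  case: Hr => Hr; first by rewrite -E2; exact: Hr.
  by exfalso; apply: (Hr _ b1); rewrite E1.
by exists d => // h Gh hB; apply: sg => //; exact: Hd.
Qed.

(* If [g] displaced the box, conjugating by [g] one of two noncommuting homeomorphisms supported in it would make them commute. *)
Lemma meets d : 0 < d <= 1 / 4 -> exists2 V, nid V & forall g, V g ->
  exists z w, [/\ bx O2 d z, bx O2 d w & g (e z) = e w].
Proof.
move=> /andP[d0 d1].
have bp : bx O2 d (d / 2, 0) by split; rewrite /= subr0 ?normr0 // ger0_norm; lra.
have bq : bx O2 (d / 2) (d / 4, 0) by split; rewrite /= subr0 ?normr0 ?ger0_norm; lra.
have d40 : d / 4 != 0 by apply/negP => /eqP; lra.
have nbp : ~ bx O2 (d / 2) (d / 2, 0).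
  by move=> [/=]; rewrite subr0 ger0_norm; lra.
have dd : d / 2 <= d by lra.
have d8 : d <= 8 by lra.
(* [a] moves the centre to [(d / 2, 0)], which [b] fixes, while [b] moves the centre to
   [(d / 4, 0)]: the two products differ at the centre. *)
have [a aO a0] := box_push bp; have [b bO' b0] := box_push bq.
have bO : fixoff (bx O2 d) b by apply: (fixoffS _ bO'); exact: bxS.
have a8 : sup8 a by apply: (fixoffS _ aO); exact: bxS.
have b8 : sup8 b by apply: (fixoffS _ bO); exact: bxS.
have Ga := Gtr a8; have Gb := Gtr b8.
have ne : tr c a \o tr c b <> tr c b \o tr c a.
  rewrite -!tr_comp // => /(@tr_inj _ _ _ _ c (hcomp a b) (hcomp b a) (sup8_comp a8 b8) (sup8_comp b8 a8))/(_ O2).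
  rewrite /= b0 a0 (bO' _ nbp) -a0 => /(@hfun_inj _ a) /(congr1 fst) /= /eqP.
  by apply/negP.
have [W1 [W2 [s1 s2 m1 m2 W12]]] := hsig.2 _ _ (Gm Ga Gb) (Gm Gb Ga) ne.
have [A1 [B1 [sA1 sB1 A1a B1b H1]]] := s_mul Ga Gb s1 m1.
have [A2 [B2 [sA2 sB2 A2b B2a H2]]] := s_mul Gb Ga s2 m2.
(* The conjugate [k] of [a] by [g] is still close to [a], so [k b] lies in [W1] and [b k] in the
   disjoint [W2]: they must differ. *)
have [V nV HV] := conj_at Ga (sI sA1 sB2) (conj A1a B2a).
exists V => // g Vg; have Gg := sG nV.1 Vg; have [g' [Gg' gK g'K]] := G_inv GX Gg.
apply: contrapT => nzw.
have disj x : B d x -> ~ B d (g x).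
  move=> [Ex ix] [Ey iy]; apply: nzw; exists (i x), (i (g x)); split => //.
  by rewrite !ciK.
have [A1g B2g] := HV g g' Vg Gg' gK g'K.
pose k := g \o tr c a \o g'.
have [ta tb] : (forall x, ~ B d x -> tr c a x = x) /\ (forall x, ~ B d x -> tr c b x = x).
  by split; exact: tr_fix.
have kout x : ~ B d (g' x) -> k x = x by move=> nB; rewrite /k /= ta // g'K.
have kin x : B d (g' x) -> B d (g' (k x)) by move=> Bx; rewrite /k /= gK; exact: stay.
have kb : k \o tr c b = tr c b \o k.
  apply/funext => x /=; have [Bx|nB] := pselect (B d x).
    have n1 y : B d y -> ~ B d (g' y) by move=> By /disj; rewrite g'K.
    by rewrite !kout //; apply: n1 => //; exact: stay.
  rewrite (tb _ nB); have [Bg|nBg] := pselect (B d (g' x)); last by rewrite kout // tb.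
  by rewrite tb // -[k x]g'K; apply: disj; exact: kin.
have : (W1 `&` W2) (k \o tr c b) by split; [exact: H1|rewrite kb; exact: H2].
by rewrite W12.
Qed.

(* A homeomorphism of [V] carries the small box [B d] to a connected set reaching from [B d] to the sphere; homeomorphisms supported in that set are conjugate to ones supported in [B d]. *)
Lemma reach_sphere W : nid W -> exists f : homeo P,
  [/\ fixoff (bx O2 1) f, W (tr c f) & Num.max `|(f O2).1| `|(f O2).2| = 1 / 2].
Proof.
move=> nW; have [V1 nV1 H1] := nid_mul nW; have [V nV HV] := nid_conj nV1.
have [d /andP[d0 d1] Hd] := small_support (nidI nV nV1).
have [|V2 nV2 HV2] := @meets d; first by rewrite d0.
have d8 : d <= 8 by lra.
have nB : nbhs x0 (B d).
  by apply: open_nbhs_nbhs; split => //; split; [exact: cE0|rewrite ci0; exact: bx_self].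
have [g [x [[Vg V2g] [Ex ix] nUg]]] := bad (nidI nV nV2) nB.
have Gg := sG nV.1 Vg; have [g' [Gg' gK g'K]] := G_inv GX Gg.
have [z2 [z3 [b2 b3 g23]]] := HV2 g V2g.
pose z1 := i x; have b1 : bx O2 d z1 by [].
have bd8 : bx O2 d `<=` bx O2 8 by exact: bxS.
have bd1 : bx O2 d `<=` bx O2 1 by apply: bxS; lra.
(* The image under [g] of the segment from [z2] to [z1]: it starts at [e z3] in the box and ends
   outside [U], so it crosses [nu = 1 / 2]. *)
pose k (t : RR) := g (e (cseg z2 z1 t)).
have ck : continuous k.
  move=> t; apply: (@continuous_comp _ _ _ (fun t => e (cseg z2 z1 t)) g); last exact: (G_cts GX Gg).
  by apply: ce_cseg_cts; exact: bd8.
have cnk : ctsf (fun t => nu c (k t)).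
  by move=> t; apply: (@continuous_comp _ _ _ k (nu c)); [exact: ck|exact: nu_cts].
have k0 : k 0 = e z3 by rewrite /k cseg0.
have k1 : k 1 = g x by rewrite /k cseg1 /z1 ciK.
have n0 : nu c (k 0) < 1 / 2.
  rewrite k0 nu_ce; last exact: bd1.
  by move: b3 => [/=]; rewrite !subr0 gt_max => h2 h3; apply/andP; split; lra.
have n1 : 1 / 2 <= nu c (k 1).
  by rewrite k1 nu_out; [lra|move=> /cE_sub].
have [T /andP[T0 T1] [nT Tle]] := first_hit cnk n0 n1.
have Tc (t : RR) : 0 <= T * clamp t <= T.
  by have /andP[h1 h2] := clamp01 t; rewrite mulr_ge0 // ler_piMr.
have kE (t : RR) : E (k (T * clamp t)) /\ bx O2 1 (i (k (T * clamp t))).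
  by apply: nu_lt1; apply: (le_lt_trans (Tle _ (Tc t))); lra.
pose dd (t : RR) := i (k (T * clamp t)).
have cdd : continuous dd.
  move=> t; apply: (@continuous_comp _ _ _ (fun t => k (T * clamp t)) i); last exact: (ci_cts (kE t).1).
  apply: (@continuous_comp _ _ _ (fun t => T * clamp t) k); last exact: ck.
  by move: t; apply: ctsfW; rewrite /clamp; cts.
have dd0 : dd 0 = z3.
  rewrite /dd clampE ?lexx ?ler01 // mulr0 k0 ceK //; apply: bxS b3; lra.
have dd1 : e (dd 1) = k T.
  by rewrite /dd (ciK (kE 1).1) clampE ?lexx ?ler01 // mulr1.
pose O := bx O2 1 `&` [set z | bx O2 16 z /\ B d (g' (e z))].
have oO : open O.
  apply: openI; first exact: bx_open.
  apply: (ce_open (c := c) (A := [set y | B d (g' y)])); apply: open_comp => // y _; exact: (G_cts GX Gg').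
have ddO t : 0 <= t <= 1 -> O (dd t).
  move=> _; have [E1 I1] := kE t; split => //; split; first by apply: bxS I1; lra.
  by rewrite /dd ciK // /k gK; apply: B_ce => //; exact: cseg_in.
(* [h] is supported in the image of [B d] under [g], so conjugating back by [g] gives a map
   supported in [B d]. Preceded by the push [f1] from the centre to [z3], it carries the centre to
   the sphere. *)
have [h hO] := path_reach oO cdd ler01 ddO; rewrite dd0 => hz3.
have h1 : fixoff (bx O2 1) h by apply: (fixoffS _ hO) => z [].
have h8 : sup8 h by apply: (fixoffS _ h1); apply: bxS; lra.
have Gh := Gtr h8.
have Vh : V1 (tr c h).
  have -> : tr c h = g \o (g' \o tr c h \o g) \o g' by apply/funext => y /=; rewrite !g'K.
  have [Vk _] : (V `&` V1) (g' \o tr c h \o g).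
    apply: Hd => [|y nBy /=]; first by apply: Gm => //; apply: Gm.
    by rewrite (tr_fix hO) ?gK // => -[Eg [_ [_]]]; rewrite ciK // gK.
  exact: HV.
have [f1 f1O f10] := box_push b3.
have f18 : sup8 f1 by apply: fixoffS f1O.
have Vf1 : V1 (tr c f1).
  by have [] := Hd (tr c f1) (Gtr f18) (tr_fix f1O).
exists (hcomp h f1); split.
- by apply: fixoff_comp => //; apply: (fixoffS _ f1O).
- by rewrite tr_comp //; exact: H1.
rewrite /= f10 hz3; have := nT; rewrite -dd1 nu_ce //; have [_] := kE 1; exact.
Qed.

Lemma sphere_compact : compact [set z : P | Num.max `|z.1| `|z.2| = 1 / 2].
Proof.
have -> : [set z : P | Num.max `|z.1| `|z.2| = 1 / 2] =
    cbx 1 `&` (fun z : P => Num.max `|z.1| `|z.2|) @^-1` [set 1 / 2].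
  apply/seteqP; split => z; last by case.
  move=> /= h; split => //; have h1 : Num.max `|z.1| `|z.2| <= 1 by rewrite h; lra.
  by move: h1; rewrite ge_max => /andP[].
apply: compact_closedI; first exact: cbx_compact.
apply: preimage_closed => [z _|]; last exact: closed_eq.
by apply: ctsfW z; cts.
Qed.

(** Compactness of the closed box gives one radius; off the core nothing moves. A point of the box
    whose image is off [K] has a neighbourhood with the same property, where the condition is
    void. *)
Lemma small_moves K A : compact K -> open A -> K `<=` A -> exists2 r, 0 < r & forall f : homeo P,
  sup8 f -> (forall z, bx z r (f z)) -> co_sub K A (tr c f).
Proof.
move=> cK oA KA.
pose FF : set_system RR := filter_from [set r : RR | 0 < r] (fun r => [set t | t <= r]).
have fFF : Filter FF.
  apply: filter_from_filter; first by exists 1; exact: ltr01.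
  move=> r s r0 s0; exists (Num.min r s); first by rewrite /= lt_min r0.
  by move=> t /=; rewrite le_min => /andP[].
have oO := ce_open (c := c) oA.
have := cover_uniform (Q := fun r z => K (e z) -> forall w, bx z r w -> bx O2 16 w /\ A (e w)) (@cbx_compact RR 8) fFF.
case=> [z z8|r r0 Hr].
  have z16 : bx O2 16 z by apply: cbx_bx z8; lra.
  have [Kz|nK] := pselect (K (e z)).
    have [r r0 Hr] := open_bx oO (conj z16 (KA _ Kz)).
    exists (bx z (r / 2)), [set t | t <= r / 2]; split.
    - by apply/nbhs_bx; exists (r / 2) => //; rewrite divr_gt0.
    - by exists (r / 2) => //=; rewrite divr_gt0.
    move=> t y /= tr [y1 y2] _ w [w1 w2]; apply: Hr; split.
      by apply: (le_lt_trans (ler_distD y.1 _ _)); lra.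
    by apply: (le_lt_trans (ler_distD y.2 _ _)); lra.
  have oK : open (~` K) by apply: closed_openC; exact: compact_closed.
  exists [set w | bx O2 16 w /\ (~` K) (e w)], setT; split.
  - by apply: open_nbhs_nbhs; split => //; exact: ce_open.
  - exact: filterT.
  - by move=> t y _ [].
exists r => // f f8 fr _ [x Kx <-].
have [Cx|nC] := pselect (core c 8 x); last by rewrite tr_core //; exact: KA.
have [Ex ix] := core_out (lt816 _) Cx; rewrite trE //.
by have [|] := Hr r (lexx r) (i x) ix _ (f (i x)) (fr _); rewrite ?ciK.
Qed.

Lemma nid_small W : nid W -> exists2 r, 0 < r & forall f : homeo P,
  sup8 f -> (forall z, bx z r (f z)) -> W (tr c f).
Proof.
move=> [/sub[WG WH] Wi]; have [s [sc sf sg]] := WH id Wi.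
have [r r0 Hr] : exists2 r, 0 < r & forall f : homeo P, sup8 f -> (forall z, bx z r (f z)) ->
    forall p, p \in s -> co_sub p.1 p.2 (tr c f).
  elim: s sc sf {sg} => [|p s IH] sc sf; first by exists 1.
  have [r r0 Hr] := IH (fun q qs => sc q (mem_behead (s := p :: s) qs)) (fun q qs => sf q (mem_behead (s := p :: s) qs)).
  have [cK oU] := sc p (mem_head _ _); have fp := sf p (mem_head _ _).
  have [|t t0 Ht] := small_moves cK oU; first by move=> x Kx; apply: fp; exists x.
  exists (Num.min r t); first by rewrite lt_min r0.
  move=> f f8 frt q; rewrite inE => /orP[/eqP ->|].
    by apply: Ht => // z; apply: bxS (frt z); rewrite ge_min lexx orbT.
  by apply: Hr => // z; apply: bxS (frt z); rewrite ge_min lexx.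
by exists r => // f f8 fr; apply: sg; [exact: Gtr|exact: Hr].
Qed.

Let NN : set (set (P -> P)) := [set N | exists2 W, nid W & N = [set f | W (tr c f)]].

(** The first five fields translate sigma through [tr]. For [nn_move], [reach_sphere] gives targets
    that depend on the neighbourhood; [q] is a cluster point of them on the compact sphere. *)
Lemma sigma_group_nbhds : group_nbhds NN.
Proof.
split.
- move=> _ [W nW ->]; have [V nV H] := nid_mul nW.
  exists [set f | V (tr c f)]; first by exists V.
  by move=> f g f8 g8 Vf Vg; rewrite /= tr_comp //; exact: H.
- move=> _ [W nW ->]; have [V nV H] := nid_inv nW.
  exists [set f | V (tr c f)]; first by exists V.
  move=> f f8 Vf; apply: (H _ _ Vf); first exact: (Gtr (fixoff_opp f8)).
    exact: tr_can.
  exact: (tr_can c (fixoff_opp f8)).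
- move=> _ h [W nW ->] h8.
  have h8' := fixoff_opp h8.
  have [V nV H] := conj_fix (Gtr h8) (Gtr h8') (tr_can c h8') nW.
  exists [set f | V (tr c f)]; first by exists V.
  move=> f f8 Vf /=.
  have -> : tr c (h \o (f \o hinv h)) = tr c h \o tr c f \o tr c (hinv h).
    rewrite (@tr_comp _ _ _ _ c h (hcomp f (hopp h))) //; last exact: sup8_comp.
    by rewrite (@tr_comp _ _ _ _ c f (hopp h)).
  exact: H.
- move=> _ _ [W nW ->] [V nV ->]; exists [set f | (W `&` V) (tr c f)] => //.
  by exists (W `&` V) => //; exact: nidI.
- by move=> _ [W /nid_small[r r0 Hr] ->]; exists r.
pose Q W := [set z : P | exists f : homeo P, [/\ fixoff (bx O2 1) f, W (tr c f), f O2 = z &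
  Num.max `|z.1| `|z.2| = 1 / 2]].
pose FF : set_system P := filter_from nid Q.
have fFF : ProperFilter FF.
  apply: filter_from_proper.
    apply: filter_from_filter; first by exists G; split => //; case: st.
    move=> W V nW nV; exists (W `&` V); first exact: nidI.
    by move=> z [f [h1 [h2 h3] h4 h5]]; split; exists f.
  by move=> W /reach_sphere[f [f1 Wf fq]]; exists (f O2); exists f.
have FS : FF [set z : P | Num.max `|z.1| `|z.2| = 1 / 2].
  by exists G; [split => //; case: st|move=> z [f []]].
have [q [qS qcl]] := sphere_compact fFF FS.
have qb : Num.max `|q.1| `|q.2| <= 1 / 2 by rewrite qS.
move: qb; rewrite ge_max => /andP[q1 q2].
exists q; split.
- by split; rewrite /= subr0; [apply: (le_lt_trans q1)|apply: (le_lt_trans q2)]; lra.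
- by move=> q0; move: qS; rewrite q0 /= normr0 maxxx; lra.
move=> _ [W nW ->]; have [V nV HV] := nid_mul nW.
have [d d0 Hd] := nid_small nV.
have [r r0 [r1 rd]] : exists2 r, 0 < r & r <= 1 / 2 /\ 2 * r <= d.
  exists (Num.min (1 / 2) (d / 2)); first by rewrite lt_min !divr_gt0.
  have : Num.min (1 / 2) (d / 2) <= d / 2 by rewrite ge_min lexx orbT.
  by move=> h; split; [rewrite ge_min lexx|lra].
(* A target [z] near [q] is corrected by a push from [z] to [q] that is small, hence in [V]. *)
have [||z [[f [f1 Vf fz zS]] qz]] := qcl (Q V) (bx q r); first by exists V.
  by apply/nbhs_bx; exists r.
have zq : bx z r q by case: qz => ? ?; split; rewrite distrC.
have [k kO kz] := box_push zq.
have zb : Num.max `|z.1| `|z.2| <= 1 / 2 by rewrite zS.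
move: zb; rewrite ge_max => /andP[z1 z2].
have k1 : fixoff (bx O2 1) k.
  apply: (fixoffS _ kO) => w [w1 w2]; split; rewrite /= subr0.
    by have := ler_normD (w.1 - z.1) z.1; rewrite subrK; lra.
  by have := ler_normD (w.2 - z.2) z.2; rewrite subrK; lra.
have b18 : bx O2 1 `<=` bx O2 8 by apply: bxS; lra.
have k8 : sup8 k by apply: fixoffS k1.
have f8 : sup8 f by apply: fixoffS f1.
exists (hcomp k f); split.
- exact: fixoff_comp.
- rewrite /= tr_comp //; apply: HV => //; apply: Hd => // w.
  by apply: (bxS rd); exact: (fixoff_small r0 kO).
- by rewrite /= fz.
Qed.

Lemma bad_point_absurd : False.
Proof.
have [S [S8 [z Sz] HS]] := shear_in_all sigma_group_nbhds.
have ne : id <> tr c S.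
  move=> h; apply: Sz; apply/esym.
  exact: (@tr_inj _ _ _ _ c hid S (@fixoff_id _ _) S8 (etrans (tr_id c) h) z).
have [A [B' [sA sB Ai BS AB]]] := hsig.2 _ _ Gid (Gtr S8) ne.
have : (A `&` B') (tr c S).
  by split => //; apply: (HS [set f | A (tr c f)]); exists A.
by rewrite AB.
Qed.

End AtBadPoint.

Lemma sigma_eq_co : sigma = co.
Proof.
apply: contrapT => /bad_pair[K [U [cK oU KU H]]].
have [x0 Kx0 bad] := bad_point cK H.
have [c] := chart_ex lX oU (KU _ Kx0).
exact: (bad_point_absurd c bad).
Qed.

End Minimality.

Theorem theorem0p1 (X : topologicalType) (G : set (X -> X)) :
  surface_without_boundary X ->
  homeo_subgroup G ->
  (forall h, in_Hc0 h -> G h) ->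
  minimal_group_topology G (compact_open_on G).
Proof.
move=> [hX _ lX] GX GHc0; split; first exact: co_hausdorff_group.
by move=> sigma hsig sub; exact: sigma_eq_co.
Qed.
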